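(* Let $\Sigma$ be a finite alphabet with $\{\mathtt{true},\mathtt{false}\}\subseteq\Sigma$, let $f:\Sigma^\ast\to\{\mathtt{true},\mathtt{false}\}$ be a function, and let $\mathcal T,\mathcal S:\mathbb N\to\mathbb N$ with $\mathcal T,\mathcal S\in\Omega(n)$. (1) If $f$ is $\mathsf{L}$-computable in time $\mathcal T$ and space $\mathcal S$, then $f$ is computable by a Turing machine in time $O(p(\mathcal T(n)))$ for some polynomial $p$ and in space $O(\mathcal S(n))$. (2) If $f$ is computable by a Turing machine in time $\mathcal T$ and space $\mathcal S$, then $f$ is $\mathsf{L}$-computable in time $O(p(\mathcal T(n)))$ for some polynomial $p$ and in space $O(\mathcal S(n))$.
   Context: $\mathsf{L}$ is the deterministic weak call-by-value $\lambda$-calculus. Its terms are given in de Bruijn notation by $s,t,u::= n\mid s\,t\mid \lambda s$ with $n\in\mathbb N$. Substitution $s^k_u$ is defined by $k^k_u=u$, $n^k_u=n$ for $n\neq k$, $(st)^k_u=(s^k_u)(t^k_u)$, $(\lambda s)^k_u=\lambda(s^{k+1}_u)$. Reduction $\succ$ is the least relation such that $(\lambda s)(\lambda t)\succ s^0_{\lambda t}$; if $s\succ s'$ then $st\succ s't$; if $t\succ t'$ then $(\lambda s)t\succ(\lambda s)t'$. The size of a term is $|n|=1+n$, $|\lambda s|=1+|s|$, $|st|=1+|s|+|t|$. If a closed term $s$ reduces as $s=s_0\succ s_1\succ\cdots\succ s_k=\lambda u$ (an abstraction), then $\mathrm{Time}(s):=k$ and $\mathrm{Space}(s):=\max_{0\le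 i\le k}|s_i|$. Strings $x\in\Sigma^\ast$ are encoded as closed $\mathsf{L}$-terms $\ulcorner x\urcorner$ in normal form by a fixed encoding (Scott encoding). A function $f:\Sigma^\ast\to\Sigma^\ast$ is $\mathsf{L}$-computable in time $\mathcal T$ and space $\mathcal S$ if there is an $\mathsf{L}$-term $s_f$ such that for all $x\in\Sigma^\ast$: $s_f\ulcorner x\urcorner\succ^\ast\ulcorner f(x)\urcorner$, $\mathrm{Time}(s_f\ulcorner x\urcorner)\le\mathcal T(|x|)$ and $\mathrm{Space}(s_f\ulcorner x\urcorner)\le\mathcal S(|x|)$. Turing machine time and space are the standard notions. *)

(* Defs.v *)
From mathcomp Require Import all_boot.

Set Implicit Arguments.
Unset Strict Implicit.
Unset Printing Implicit Defensive.

Definition bigO (g h : nat -> nat) : Prop :=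
  exists c n0 : nat, forall n, n0 <= n -> g n <= c * h n.

(* T \in Omega(n) : T n >= c * n eventually, for some c > 0
   (equivalently n <= k * T n eventually, for some natural k). *)
Definition OmegaLin (T : nat -> nat) : Prop :=
  exists k n0 : nat, forall n, n0 <= n -> n <= k * T n.

Definition peval (p : seq nat) (n : nat) : nat :=
  \sum_(i < size p) nth 0 p i * n ^ i.

Inductive term : Type :=
| var : nat -> term
| app : term -> term -> term
| lam : term -> term.

Fixpoint subst (s : term) (k : nat) (u : term) : term :=
  match s with
  | var n => if n == k then u else var n
  | app s1 s2 => app (subst s1 k u) (subst s2 k u)
  | lam s1 => lam (subst s1 k.+1 u)
  end.

Inductive step : term -> term -> Prop :=
| stepBeta s t : step (app (lam s) (lam t)) (subst s 0 (lam t))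
| stepAppL s s' t : step s s' -> step (app s t) (app s' t)
| stepAppR s t t' : step t t' -> step (app (lam s) t) (app (lam s) t').

Fixpoint tsize (s : term) : nat :=
  match s with
  | var n => 1 + n
  | app s1 s2 => 1 + tsize s1 + tsize s2
  | lam s1 => 1 + tsize s1
  end.

Fixpoint bound (k : nat) (s : term) : bool :=
  match s with
  | var n => n < k
  | app s1 s2 => bound k s1 && bound k s2
  | lam s1 => bound k.+1 s1
  end.

Definition closed (s : term) : bool := bound 0 s.

(* s = s_0 > s_1 > ... > s_k = t, with k <= time and |s_i| <= space for
   all i.  Since L is deterministic and abstractions are irreducible,
   when t is an abstraction this says Time(s) <= time and Space(s) <= space. *)
Definition reduces_within (s t : term) (time space : nat) : Prop :=
  exists ls : seq term,
    [/\ 0 < size ls <= time.+1,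
        nth s ls 0 = s /\ nth s ls (size ls).-1 = t,
        (forall i, i.+1 < size ls -> step (nth s ls i) (nth s ls i.+1)) &
        (forall i, i < size ls -> tsize (nth s ls i) <= space)].

(* Scott encoding of strings over a finite alphabet Sig.
   With #|Sig| = m and a the i-th symbol (enum_rank), a is encoded as the
   i-th of m constructors, lambda x_0 ... x_(m-1). x_i;
   nil = \ \ 1, cons a l = \ \ (0 <a> <l>). *)
Definition lams (m : nat) (t : term) : term := iter m lam t.

Definition enc_sym (Sig : finType) (a : Sig) : term :=
  lams #|Sig| (var (#|Sig| - 1 - enum_rank a)).

Fixpoint enc_str (Sig : finType) (x : seq Sig) : term :=
  match x with
  | [::] => lam (lam (var 1))
  | a :: x' => lam (lam (app (app (var 0) (enc_sym a)) (enc_str x')))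
  end.

(* f : Sig^* -> {true,false} (true/false being the symbols tsym/fsym of Sig,
   so f x is the one-letter string [:: tsym] or [:: fsym]) is L-computable
   in time T and space S. *)
Definition L_computable (Sig : finType) (tsym fsym : Sig)
    (f : seq Sig -> bool) (T S : nat -> nat) : Prop :=
  exists sf : term, closed sf /\
    forall x : seq Sig,
      reduces_within (app sf (enc_str x))
                     (enc_str [:: if f x then tsym else fsym])
                     (T (size x)) (S (size x)).

Inductive move : Type := Lmove | Nmove | Rmove.

(* Tape alphabet: input symbols Sig plus extra work symbols W; a cell is
   [None] (blank) or [Some c]. A machine decides by halting in a state q
   with [halt q = Some b], b the output. *)
Record TM (Sig : finType) : Type := {
  tm_state : finType;
  tm_work : finType;
  tm_start : tm_state;
  tm_halt : tm_state -> option bool;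
  tm_delta : tm_state -> option (Sig + tm_work) ->
             tm_state * option (Sig + tm_work) * move
}.

Definition cell (Sig : finType) (M : TM Sig) := option (Sig + tm_work M).

(* configuration: state, cells left of the head (nearest first),
   cell under the head, cells right of the head (nearest first). *)
Definition config (Sig : finType) (M : TM Sig) :=
  (tm_state M * seq (cell M) * cell M * seq (cell M))%type.

Definition tm_step (Sig : finType) (M : TM Sig) (c : config M) : config M :=
  let: (q, l, h, r) := c in
  let: (q', w, m) := @tm_delta Sig M q h in
  match m with
  | Lmove => match l with
             | [::] => (q', [::], None, w :: r)
             | h' :: l' => (q', l', h', w :: r)
             end
  | Nmove => (q', l, w, r)
  | Rmove => match r with
             | [::] => (q', w :: l, None, [::])
             | h' :: r' => (q', w :: l, h', r')
             end
  end.

Definition init_config (Sig : finType) (M : TM Sig) (x : seq Sig) : config M :=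
  match x with
  | [::] => (@tm_start Sig M, [::], None, [::])
  | a :: x' => (@tm_start Sig M, [::], Some (inl a), [seq Some (inl b) | b <- x'])
  end.

Definition cfg_state (Sig : finType) (M : TM Sig) (c : config M) : tm_state M :=
  let: (q, _, _, _) := c in q.

(* number of tape cells visited so far (including the input cells) *)
Definition cfg_size (Sig : finType) (M : TM Sig) (c : config M) : nat :=
  let: (_, l, _, r) := c in size l + 1 + size r.

Definition TM_computes (Sig : finType) (M : TM Sig) (f : seq Sig -> bool)
    (T S : nat -> nat) : Prop :=
  forall x : seq Sig, exists k : nat,
    [/\ k <= T (size x),
        @tm_halt Sig M (cfg_state (iter k (@tm_step Sig M) (init_config M x)))
          = Some (f x),
        (forall j, j < k ->
           @tm_halt Sig M (cfg_state (iter j (@tm_step Sig M) (init_config M x)))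
             = None) &
        (forall j, j <= k ->
           cfg_size (iter j (@tm_step Sig M) (init_config M x)) <= S (size x))].

(* Main.v *)
From HB Require Import structures.
From mathcomp Require Import all_boot zify.
Require Import Defs.

Set Implicit Arguments.
Unset Strict Implicit.
Unset Printing Implicit Defensive.

(** A beta step can be executed by copying its argument, in space linear in the
    current term but with terms that may grow exponentially in the number of
    steps, or by storing the argument on a heap and substituting its address, in
    time and space polynomial in the number of steps but not linear in the size
    of the terms.  Neither strategy alone meets both bounds.  The Turing machine
    therefore tries both on a tape confined to s cells, for increasing s.  An
    attempt takes time polynomial in s and in the number of beta steps even when
    it runs out of cells, and the first s for which one of them succeeds is both
    O(S), by the first strategy, and polynomial in T, by the second.  No time or
    space bound has to be computed.

    Conversely, a configuration of a Turing machine is a tuple of Scott-encoded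
    state, head symbol and half-tapes, on which a transition is a bounded number
    of beta steps that duplicate no half-tape. *)

(** * Reduction in L with time and space bounds *)

(** Linear space for the copying strategy rests on two matches of measure. [tsize] charges a de
    Bruijn index its value, so unary indices keep the code of a term within a constant factor of it;
    and a state of the evaluator, read in reverse Polish notation, has exactly the size of the term
    it denotes. The heap strategy is polynomial because every task, value and heap cell is a piece
    of the initial term with addresses put for variables, and an address counts as one symbol, so no
    piece outgrows that term. A failing attempt stays cheap because the cost of one evaluator step
    is bounded by the state before it, whatever the result would be, and the number of steps is at
    most [1 + 3 * k] for [k] beta steps in either mode. In heap mode the computed string may contain
    unresolved addresses; rather than unfolding it, the evaluated term applies it to closed
    observers from the outset. *)

Inductive red : term -> term -> nat -> nat -> Prop :=
| red_refl s k sp : tsize s <= sp -> red s s k sp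
| red_step s s' t k sp :
    tsize s <= sp -> step s s' -> red s' t k sp -> red s t k.+1 sp.

Lemma red_le s t k sp k' sp' :
  red s t k sp -> k <= k' -> sp <= sp' -> red s t k' sp'.
Proof.
move=> H; elim: H k' => {s t k sp} [s k sp Hs|s s' t k sp Hs st _ IH] k' le le'.
  by apply: red_refl; lia.
case: k' le => // k' le; apply: (red_step _ st); first lia.
by apply: IH; lia.
Qed.

Lemma red_trans s t u k1 k2 sp :
  red s t k1 sp -> red t u k2 sp -> red s u (k1 + k2) sp.
Proof.
elim=> {s t k1 sp} [s k sp Hs|s s' t k sp Hs st _ IH] H.
  by apply: (red_le H); lia.
by rewrite addSn; apply: (red_step Hs st); apply: IH.
Qed.

Lemma red_appL s t u k sp :
  red s t k sp -> red (app s u) (app t u) k (sp + (tsize u).+1).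
Proof.
elim=> {s t k sp} [s k sp Hs|s s' t k sp Hs st _ IH].
  by apply: red_refl => /=; lia.
by apply: (red_step _ _ IH) => /=; [lia | apply: stepAppL].
Qed.

Lemma red_appR s t u k sp :
  red s t k sp -> red (app (lam u) s) (app (lam u) t) k (sp + (tsize u).+2).
Proof.
elim=> {s t k sp} [s k sp Hs|s s' t k sp Hs st _ IH].
  by apply: red_refl => /=; lia.
by apply: (red_step _ _ IH) => /=; [lia | apply: stepAppR].
Qed.

Lemma red_reduces_within s t k sp : red s t k sp -> reduces_within s t k sp.
Proof.
elim=> {s t k sp} [s k sp Hs|s s' t k sp Hs st _ [ls [/andP[Hl Hl'] [H0 Hn] Hst Hsp]]].
  by exists [:: s]; split=> //= -[].
exists (s :: ls); split=> //=.
- split=> //; case: ls Hl {Hl'} H0 Hn {Hst Hsp} => //= x l _ H0 Hn.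
  by rewrite -Hn; apply: set_nth_default.
- move=> [|i] Hi /=.
    by rewrite (set_nth_default s') ?H0 //; lia.
  by rewrite !(set_nth_default s' s) //; [apply: Hst|]; lia.
- move=> [|i] Hi //=.
  by rewrite (set_nth_default s'); [apply: Hsp|]; lia.
Qed.

Lemma reduces_within_red s t k sp : reduces_within s t k sp -> red s t k sp.
Proof.
case=> ls; elim: ls s k => [|x ls IH] s k [/andP[Hl Hl'] [H0 Hn] Hst Hsp] //.
move: H0 => /= E; rewrite {}E in Hn Hst Hsp *.
case: ls IH Hl Hl' Hn Hst Hsp => [|y ls] IH Hl Hl' Hn Hst Hsp.
  by rewrite -Hn; apply: red_refl; apply: (Hsp 0).
case: k Hl' => [|k] Hl'; first by move: Hl'; rewrite /=; lia.
apply: (@red_step _ y); [exact: (Hsp 0)|exact: (Hst 0)|apply: IH].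
split.
- by move: Hl' => /=; lia.
- by split=> //; rewrite -Hn /=; apply: set_nth_default.
- move=> i Hi; have := Hst i.+1 Hi.
  by rewrite /= !(set_nth_default y s) //; move: Hi => /=; lia.
- by move=> i Hi; have := Hsp i.+1 Hi; rewrite /= (set_nth_default y s).
Qed.

Lemma bound_subst k s u : bound k s -> subst s k u = s.
Proof.
elim: s k => [n|s IHs t IHt|s IHs] k /=.
- by case: eqP => // ->; rewrite ltnn.
- by case/andP=> /IHs -> /IHt ->.
- by move/IHs ->.
Qed.

Lemma bound_le k k' s : k <= k' -> bound k s -> bound k' s.
Proof.
elim: s k k' => [n|s IHs t IHt|s IHs] k k' /= le; first lia.
- by case/andP=> /(IHs _ _ le) -> /(IHt _ _ le) ->.
- by apply: IHs.
Qed.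

Lemma closed_bound k s : closed s -> bound k s.
Proof. exact: bound_le. Qed.

Lemma closed_subst k s u : closed s -> subst s k u = s.
Proof. by move/(closed_bound k); apply: bound_subst. Qed.

Lemma tsize_gt0 s : 0 < tsize s. Proof. by case: s => /=. Qed.

Definition is_lam s := if s is lam _ then true else false.

Definition value s := is_lam s && closed s.

Lemma val_closed s : value s -> closed s. Proof. by case/andP. Qed.

Lemma red_beta s v sp :
  is_lam v -> (tsize s).+2 + tsize v <= sp -> tsize (subst s 0 v) <= sp ->
  red (app (lam s) v) (subst s 0 v) 1 sp.
Proof.
case: v => // v _ H H'; apply: (red_step _ (stepBeta s v)); first by rewrite /= in H *; lia.
exact: red_refl.
Qed.

(** * Scott encodings *)

Lemma tsize_lams m s : tsize (lams m s) = m + tsize s.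
Proof. by elim: m => //= m ->; rewrite -/(lams m s); lia. Qed.

Lemma bound_lams m k s : bound k (lams m s) = bound (m + k) s.
Proof. by elim: m k => //= m IH k; rewrite -/(lams m s) IH addnS. Qed.

Lemma subst_lams m s k u : subst (lams m s) k u = lams m (subst s (m + k) u).
Proof. by elim: m k => //= m IH k; rewrite -/(lams m s) IH addnS. Qed.

Definition apps (s : term) (vs : seq term) : term := foldl app s vs.

Definition sizes (vs : seq term) := sumn [seq (tsize v).+1 | v <- vs].

Lemma sizes_cons v vs : sizes (v :: vs) = (tsize v).+1 + sizes vs.
Proof. by []. Qed.

Lemma tsize_apps s vs : tsize (apps s vs) = tsize s + sizes vs.
Proof. by elim: vs s => /= [|v vs IH] s; rewrite ?IH /sizes /=; lia. Qed.

Lemma subst_apps s vs k u :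
  subst (apps s vs) k u = apps (subst s k u) [seq subst v k u | v <- vs].
Proof. by elim: vs s => //= v vs IH s; rewrite -/(apps _ _) IH. Qed.

Lemma bound_apps k s vs : bound k (apps s vs) = bound k s && all (bound k) vs.
Proof.
by elim: vs s => /= [|v vs IH] s; rewrite -?/(apps _ _) ?andbT ?IH //= andbA.
Qed.

Lemma red_apps s t vs k sp :
  red s t k sp -> red (apps s vs) (apps t vs) k (sp + sizes vs).
Proof.
elim: vs s t sp => [|v vs IH] s t sp H /=; first by rewrite addn0.
apply: (red_le (IH _ _ _ (red_appL v H))) => //.
by rewrite /sizes /=; lia.
Qed.

Lemma red_drop_args v vs sp :
  value v -> all value vs -> size vs + tsize v + sizes vs <= sp ->
  red (apps (lams (size vs) v) vs) v (size vs) sp.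
Proof.
move=> vv; elim: vs sp => [|u vs IH] sp /=; first by move=> _ H; apply: red_refl; lia.
case/andP=> vu vvs; rewrite /sizes /= -/(sizes vs) => H.
rewrite -/(apps _ _) -/(lams _ _) -add1n.
apply: (@red_trans _ (apps (lams (size vs) v) vs)); last by apply: IH => //; lia.
have E : subst (lams (size vs) v) 0 u = lams (size vs) v.
  by rewrite subst_lams closed_subst //; apply: val_closed.
have H1 : red (app (lam (lams (size vs) v)) u) (lams (size vs) v) 1
   (size vs + tsize v + tsize u + 2).
  have := @red_beta (lams (size vs) v) u (size vs + tsize v + tsize u + 2).
  rewrite E tsize_lams; apply; [by case/andP: vu|lia|lia].
by apply: (red_le (red_apps vs H1)); lia.
Qed.

(** The first beta step either hits the variable, when [j = 0], and the inserted closed value then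
    discards the other arguments by [red_drop_args], or it only strips a binder and leaves a
    selector for the remaining arguments. *)
Lemma red_select vs j sp :
  all value vs -> j < size vs -> (size vs).*2 + (sizes vs).*2 <= sp ->
  red (apps (lams (size vs) (var (size vs - 1 - j))) vs)
      (nth (var 0) vs j) (size vs) sp.
Proof.
elim: vs j sp => [|u vs IH] j sp //= /andP[vu vvs] Hj.
rewrite /sizes /= -/(sizes vs) => H; rewrite -/(apps _ _) -/(lams _ _).
have lu : is_lam u by case/andP: vu.
have Hb := @red_beta (lams (size vs) (var ((size vs).+1 - 1 - j))) u.
rewrite subst_lams addn0 /= in Hb; rewrite -add1n.
case: j Hj Hb => [|j] Hj Hb /=.
  have E : (size vs).+1 - 1 - 0 = size vs by lia.
  rewrite E eqxx in Hb *.
  apply: (@red_trans _ (apps (lams (size vs) u) vs)).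
    have {}Hb := Hb (size vs + size vs + tsize u + 3) lu.
    rewrite !tsize_lams /= in Hb.
    by apply: (red_le (red_apps vs (Hb _ _))); lia.
  by apply: red_drop_args => //; lia.
have E : (size vs).+1 - 1 - j.+1 = size vs - 1 - j by lia.
have NE : (size vs - 1 - j == size vs) = false by apply/eqP; lia.
rewrite E NE in Hb *.
apply: (@red_trans _ (apps (lams (size vs) (var (size vs - 1 - j))) vs)).
  have {}Hb := Hb (size vs + size vs + tsize u + 3) lu.
  rewrite !tsize_lams /= in Hb.
  by apply: (red_le (red_apps vs (Hb _ _))); lia.
by apply: IH => //; lia.
Qed.

Section Encodings.
Variable Sig : finType.

Lemma closed_enc_sym (a : Sig) : closed (enc_sym a).
Proof.
rewrite /closed /enc_sym bound_lams /=.
by case: #|Sig| (enum_rank a) => [|m] i; [case: i|lia].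
Qed.

Lemma val_enc_sym (a : Sig) : value (enc_sym a).
Proof.
rewrite /value closed_enc_sym andbT /enc_sym.
by case: #|Sig| (enum_rank a) => [|m] i; [case: i|].
Qed.

Lemma tsize_enc_sym (a : Sig) : tsize (enc_sym a) <= #|Sig|.*2.
Proof.
rewrite /enc_sym tsize_lams /=.
by case: #|Sig| (enum_rank a) => [|m] i; [case: i|lia].
Qed.

Lemma val_enc_str (x : seq Sig) : value (enc_str x).
Proof.
rewrite /value; elim: x => //= a x /andP[_ H].
by rewrite /closed /= (closed_bound 2 (closed_enc_sym a)) closed_bound.
Qed.

Lemma closed_enc_str (x : seq Sig) : closed (enc_str x).
Proof. by case/andP: (val_enc_str x). Qed.

Lemma tsize_enc_str (x : seq Sig) :
  tsize (enc_str x) <= (#|Sig|.*2 + 5) * (size x).+1.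
Proof.
elim: x => [|a x IH] /=; first by rewrite muln1; lia.
have := tsize_enc_sym a; move: (tsize _) (tsize _) IH => p q.
by move: (#|Sig|.*2) => m; rewrite mulnS; lia.
Qed.

Definition branches (F : Sig -> term) : seq term := [seq F a | a <- enum Sig].

Lemma red_enc_sym (F : Sig -> term) (a : Sig) sp :
  (forall b, value (F b)) -> #|Sig|.*2 + (sizes (branches F)).*2 <= sp ->
  red (apps (enc_sym a) (branches F)) (F a) #|Sig| sp.
Proof.
move=> vF H; have sF : size (branches F) = #|Sig| by rewrite size_map -cardE.
have := @red_select (branches F) (enum_rank a) sp.
rewrite sF /enc_sym; have -> : nth (var 0) (branches F) (enum_rank a) = F a.
  rewrite (nth_map a) ?nth_enum_rank // -cardE; exact: ltn_ord.
by apply=> //; rewrite all_map; apply/allP=> b _ /=.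
Qed.

Lemma closed_branches (F : Sig -> term) : (forall b, value (F b)) ->
  forall k u, [seq subst v k u | v <- branches F] = branches F.
Proof.
move=> vF k u; rewrite /branches -map_comp; apply: eq_map => b /=.
by rewrite closed_subst //; apply: val_closed.
Qed.

Lemma bound_branches (F : Sig -> term) k :
  (forall b, value (F b)) -> all (bound k) (branches F).
Proof.
move=> vF; rewrite all_map; apply/allP=> b _ /=.
by apply: closed_bound; apply: val_closed.
Qed.

End Encodings.

(** * Simulating Turing machines in L *)

Fixpoint occ (k : nat) (s : term) : nat :=
  match s with
  | var n => n == k
  | app s t => occ k s + occ k t
  | lam s => occ k.+1 s
  end.

Lemma occ_le k s : occ k s <= tsize s.
Proof.
elim: s k => [n|s IHs t IHt|s IHs] k /=; first by case: eqP.
  by have := IHs k; have := IHt k; lia.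
by have := IHs k.+1; lia.
Qed.

Lemma occ_bound k j s : bound k s -> k <= j -> occ j s = 0.
Proof.
elim: s k j => [n|s IHs t IHt|s IHs] k j /=; first by move=> *; apply/eqP; lia.
  by case/andP=> bs bt le; rewrite (IHs k) ?(IHt k).
by move=> bs le; apply: (IHs k.+1).
Qed.

Lemma occ_subst k j s u :
  closed u -> occ j (subst s k u) = if j == k then 0 else occ j s.
Proof.
move=> cu; elim: s k j => [n|s IHs t IHt|s IHs] k j /=.
- case: eqP => [->|nk]; first by rewrite (occ_bound cu) // eq_sym; case: eqP.
  by rewrite /=; case: (j =P k) => // ->; case: eqP.
- by rewrite IHs IHt; case: eqP.
- by rewrite IHs.
Qed.

Lemma tsize_subst s k u : tsize (subst s k u) <= tsize s + occ k s * tsize u.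
Proof.
elim: s k => [n|s IHs t IHt|s IHs] k /=; first by case: eqP => /=; lia.
  by have := IHs k; have := IHt k; nia.
by have := IHs k.+1; lia.
Qed.

Fixpoint substs (body : term) (vs : seq term) : term :=
  if vs is v :: vs' then substs (subst body (size vs') v) vs' else body.

(** Inserting a closed value creates no free occurrence, so the bound [c] for the original body
    persists through the whole chain and each argument is copied at most [c] times. The space is
    therefore linear in the arguments instead of growing with every step. *)
Lemma red_betas_occ c body vs ws sp :
  (forall i, occ i body <= c) -> all value vs ->
  size vs + tsize body + c.+2 * sizes vs + sizes ws <= sp ->
  red (apps (lams (size vs) body) (vs ++ ws)) (apps (substs body vs) ws)
      (size vs) sp.
Proof.
elim: vs body sp => [|v vs IH] body sp occb.
  by move=> _; rewrite (_ : sizes [::] = 0) // => H; apply: red_refl;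
    rewrite tsize_apps; move: H => /=; lia.
case/andP=> vv vvs H /=; rewrite -/(apps _ _) -/(lams _ _) -add1n.
rewrite sizes_cons in H.
rewrite /= mulnDr mulnS !mulSn in H; have Hc := leq0n (c * sizes vs).
have Hs := tsize_subst body (size vs) v.
have Ho := occb (size vs).
have {}Hs : tsize (subst body (size vs) v) <= tsize body + c * tsize v by nia.
apply: (@red_trans _ (apps (lams (size vs) (subst body (size vs) v)) (vs ++ ws))).
  have -> : lams (size vs) (subst body (size vs) v) =
            subst (lams (size vs) body) 0 v by rewrite subst_lams addn0.
  have Sc : sizes (vs ++ ws) = sizes vs + sizes ws.
    by rewrite /sizes map_cat sumn_cat.
  apply: (red_le (red_apps _ (red_beta (sp := size vs + tsize body + c.+1 * tsize v + 2) _ _ _))).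
  - by case/andP: vv.
  - by rewrite tsize_lams mulSn; have := tsize_gt0 v; lia.
  - by rewrite subst_lams tsize_lams addn0 mulSn; lia.
  - by [].
  - by rewrite Sc mulSn; lia.
apply: IH => //; last by lia.
by move=> i; rewrite occ_subst ?(val_closed vv) //; case: eqP.
Qed.

Lemma sizes_cat vs ws : sizes (vs ++ ws) = sizes vs + sizes ws.
Proof. by rewrite /sizes map_cat sumn_cat. Qed.

Lemma size_le_sizes vs : size vs <= sizes vs.
Proof. by elim: vs => //= v vs; rewrite /sizes /=; lia. Qed.

(** Coarse form for fixed program code: a body of size at most [K] contains each variable at most
    [K] times. Since [K] depends on the program only, the space is linear in the size [X] of the
    data. *)
Lemma red_betas K X body vs ws sp :
  tsize body <= K -> all value vs -> sizes (vs ++ ws) <= X ->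
  K.+4 * X.+1 <= sp ->
  red (apps (lams (size vs) body) (vs ++ ws)) (apps (substs body vs) ws)
      (size vs) sp.
Proof.
move=> Hb vvs; rewrite sizes_cat => HX Hsp.
apply: (@red_betas_occ K) => //; last by have := size_le_sizes vs; nia.
by move=> i; have := occ_le i body; lia.
Qed.

(** The constructor of [enc_str] for arbitrary terms. Nothing is shifted, so variables inside [a]
    and [l] have to be written two higher than outside. *)
Definition scons (a l : term) : term := lam (lam (app (app (var 0) a) l)).
Definition snil : term := lam (lam (var 1)).

Lemma tsize_branches (F : finType) (f : F -> term) a :
  tsize (f a) <= sizes (branches f).
Proof.
rewrite /sizes /branches -map_comp /=.
have : a \in enum F by rewrite mem_enum.
elim: (enum F) => //= b s IH; rewrite in_cons => /orP[/eqP <-|/IH]; lia.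
Qed.

Lemma tsize_scons a l : tsize (scons a l) = tsize a + tsize l + 5.
Proof. by rewrite /=; lia. Qed.

Lemma red_case_nil n c ws sp : value n -> value c ->
  3 * sizes (n :: c :: ws) + 10 <= sp ->
  red (apps snil (n :: c :: ws)) (apps n ws) 2 sp.
Proof.
move=> vn vc; rewrite !sizes_cons => H.
have := @red_betas_occ 1 (var 1) [:: n; c] ws sp.
rewrite /= (closed_subst _ _ (val_closed vn)) => red1; apply: red1.
- by case=> [|[|i]].
- by rewrite vn vc.
- by rewrite !sizes_cons (_ : sizes [::] = 0) //; lia.
Qed.

Lemma red_case_cons a l n c ws sp : closed a -> closed l -> value n -> value c ->
  tsize a + tsize l + 3 * sizes (n :: c :: ws) + 10 <= sp ->
  red (apps (scons a l) (n :: c :: ws)) (apps c (a :: l :: ws)) 2 sp.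
Proof.
move=> ca c2 vn vc; rewrite !sizes_cons => H.
have := @red_betas_occ 1 (app (app (var 0) a) l) [:: n; c] ws sp.
rewrite /= !(closed_subst _ _ ca) !(closed_subst _ _ c2) => red1; apply: red1.
- by case=> [|i] /=; rewrite (@occ_bound 0 _ a) ?(@occ_bound 0 _ l).
- by rewrite vn vc.
- by rewrite !sizes_cons (_ : sizes [::] = 0) //; lia.
Qed.

Section TMtoL.
Variables (Sig : finType) (M : TM Sig) (tsym fsym : Sig).

Let Q : finType := tm_state M.
Let G : finType := option (Sig + tm_work M).

Definition answer (b : bool) : term := enc_str [:: if b then tsym else fsym].

Section Branch.
Variables (q : term) (w : term).
(* [z] stands for [run_term]: recursion is by self-application. *)
Definition goto (l h r z : term) : term := apps z [:: z; q; l; h; r].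

(** The branches receive [z] and the other half-tape as arguments instead of capturing them; this
    keeps them closed values, as a Scott case distinction in call-by-value requires. Inside [scons],
    [var 2] is the last argument of the branch seen through two binders. *)
Definition right_nil := lams 2 (goto (scons w (var 2)) (enc_sym (None : G)) snil (var 1)).
Definition right_cons := lams 4 (goto (scons w (var 2)) (var 3) (var 2) (var 1)).
Definition left_nil := lams 2 (goto snil (enc_sym (None : G)) (scons w (var 2)) (var 1)).
Definition left_cons := lams 4 (goto (var 2) (var 3) (scons w (var 2)) (var 1)).

Definition right_body := apps (var 0) [:: right_nil; right_cons; var 2; var 1].
Definition left_body := apps (var 1) [:: left_nil; left_cons; var 2; var 0].
Definition stay_body := goto (var 1) w (var 0) (var 2).

End Branch.

Definition trans_body (q : Q) (a : G) : term :=
  let: (q', w, m) := tm_delta q a in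
  match m with
  | Lmove => left_body (enc_sym (q' : Q)) (enc_sym (w : G))
  | Nmove => stay_body (enc_sym (q' : Q)) (enc_sym (w : G))
  | Rmove => right_body (enc_sym (q' : Q)) (enc_sym (w : G))
  end.

Definition trans_term (q : Q) (a : G) : term := lams 3 (trans_body q a).

Definition state_body (q : Q) : term :=
  if tm_halt q is Some b then answer b
  else apps (apps (var 1) (branches (trans_term q))) [:: var 3; var 2; var 0].

Definition state_term (q : Q) : term := lams 4 (state_body q).

(** A Scott-encoded symbol is its own case distinction: applied to a table of branches it selects
    one. The transition function is thus compiled into a table over states whose entries contain
    tables over head symbols. *)
Definition run_body : term :=
  apps (apps (var 3) (branches state_term)) [:: var 4; var 2; var 1; var 0].

Definition run_term : term := lams 5 run_body.

Definition cfg_term (c : config M) : term :=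
  let: (q, l, h, r) := c in
  apps run_term [:: run_term; enc_sym (q : Q); enc_str (l : seq G);
                    enc_sym (h : G); enc_str (r : seq G)].

Let cs (F : finType) (a : F) := closed_enc_sym a.
Let cl (F : finType) (a : seq F) := closed_enc_str a.

Lemma val_trans q a : value (trans_term q a).
Proof.
rewrite /value /= /closed /= /trans_body.
by case: (tm_delta q a) => [[q' w] []] /=; rewrite ?(closed_bound _ (cs _)).
Qed.

Lemma val_state q : value (state_term q).
Proof.
rewrite /value /= /closed /= /state_body.
case: (tm_halt q) => [b|]; first by rewrite closed_bound // /answer cl.
by rewrite -!/(apps _ _) /= bound_apps bound_branches //; apply: val_trans.
Qed.

Lemma val_run : value run_term.
Proof.
rewrite /value /= /closed /= /run_body -!/(apps _ _) /= bound_apps.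
by rewrite bound_branches //; apply: val_state.
Qed.

Let K := tsize run_term.

Lemma tsize_state q : tsize (state_term q) <= K.
Proof.
rewrite /K /run_term tsize_lams /run_body tsize_apps tsize_apps.
by have := tsize_branches state_term q; lia.
Qed.

Lemma tsize_trans q a : tm_halt q = None -> tsize (trans_term q a) <= K.
Proof.
move=> hq; have := tsize_state q.
rewrite /state_term tsize_lams /state_body hq tsize_apps tsize_apps.
by have := tsize_branches (trans_term q) a; lia.
Qed.


Section Substs.
Variables (q w : term).
Hypotheses (cq : closed q) (cw : closed w).
Let ce (F : finType) (a : F) k u := closed_subst k u (closed_enc_sym a).

Lemma substs_right z l r : closed z -> closed l -> closed r ->
  substs (right_body q w) [:: z; l; r] =
  apps r [:: right_nil q w; right_cons q w; z; l].
Proof. by move=> cz c1 cr; rewrite /= !ce ?closed_subst. Qed.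

Lemma substs_left z l r : closed z -> closed l -> closed r ->
  substs (left_body q w) [:: z; l; r] =
  apps l [:: left_nil q w; left_cons q w; z; r].
Proof. by move=> cz c1 cr; rewrite /= !ce ?closed_subst. Qed.

Lemma substs_stay z l r : closed z -> closed l -> closed r ->
  substs (stay_body q w) [:: z; l; r] = apps z [:: z; q; l; w; r].
Proof. by move=> cz c1 cr; rewrite /= ?closed_subst. Qed.

End Substs.

Lemma substs_run z q l h r :
  closed z -> closed q -> closed l -> closed h -> closed r ->
  substs run_body [:: z; q; l; h; r] =
  apps (apps q (branches state_term)) [:: z; l; h; r].
Proof.
move=> cz cq c1 ch cr; have bs := closed_branches val_state.
by rewrite /= !subst_apps !bs /= !(closed_subst _ _ cz) !(closed_subst _ _ cq)
  !(closed_subst _ _ c1) ?(closed_subst _ _ ch) ?(closed_subst _ _ cr).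
Qed.

Lemma substs_state q z l h r : tm_halt q = None ->
  closed z -> closed l -> closed h -> closed r ->
  substs (state_body q) [:: z; l; h; r] =
  apps (apps h (branches (trans_term q))) [:: z; l; r].
Proof.
move=> hq cz c1 ch cr; have bs := closed_branches (val_trans q).
by rewrite /= /state_body hq /= !subst_apps !bs /= !(closed_subst _ _ cz)
  !(closed_subst _ _ c1) ?(closed_subst _ _ ch) ?(closed_subst _ _ cr).
Qed.

Section Step.
Let kq := #|Q|.*2.
Let kg := #|G|.*2.
Let z := run_term.
(** The shape [K.+4 * X.+1] of [red_betas], with one [X] generous enough for every term that occurs
    during a transition. It is linear in the half-tapes, with coefficients that depend on the
    machine only. *)
Definition step_space (l r : seq G) :=
  K.+4 * (20 * (K + kq + kg + 10) + 5 * (tsize (enc_str l) + tsize (enc_str r))).+1.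
Definition step_time := #|Q| + #|G| + 20.

Let vz : value z. Proof. exact: val_run. Qed.
Let cz : closed z. Proof. exact: val_closed. Qed.
Let vs (F : finType) (a : F) := val_enc_sym a.
Let vl (F : finType) (a : seq F) := val_enc_str a.

Lemma sizes_branches_state : sizes (branches state_term) <= K.
Proof.
by rewrite /K /run_term tsize_lams /run_body tsize_apps tsize_apps; lia.
Qed.

Lemma sizes_branches_trans q : tm_halt q = None -> sizes (branches (trans_term q)) <= K.
Proof.
move=> hq; have := tsize_state q.
by rewrite /state_term tsize_lams /state_body hq tsize_apps tsize_apps; lia.
Qed.

Let sgo (l r : seq G) (X := tsize (enc_str l) + tsize (enc_str r)) n :
  n <= 15 * K + 10 * (kq + kg + 10) + 5 * X + X -> n <= step_space l r.
Proof. by rewrite /step_space -/X; nia. Qed.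

Lemma red_state q l h r :
  red (cfg_term (q, l, h, r))
      (apps (state_term q) [:: z; enc_str (l : seq G); enc_sym (h : G);
                               enc_str (r : seq G)])
      (#|Q| + 5) (step_space l r).
Proof.
set L := enc_str (l : seq G); set R := enc_str (r : seq G).
have cL : closed L by exact: closed_enc_str.
have cR : closed R by exact: closed_enc_str.
have ch := closed_enc_sym (h : G); have cq := closed_enc_sym (q : Q).
have sq : tsize (enc_sym (q : Q)) <= kq := tsize_enc_sym _.
have sh : tsize (enc_sym (h : G)) <= kg := tsize_enc_sym _.
have sz : tsize z = K by [].
have sb := sizes_branches_state.
rewrite addnC.
apply: (@red_trans _ (apps (apps (enc_sym (q : Q)) (branches state_term))
                           [:: z; L; enc_sym (h : G); R])).
  have := @red_betas K (20 * (K + kq + kg + 10) + 5 * (tsize L + tsize R)) run_body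
           [:: z; enc_sym (q : Q); L; enc_sym (h : G); R] [::] (step_space l r).
  rewrite (substs_run cz cq cL ch cR).
  apply=> //.
  - by rewrite -sz tsize_lams; lia.
  - by rewrite /= vz !vs !vl.
  - by rewrite /= !sizes_cons (_ : sizes [::] = 0) //; lia.
have H := @red_enc_sym _ state_term q (kq + K.*2) val_state.
apply: (red_le (red_apps _ (H _))); [by lia|by []|].
by apply: sgo; rewrite -/L -/R !sizes_cons (_ : sizes [::] = 0) //; lia.
Qed.

Lemma red_halt q l h r b : tm_halt q = Some b ->
  red (cfg_term (q, l, h, r)) (answer b) (#|Q| + 9) (step_space l r).
Proof.
move=> hq; set L := enc_str (l : seq G); set R := enc_str (r : seq G).
have sq : tsize (enc_sym (q : Q)) <= kq := tsize_enc_sym _.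
have sh : tsize (enc_sym (h : G)) <= kg := tsize_enc_sym _.
have sz : tsize z = K by [].
rewrite -[9]/(5 + 4) addnA; apply: (red_trans (red_state _ _ _ _)).
have := @red_betas K (20 * (K + kq + kg + 10) + 5 * (tsize L + tsize R)) (state_body q)
         [:: z; L; enc_sym (h : G); R] [::] (step_space l r).
have -> : substs (state_body q) [:: z; L; enc_sym (h : G); R] = answer b.
  rewrite /state_body hq; move: [:: z; _; _; _] => us.
  elim: us => //= u us IH; rewrite closed_subst //; exact: closed_enc_str.
apply=> //.
- by have := tsize_state q; rewrite tsize_lams; lia.
- by rewrite /= vz !vs !vl.
- by rewrite /= !sizes_cons (_ : sizes [::] = 0) //; lia.
Qed.

Lemma red_branch q l h r : tm_halt q = None ->
  red (cfg_term (q, l, h, r))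
      (apps (trans_term q h) [:: z; enc_str (l : seq G); enc_str (r : seq G)])
      (#|Q| + #|G| + 9) (step_space l r).
Proof.
move=> hq; set L := enc_str (l : seq G); set R := enc_str (r : seq G).
have cL : closed L by exact: closed_enc_str.
have cR : closed R by exact: closed_enc_str.
have ch := closed_enc_sym (h : G).
have sh : tsize (enc_sym (h : G)) <= kg := tsize_enc_sym _.
have sz : tsize z = K by [].
have sb' := sizes_branches_trans hq.
apply: (@red_le _ _ ((#|Q| + 5) + (4 + #|G|)) (step_space l r)) => //; last by lia.
apply: (red_trans (red_state _ _ _ _)).
apply: (@red_trans _ (apps (apps (enc_sym (h : G)) (branches (trans_term q)))
                           [:: z; L; R])).
  have := @red_betas K (20 * (K + kq + kg + 10) + 5 * (tsize L + tsize R)) (state_body q)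
           [:: z; L; enc_sym (h : G); R] [::] (step_space l r).
  rewrite (substs_state hq cz cL ch cR).
  apply=> //.
  - by have := tsize_state q; rewrite tsize_lams; lia.
  - by rewrite /= vz !vs !vl.
  - by rewrite /= !sizes_cons (_ : sizes [::] = 0) //; lia.
have H := @red_enc_sym _ (trans_term q) h (kg + K.*2) (val_trans q).
apply: (red_le (red_apps _ (H _))); [by lia|by []|].
by apply: sgo; rewrite -/L -/R !sizes_cons (_ : sizes [::] = 0) //; lia.
Qed.

Lemma red_trans_body q l h r : tm_halt q = None ->
  red (apps (trans_term q h) [:: z; enc_str (l : seq G); enc_str (r : seq G)])
      (cfg_term (tm_step (q, l, h, r))) 11 (step_space l r).
Proof.
move=> hq; set L := enc_str (l : seq G); set R := enc_str (r : seq G).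
have cL : closed L by exact: closed_enc_str.
have cR : closed R by exact: closed_enc_str.
have sz : tsize z = K by [].
have sb := tsize_trans h hq.
pose X := 20 * (K + kq + kg + 10) + 5 * (tsize L + tsize R).
apply: (@red_trans _ (substs (trans_body q h) [:: z; L; R]) _ 3 8).
  apply: (@red_betas K X (trans_body q h) [:: z; L; R] [::] (step_space l r)) => //.
  - by move: sb; rewrite tsize_lams; lia.
  - by rewrite /= vz !vl.
  - by rewrite /= !sizes_cons (_ : sizes [::] = 0) // /X; lia.
have {sb} : tsize (trans_body q h) <= K by move: sb; rewrite tsize_lams; lia.
rewrite /trans_body /tm_step; case: (tm_delta q h) => [[q' w] m].
set eq := enc_sym (q' : Q); set ew := enc_sym (w : G).
have cq : closed eq by exact: closed_enc_sym.
have cw : closed ew by exact: closed_enc_sym.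
have sq : tsize eq <= kq := tsize_enc_sym _.
have sw : tsize ew <= kg := tsize_enc_sym _.
case: m => sb.
- rewrite (substs_left cq cw cz cL cR).
  have vn : value (left_nil eq ew).
    by rewrite /value /closed /= !(closed_bound _ cq) !(closed_bound _ cw)
         (closed_bound _ (closed_enc_sym _)).
  have vc : value (left_cons eq ew).
    by rewrite /value /closed /= !(closed_bound _ cq) !(closed_bound _ cw).
  have [sn sc] : tsize (left_nil eq ew) <= K /\ tsize (left_cons eq ew) <= K.
    by move: sb; rewrite /left_body tsize_apps !sizes_cons; lia.
  case: l @L cL @X => [|h' l] L cL X.
    apply: (@red_trans _ (apps (left_nil eq ew) [:: z; R]) _ 2 6).
      apply: red_case_nil => //; apply: sgo.
      by rewrite -/L -/R !sizes_cons (_ : sizes [::] = 0) //; lia.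
    apply: (@red_le _ _ 2 (step_space [::] r)) => //.
    have := @red_betas K X (goto eq snil (enc_sym (None : G)) (scons ew (var 2)) (var 1))
              [:: z; R] [::] (step_space [::] r).
    have -> : substs (goto eq snil (enc_sym (None : G)) (scons ew (var 2)) (var 1)) [:: z; R]
       = cfg_term (q', [::], None, w :: r).
      rewrite /cfg_term -/eq -/z; move: (z) cz => z' cz'.
      rewrite /= !(closed_subst _ _ cq) !(closed_subst _ _ cw) !(closed_subst _ _ cz').
      by rewrite !(closed_subst _ _ (closed_enc_sym _)).
    apply=> //.
    - by move: sn; rewrite tsize_lams; lia.
    - by rewrite /= vz !vl.
    - by rewrite /= !sizes_cons (_ : sizes [::] = 0) // /X; lia.
  have sL : tsize L = tsize (enc_sym (h' : G)) + tsize (enc_str (l : seq G)) + 5.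
    exact: tsize_scons.
  have sh : tsize (enc_sym (h' : G)) <= kg := tsize_enc_sym _.
  apply: (@red_trans _ (apps (left_cons eq ew)
            [:: enc_sym (h' : G); enc_str (l : seq G); z; R]) _ 2 6).
    apply: (@red_case_cons (enc_sym (h' : G)) (enc_str (l : seq G))) => //.
    apply: sgo.
    by rewrite -/L -/R !sizes_cons (_ : sizes [::] = 0) //; lia.
  apply: (@red_le _ _ 4 (step_space (h' :: l) r)) => //.
  have := @red_betas K X (goto eq (var 2) (var 3) (scons ew (var 2)) (var 1))
            [:: enc_sym (h' : G); enc_str (l : seq G); z; R] [::] (step_space (h' :: l) r).
  have -> : substs (goto eq (var 2) (var 3) (scons ew (var 2)) (var 1))
            [:: enc_sym (h' : G); enc_str (l : seq G); z; R]
     = cfg_term (q', l, h', w :: r).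
    rewrite /cfg_term -/eq -/z; move: (z) cz => z' cz'.
    rewrite /= !(closed_subst _ _ cq) !(closed_subst _ _ cw) !(closed_subst _ _ cz').
    by rewrite !(closed_subst _ _ (closed_enc_sym _)) !(closed_subst _ _ (closed_enc_str _)).
  apply=> //.
  - by move: sc; rewrite tsize_lams; lia.
  - by rewrite /= vz !vl !vs.
  - by rewrite /= !sizes_cons (_ : sizes [::] = 0) // /X; lia.
- rewrite (substs_stay cq cw cz cL cR); apply: red_refl.
  apply: sgo; rewrite -/L -/R tsize_apps !sizes_cons (_ : sizes [::] = 0) //.
  by lia.
- rewrite (substs_right cq cw cz cL cR).
  have vn : value (right_nil eq ew).
    by rewrite /value /closed /= !(closed_bound _ cq) !(closed_bound _ cw)
         (closed_bound _ (closed_enc_sym _)).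
  have vc : value (right_cons eq ew).
    by rewrite /value /closed /= !(closed_bound _ cq) !(closed_bound _ cw).
  have [sn sc] : tsize (right_nil eq ew) <= K /\ tsize (right_cons eq ew) <= K.
    by move: sb; rewrite /right_body tsize_apps !sizes_cons; lia.
  case: r @R cR @X => [|h' r] R cR X.
    apply: (@red_trans _ (apps (right_nil eq ew) [:: z; L]) _ 2 6).
      apply: red_case_nil => //; apply: sgo.
      by rewrite -/L -/R !sizes_cons (_ : sizes [::] = 0) //; lia.
    apply: (@red_le _ _ 2 (step_space l [::])) => //.
    have := @red_betas K X (goto eq (scons ew (var 2)) (enc_sym (None : G)) snil (var 1))
              [:: z; L] [::] (step_space l [::]).
    have -> : substs (goto eq (scons ew (var 2)) (enc_sym (None : G)) snil (var 1)) [:: z; L]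
       = cfg_term (q', w :: l, None, [::]).
      rewrite /cfg_term -/eq -/z; move: (z) cz => z' cz'.
      rewrite /= !(closed_subst _ _ cq) !(closed_subst _ _ cw) !(closed_subst _ _ cz').
      by rewrite !(closed_subst _ _ (closed_enc_sym _)).
    apply=> //.
    - by move: sn; rewrite tsize_lams; lia.
    - by rewrite /= vz !vl.
    - by rewrite /= !sizes_cons (_ : sizes [::] = 0) // /X; lia.
  have sR : tsize R = tsize (enc_sym (h' : G)) + tsize (enc_str (r : seq G)) + 5.
    exact: tsize_scons.
  have sh : tsize (enc_sym (h' : G)) <= kg := tsize_enc_sym _.
  apply: (@red_trans _ (apps (right_cons eq ew)
            [:: enc_sym (h' : G); enc_str (r : seq G); z; L]) _ 2 6).
    apply: (@red_case_cons (enc_sym (h' : G)) (enc_str (r : seq G))) => //.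
    apply: sgo.
    by rewrite -/L -/R !sizes_cons (_ : sizes [::] = 0) //; lia.
  apply: (@red_le _ _ 4 (step_space l (h' :: r))) => //.
  have := @red_betas K X (goto eq (scons ew (var 2)) (var 3) (var 2) (var 1))
            [:: enc_sym (h' : G); enc_str (r : seq G); z; L] [::] (step_space l (h' :: r)).
  have -> : substs (goto eq (scons ew (var 2)) (var 3) (var 2) (var 1))
            [:: enc_sym (h' : G); enc_str (r : seq G); z; L]
     = cfg_term (q', w :: l, h', r).
    rewrite /cfg_term -/eq -/z; move: (z) cz => z' cz'.
    rewrite /= !(closed_subst _ _ cq) !(closed_subst _ _ cw) !(closed_subst _ _ cz').
    by rewrite !(closed_subst _ _ (closed_enc_sym _)) !(closed_subst _ _ (closed_enc_str _)).
  apply=> //.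
  - by move: sc; rewrite tsize_lams; lia.
  - by rewrite /= vz !vl !vs.
  - by rewrite /= !sizes_cons (_ : sizes [::] = 0) // /X; lia.
Qed.

Lemma red_tm_step q l h r : tm_halt q = None ->
  red (cfg_term (q, l, h, r)) (cfg_term (tm_step (q, l, h, r)))
      step_time (step_space l r).
Proof.
(* Unpacking takes 5 beta steps for [run_term] and 4 for the state; the two selections account for
   [#|Q| + #|G|], and the chosen transition needs at most 11. *)
move=> hq; rewrite /step_time -[20]/(9 + 11) addnA.
by apply: (red_trans (red_branch _ _ _ hq)); apply: red_trans_body.
Qed.

Definition space_const := K.+4 * (20 * (K + kq + kg + 10) + 5 * (kg + 5) + 1).

Lemma step_space_le l h q r n :
  cfg_size ((q, l, h, r) : config M) <= n -> step_space l r <= space_const * n.+1.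
Proof.
move=> /= Hn; rewrite /step_space /space_const -mulnA leq_mul2l; apply/orP; right.
have := tsize_enc_str (l : seq G); have := tsize_enc_str (r : seq G).
rewrite -/kg => H1 H2.
have : (kg + 5) * (size l).+1 + (kg + 5) * (size r).+1 <= (kg + 5) * n.+1.
  by rewrite -mulnDr leq_mul2l; apply/orP; right; lia.
set A := 20 * _; have HA : A <= A * n.+1 by rewrite leq_pmulr.
rewrite (_ : (A + 5 * (kg + 5) + 1) * n.+1 = A * n.+1 + 5 * ((kg + 5) * n.+1) + n.+1).
  move: (A * n.+1) ((kg + 5) * n.+1) HA => B C HA HC.
  apply: (@leq_trans (A + 5 * C).+1); last by lia.
  by rewrite ltnS leq_add2l leq_mul2l; apply: leq_trans HC; apply: leq_add.
by rewrite mulnDl mul1n mulnDl mulnA.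
Qed.

(** The additional round in [k.+1] is the one in which the halting state discards the tape and
    returns the answer. *)
Lemma red_tm_run k c b n :
  (forall j, j < k -> tm_halt (cfg_state (iter j (@tm_step Sig M) c)) = None) ->
  tm_halt (cfg_state (iter k (@tm_step Sig M) c)) = Some b ->
  (forall j, j <= k -> cfg_size (iter j (@tm_step Sig M) c) <= n) ->
  red (cfg_term c) (answer b) (k.+1 * step_time) (space_const * n.+1).
Proof.
elim: k c => [|k IH] [[[q l] h] r] Hn Hh Hs.
  apply: (red_le (red_halt _ _ _ Hh)); first by rewrite /step_time; lia.
  exact: (step_space_le (Hs 0 _)).
rewrite mulSn; apply: (red_trans (t := cfg_term (tm_step (q, l, h, r)))).
  apply: (red_le (red_tm_step _ _ _ _)) => //; first exact: (Hn 0).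
  exact: (step_space_le (Hs 0 _)).
apply: IH => [j Hj||j Hj]; rewrite -?iterSr; [exact: Hn|exact: Hh|exact: Hs].
Qed.

End Step.
End TMtoL.

(** * Re-encoding the input over the tape alphabet *)

Lemma conv_arith d n : 20 * d + 3 * ((d + 5) * n.+1) + 12 <= (20 * d + 200) * n.+2.
Proof. by nia. Qed.

Lemma init_arith c d n : 30 <= d ->
  c * n.+1 + 9 * (d * n.+1) + 20 * d <= (c + 10 * d * d) * n.+2.
Proof.
move=> Hd; set P := d * n.+2.
have H1 : d * n.+1 <= P by rewrite leq_mul2l leqnSn orbT.
have H2 : d <= P by rewrite leq_pmulr.
have H3 : 30 * P <= d * P by rewrite leq_mul2r Hd orbT.
rewrite mulnDl (_ : 10 * d * d * n.+2 = 10 * (d * P)); last by rewrite /P !mulnA.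
by rewrite (mulnS c n.+1); lia.
Qed.

Section Conversion.
Variables (Sig : finType) (M : TM Sig) (tsym fsym : Sig).
Let Q : finType := tm_state M.
Let G : finType := option (Sig + tm_work M).
Let z := run_term M tsym fsym.
Let K := tsize z.
Let vz : value z. Proof. exact: val_run. Qed.
Let cz : closed z. Proof. exact: val_closed. Qed.

(** The Scott encoding of a letter has as many binders as its alphabet has symbols. The input must
    therefore be translated letter by letter before it can serve as a half-tape. *)
Definition inj_sym (a : Sig) : G := Some (inl a).
Definition enc_inj (a : Sig) : term := enc_sym (inj_sym a).
(** Reduction is weak, so a [scons] built directly around unevaluated terms would freeze them under
    its binders. Passing both components as arguments forces their evaluation before the cell is
    formed. *)
Definition pair_term := lams 2 (scons (var 3) (var 2)).
Definition conv_nil := lam snil.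
Definition conv_cons := lams 3
  (app (app pair_term (apps (var 2) (branches enc_inj))) (apps (var 0) [:: var 0; var 1])).
Definition conv_term := lams 2 (apps (var 0) [:: conv_nil; conv_cons; var 1]).

Let ve a : value (enc_inj a). Proof. exact: val_enc_sym. Qed.

Lemma val_conv_cons : value conv_cons.
Proof.
by rewrite /value /= /closed /= -/(apps _ _) /= bound_apps /= bound_branches.
Qed.

Lemma val_conv : value conv_term.
Proof.
have /andP[_] := val_conv_cons; rewrite /closed => H.
by rewrite /value /conv_term /= /closed; move: (conv_cons) H => c /= /(@bound_le _ 2) ->.
Qed.

Definition conv_size := tsize conv_term + #|Sig|.*2 + #|G|.*2.
Definition conv_const := 30 * conv_size.+4 * conv_size.+4.
Definition conv_time := #|Sig| + 20.

Lemma substs_conv_cons k a x : closed k -> closed a -> closed x ->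
  substs (app (app pair_term (apps (var 2) (branches enc_inj)))
     (apps (var 0) [:: var 0; var 1])) [:: a; x; k] =
  app (app pair_term (apps a (branches enc_inj))) (apps k [:: k; x]).
Proof.
move=> ck ca cx; have bs := closed_branches ve.
by rewrite /= !subst_apps !bs /= !(closed_subst _ _ cx) !(closed_subst _ _ ca).
Qed.

(** The recursive call is not a tail call: each letter leaves a pending [scons] around it. Such a
    frame has constant size, and the summand [conv_const] gained with each letter pays for it. *)
Lemma red_conv (x : seq Sig) :
  red (apps conv_term [:: conv_term; enc_str x]) (enc_str [seq inj_sym a | a <- x])
      ((size x).+1 * conv_time) (conv_const * (size x).+1).
Proof.
have vc := val_conv; have cc := val_closed vc; have vcc := val_conv_cons.
have sG (a : Sig) : tsize (enc_inj a) <= #|G|.*2 := tsize_enc_sym _.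
have sS (a : Sig) : tsize (enc_sym a) <= #|Sig|.*2 := tsize_enc_sym _.
have scc : tsize conv_cons <= conv_size by rewrite /conv_size /conv_term tsize_lams /=; lia.
have sb : sizes (branches enc_inj) <= conv_size.
  by apply: leq_trans scc; rewrite /conv_cons tsize_lams /= tsize_apps; lia.
have sp : 20 <= conv_size by rewrite /conv_size /conv_term tsize_lams /=; lia.
set k := conv_term in vc cc *; set D := conv_size in scc sb sp *.
have sk : tsize k <= D by rewrite /D /conv_size -/k; lia.
have cle n X : X.+1 <= 30 * D.+4 * n -> D.+4 * X.+1 <= conv_const * n.
  move=> HX; rewrite /conv_const -/D [30 * _ * _]mulnC -[_ * _ * n]mulnA.
  by rewrite leq_mul2l HX orbT.
have c20 : 20 * D + 200 <= conv_const.
  by rewrite /conv_const -/D; move: (D) => d; nia.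
have first y : red (apps k [:: k; enc_str y])
     (apps (enc_str y) [:: conv_nil; conv_cons; k]) 2 (conv_const * (size (y : seq Sig)).+1).
  have := @red_betas D (20 * D + (#|Sig|.*2 + 5) * (size y).+1)
    (apps (var 0) [:: conv_nil; conv_cons; var 1]) [:: k; enc_str y] [::].
  have -> : substs (apps (var 0) [:: conv_nil; conv_cons; var 1]) [:: k; enc_str y] =
     apps (enc_str y) [:: conv_nil; conv_cons; k].
    move/val_closed: vcc => ccc; move: (k) cc (conv_cons) ccc => k' ck' c' cc'.
    by rewrite /= !(closed_subst _ _ ck') !(closed_subst _ _ cc').
  apply=> //.
  - by rewrite /D /conv_size /conv_term tsize_lams; lia.
  - by rewrite /= vc val_enc_str.
  - rewrite /= !sizes_cons (_ : sizes [::] = 0) //.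
    by have := tsize_enc_str y; move: (_ * (size y).+1) => W; lia.
  - apply: cle.
    have H1 : (#|Sig|.*2 + 5) * (size y).+1 <= 2 * (D.+4 * (size y).+1).
      by rewrite mulnA leq_mul2r; apply/orP; right; rewrite /D /conv_size; lia.
    have H2 : D.+4 <= D.+4 * (size y).+1 by rewrite leq_pmulr.
    by rewrite -mulnA; move: (_ * (size y).+1) (D.+4 * (size y).+1) H1 H2 => *; lia.
elim: x => [|a x IH].
  apply: (red_le (red_trans (first [::]) _ (k2 := 3))); [|by rewrite /conv_time /=; lia|by []].
  apply: (@red_trans _ (apps conv_nil [:: k]) _ 2 1).
    apply: red_case_nil => //.
    rewrite -[(size _).+1]/1 muln1 !sizes_cons (_ : sizes [::] = 0) //.
    by have : tsize conv_nil = 5 by []; lia.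
  apply: (@red_beta snil k); first by case/andP: vc.
    by rewrite -[(size _).+1]/1 muln1 (_ : tsize snil = 4) //; lia.
  by rewrite -[(size _).+1]/1 muln1 (_ : tsize (subst _ _ _) = 4) //; lia.
have ca := closed_enc_sym a; have cx := closed_enc_str x.
have Hx := tsize_enc_str x; have Ha := sS a; have Hg := sG a.
have cx2 := closed_enc_str [seq inj_sym a | a <- x].
have Hx2 := tsize_enc_str [seq inj_sym a | a <- x].
rewrite size_map -/G in Hx2.
have SD : #|Sig|.*2 <= D /\ #|G|.*2 <= D by rewrite /D /conv_size; lia.
have Y : 20 * D + 3 * ((D + 5) * (size x).+1) + 12 <= conv_const * (size x).+2.
  by apply: leq_trans (leq_mul c20 (leqnn _)); apply: conv_arith.
have X1 : (#|Sig|.*2 + 5) * (size x).+1 <= (D + 5) * (size x).+1.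
  by rewrite leq_mul2r; lia.
have X2 : (#|G|.*2 + 5) * (size x).+1 <= (D + 5) * (size x).+1.
  by rewrite leq_mul2r; lia.
have {X1}Hx := leq_trans Hx X1; have {X2}Hx2 := leq_trans Hx2 X2.
set W := (D + 5) * (size x).+1 in Y Hx Hx2; set B := conv_const * (size x).+2 in Y *.
have sn : tsize conv_nil = 5 by [].
have sP : tsize (lam (scons (var 3) (var 2))) = 13 by [].
have sk2 : tsize (apps k [:: k; enc_str x]) = (tsize k).*2 + tsize (enc_str x) + 2.
  by rewrite tsize_apps !sizes_cons (_ : sizes [::] = 0) //; lia.
apply: (@red_le _ _ (2 + (2 + (3 + (#|Sig| + (1 + ((size x).+1 * conv_time + 1))))))
          B) => //; last by rewrite /conv_time /=; nia.
apply: (red_trans (first (a :: x))); rewrite -[conv_const * (size (a :: x)).+1]/B.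
apply: (@red_trans _ (apps conv_cons [:: enc_sym a; enc_str x; k])).
  apply: (@red_case_cons (enc_sym a) (enc_str x)) => //.
  by rewrite !sizes_cons (_ : sizes [::] = 0) //; lia.
apply: (@red_trans _ (app (app pair_term (apps (enc_sym a) (branches enc_inj)))
                          (apps k [:: k; enc_str x]))).
  have := @red_betas D (10 * D + (D + 5) * (size x).+1)
     (app (app pair_term (apps (var 2) (branches enc_inj)))
     (apps (var 0) [:: var 0; var 1])) [:: enc_sym a; enc_str x; k] [::].
  rewrite (substs_conv_cons cc ca cx); apply=> //.
  - by move: scc; rewrite /conv_cons tsize_lams; lia.
  - by rewrite /= vc val_enc_sym val_enc_str.
  - by rewrite /= !sizes_cons (_ : sizes [::] = 0) //; lia.
  - apply: cle.
    have H1 : (D + 5) * (size x).+1 <= 2 * (D.+4 * (size x).+2).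
      by rewrite mulnA; apply: leq_mul; lia.
    have H2 : D.+4 <= D.+4 * (size x).+2 by rewrite leq_pmulr.
    by rewrite -mulnA; move: (_ * (size x).+1) (D.+4 * (size x).+2) H1 H2 => *; lia.
apply: (@red_trans _ (app (app pair_term (enc_inj a)) (apps k [:: k; enc_str x]))).
  have Hs : #|Sig|.*2 + (sizes (branches enc_inj)).*2 <= 3 * D by lia.
  apply: (red_le (red_appL _ (red_appR _ (red_enc_sym a ve Hs)))) => //.
  by rewrite sk2 sP; lia.
apply: (@red_trans _ (app (lam (scons (enc_inj a) (var 2))) (apps k [:: k; enc_str x]))).
  have := @red_beta (lam (scons (var 3) (var 2))) (enc_inj a) (#|G|.*2 + 20).
  move=> red1; apply: (red_le (red_appL _ (red1 _ _ _))) => //.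
  - by case/andP: (ve a).
  - by rewrite sP; lia.
  - by rewrite [subst _ _ _]/= [tsize _]/= ; lia.
  - by rewrite sk2; lia.
apply: (@red_trans _ (app (lam (scons (enc_inj a) (var 2)))
                          (enc_str [seq inj_sym a | a <- x]))).
  apply: (red_le (red_appR _ IH)) => //.
  by rewrite /B (mulnS _ (size x).+1) tsize_scons [tsize (var _)]/=; lia.
have := @red_beta (scons (enc_inj a) (var 2)) (enc_str [seq inj_sym a | a <- x]).
have -> : subst (scons (enc_inj a) (var 2)) 0 (enc_str [seq inj_sym a | a <- x]) =
  enc_str [seq inj_sym a | a <- (a :: x)].
  by rewrite /= (closed_subst _ _ (val_closed (ve a))).
apply=> //.
- by case/andP: (val_enc_str [seq inj_sym a | a <- x]).
- by rewrite tsize_scons /=; apply: leq_trans (leq_add (leqnn _) Hx2) _; lia.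
- apply: leq_trans (eq_leq (tsize_scons _ _)) _.
  by rewrite -addnA addnCA; apply: leq_trans (leq_add Hx2 (leq_add Hg (leqnn 5))) _; lia.
Qed.

Definition start_sym : term := enc_sym (@tm_start Sig M : Q).
Definition start_nil :=
  lam (apps (var 0) [:: var 0; start_sym; snil; enc_sym (None : G); snil]).
Definition start_cons :=
  lams 3 (apps (var 0) [:: var 0; start_sym; snil; var 2; var 1]).
Definition start_term := lam (apps (var 0) [:: start_nil; start_cons; z]).
Definition sim_term := lam (app start_term (apps conv_term [:: conv_term; var 0])).

Let cst : closed start_sym. Proof. exact: closed_enc_sym. Qed.

Lemma val_start_nil : value start_nil.
Proof.
rewrite /value /start_nil /closed /= !(closed_bound _ cst).
by rewrite (closed_bound _ (closed_enc_sym _)).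
Qed.

Lemma val_start_cons : value start_cons.
Proof. by rewrite /value /start_cons /closed /= !(closed_bound _ cst). Qed.

Lemma val_start : value start_term.
Proof.
have := val_closed val_start_nil; have := val_closed val_start_cons.
rewrite /value /closed /start_term; move: (start_nil) (start_cons) (z) cz.
by move=> a b c /= /(closed_bound 1) -> /(closed_bound 1) -> /(closed_bound 1) ->.
Qed.

Lemma closed_sim : closed sim_term.
Proof.
have := val_closed val_start; have := val_closed val_conv.
rewrite /closed /sim_term; move: (start_term) (conv_term).
by move=> a b /= /(closed_bound 1) -> /(closed_bound 1) ->.
Qed.

Definition sim_time (n t : nat) := n.+1 * conv_time + t.+1 * step_time M + 10.

Definition start_size := tsize start_term + K + tsize conv_term + #|Sig|.*2 + #|G|.*2 + 30.
Definition sim_space (n s : nat) :=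
  (conv_const + 10 * start_size * start_size) * n.+2 + space_const M tsym fsym * s.+1.

Lemma red_init (x : seq Sig) sp :
  (conv_const + 10 * start_size * start_size) * (size x).+2 <= sp ->
  red (app sim_term (enc_str x)) (cfg_term tsym fsym (@init_config Sig M x))
      (1 + ((size x).+1 * conv_time + (1 + 5))) sp.
Proof.
move=> H; set D := start_size in H; set c := conv_const in H.
have st : tsize start_term <= D by rewrite /D /start_size; lia.
have sz : tsize z <= D by rewrite /D /start_size -/z; lia.
have sc : tsize conv_term <= D by rewrite /D /start_size; lia.
have sn : tsize start_nil <= D by move: st; rewrite /start_term /=; lia.
have sco : tsize start_cons <= D by move: st; rewrite /start_term /=; lia.
have sD : 30 <= D by rewrite /D /start_size; lia.
have sS : #|Sig|.*2 + 5 <= D by rewrite /D /start_size; lia.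
have sG : #|G|.*2 + 5 <= D by rewrite /D /start_size; lia.
have Hx : tsize (enc_str x) <= D * (size x).+1.
  by apply: leq_trans (tsize_enc_str x) _; rewrite leq_mul2r sS orbT.
pose y := [seq inj_sym a | a <- x].
have Hy : tsize (enc_str y) <= D * (size x).+1.
  by apply: leq_trans (tsize_enc_str y) _; rewrite size_map leq_mul2r sG orbT.
set W := D * (size x).+1 in Hx Hy; set B := c * (size x).+1.
have {}H : B + 9 * W + 20 * D <= sp.
  by apply: leq_trans H; apply: init_arith; lia.
have DW : D <= W by rewrite leq_pmulr.
have sB : conv_const * (size x).+1 <= B by [].
have st' : (tsize (apps (var 0) [:: start_nil; start_cons; z])).+1 <= D := st.
have tapp u v : tsize (app u v) = (tsize u + tsize v).+1 by [].
have t0 : tsize (var 0) = 1 by [].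
have sk2 u : tsize (apps conv_term [:: conv_term; u]) = (tsize conv_term).*2 + tsize u + 2.
  by rewrite tsize_apps !sizes_cons (_ : sizes [::] = 0) //; lia.
have cx := closed_enc_str x; have cc := val_closed val_conv.
have cst' := val_closed val_start.
apply: (red_trans (t := app start_term (apps conv_term [:: conv_term; enc_str x]))).
  have := @red_beta (app start_term (apps conv_term [:: conv_term; var 0])) (enc_str x) sp.
  have -> : subst (app start_term (apps conv_term [:: conv_term; var 0])) 0 (enc_str x)
     = app start_term (apps conv_term [:: conv_term; enc_str x]).
    move: (start_term) cst' (conv_term) cc => a ca b cb.
    by rewrite /= !(closed_subst _ _ ca) !(closed_subst _ _ cb).
  apply; first by case/andP: (val_enc_str x).
    by rewrite tapp sk2 t0; lia.
  by rewrite tapp sk2; lia.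
apply: (red_trans (t := app start_term (enc_str y))).
  by apply: (red_le (red_appR _ (red_conv x))) => //; lia.
apply: (red_trans (t := apps (enc_str y) [:: start_nil; start_cons; z])).
  have := @red_beta (apps (var 0) [:: start_nil; start_cons; z]) (enc_str y) sp.
  have -> : subst (apps (var 0) [:: start_nil; start_cons; z]) 0 (enc_str y)
     = apps (enc_str y) [:: start_nil; start_cons; z].
    have c1 := val_closed val_start_nil; have c2 := val_closed val_start_cons.
    move: (start_nil) c1 (start_cons) c2 (z) cz => a ca b cb e ce.
    by rewrite /= !(closed_subst _ _ ca) !(closed_subst _ _ cb) !(closed_subst _ _ ce).
  apply; first by case/andP: (val_enc_str y).
    by rewrite tsize_apps !sizes_cons (_ : sizes [::] = 0) // t0; lia.
  by rewrite tsize_apps !sizes_cons (_ : sizes [::] = 0) //; lia.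
move: (W) (B) H DW Hx Hy {sB} => {}W {}B H DW; rewrite /y; case: x {y cx} => [|a x] Hx Hy.
  apply: (@red_trans _ (apps start_nil [:: z]) _ 2 3).
    apply: red_case_nil; [exact: val_start_nil|exact: val_start_cons|].
    by rewrite !sizes_cons (_ : sizes [::] = 0) //; lia.
  apply: (@red_le _ _ 1 sp) => //.
  have := @red_beta (apps (var 0) [:: var 0; start_sym; snil; enc_sym (None : G); snil]) z sp.
  have -> : subst (apps (var 0) [:: var 0; start_sym; snil; enc_sym (None : G); snil]) 0 z
     = cfg_term tsym fsym (@init_config Sig M [::]).
    rewrite /cfg_term /= -/start_sym -/z; move: (z) cz => z' cz'.
    by rewrite /= !(closed_subst _ _ cst) !(closed_subst _ _ (closed_enc_sym _)).
  apply; first by case/andP: vz.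
    have sn' : (tsize (apps (var 0) [:: var 0; start_sym; snil; enc_sym (None : G); snil])).+1 <= D := sn.
    by lia.
  have : (tsize (apps (var 0) [:: var 0; start_sym; snil; enc_sym (None : G); snil])).+1 <= D := sn.
  have -> : tsize (cfg_term tsym fsym (@init_config Sig M [::])) = tsize z +
    sizes [:: z; start_sym; snil; enc_sym (None : G); snil] by rewrite -tsize_apps.
  by rewrite !tsize_apps !sizes_cons (_ : sizes [::] = 0) //; lia.
have Hy2 : tsize (enc_str [seq inj_sym a0 | a0 <- a :: x]) =
   tsize (enc_inj a) + tsize (enc_str [seq inj_sym a0 | a0 <- x]) + 5.
  exact: tsize_scons.
rewrite Hy2 in Hy.
apply: (@red_trans _ (apps start_cons [:: enc_inj a; enc_str [seq inj_sym a | a <- x]; z]) _ 2 3).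
  apply: (@red_case_cons (enc_inj a) (enc_str [seq inj_sym a | a <- x])).
  - exact: closed_enc_sym.
  - exact: closed_enc_str.
  - exact: val_start_nil.
  - exact: val_start_cons.
  - by rewrite !sizes_cons (_ : sizes [::] = 0) //; lia.
have := @red_betas_occ 2 (apps (var 0) [:: var 0; start_sym; snil; var 2; var 1])
  [:: enc_inj a; enc_str [seq inj_sym a | a <- x]; z] [::] sp.
have -> : substs (apps (var 0) [:: var 0; start_sym; snil; var 2; var 1])
  [:: enc_inj a; enc_str [seq inj_sym a | a <- x]; z] = cfg_term tsym fsym (@init_config Sig M (a :: x)).
  rewrite /cfg_term /= -/start_sym -/z -/(inj_sym a); move: (z) cz => z' cz'.
  rewrite /= !(closed_subst _ _ cst) !(closed_subst _ _ (closed_enc_sym _)).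
  by rewrite !(closed_subst _ _ (closed_enc_str _)).
apply.
- by case=> [|[|[|i]]] /=; rewrite (@occ_bound 0 _ start_sym).
- by rewrite /= vz val_enc_sym val_enc_str.
- rewrite !sizes_cons (_ : sizes [::] = 0) //.
  by move: sco; rewrite /start_cons tsize_lams [size _]/=; lia.
Qed.

Lemma L_computable_of_TM (f : seq Sig -> bool) (T S : nat -> nat) :
  TM_computes M f T S ->
  L_computable tsym fsym f (fun n => sim_time n (T n)) (fun n => sim_space n (S n)).
Proof.
move=> HM; exists sim_term; split; first exact: closed_sim.
move=> x; apply: red_reduces_within; have [k [Hk Hh Hn Hs]] := HM x.
have -> : enc_str [:: if f x then tsym else fsym] = answer tsym fsym (f x) by [].
apply: (@red_le _ _ ((1 + ((size x).+1 * conv_time + (1 + 5))) + k.+1 * step_time M)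
         (sim_space (size x) (S (size x)))) => //.
  apply: red_trans; first by apply: red_init; rewrite /sim_space; lia.
  apply: (red_le (red_tm_run tsym fsym Hn Hh Hs)) => //.
  by rewrite /sim_space; lia.
by rewrite /sim_time; nia.
Qed.

End Conversion.

(** An address stands for a closed abstraction stored on the heap and is therefore inert under
    substitution. *)
Inductive hterm : Type :=
| hvar : nat -> hterm
| hadr : nat -> hterm
| happ : hterm -> hterm -> hterm
| hlam : hterm -> hterm.

Fixpoint hsubst (s : hterm) (k : nat) (u : hterm) : hterm :=
  match s with
  | hvar n => if n == k then u else hvar n
  | hadr a => hadr a
  | happ s1 s2 => happ (hsubst s1 k u) (hsubst s2 k u)
  | hlam s1 => hlam (hsubst s1 k.+1 u)
  end.

(** * Stack machines *)

Inductive ctok := tLam | tRet | tApp | tVar | tAdr | tTick | tSep.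

Definition nat_of_ctok t :=
  match t with tLam => 0 | tRet => 1 | tApp => 2 | tVar => 3 | tAdr => 4 | tTick => 5
  | tSep => 6 end.
Definition ctok_of_nat n :=
  match n with 0 => tLam | 1 => tRet | 2 => tApp | 3 => tVar | 4 => tAdr | 5 => tTick
  | _ => tSep end.
Lemma ctok_ordK :
  cancel (fun t => inord (nat_of_ctok t) : 'I_7) (fun i => ctok_of_nat i).
Proof. by case; rewrite /= inordK. Qed.
HB.instance Definition _ := Finite.copy ctok (can_type ctok_ordK).

Inductive idx := iI | iT | iV | iX | iY | iD | iE | iH | iG | iK.

Definition nat_of_idx i :=
  match i with iI => 0 | iT => 1 | iV => 2 | iX => 3 | iY => 4 | iD => 5 | iE => 6
  | iH => 7 | iG => 8 | iK => 9 end.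
Definition idx_of_nat n :=
  match n with 0 => iI | 1 => iT | 2 => iV | 3 => iX | 4 => iY | 5 => iD | 6 => iE
  | 7 => iH | 8 => iG | _ => iK end.
Lemma idx_ordK :
  cancel (fun t => inord (nat_of_idx t) : 'I_10) (fun i => idx_of_nat i).
Proof. by case; rewrite /= inordK. Qed.
HB.instance Definition _ := Finite.copy idx (can_type idx_ordK).

(** [lLd0] to [lLd2] write the initial task; [lVal] and [lValRet] move an abstraction to the values;
    [lR] unpacks an argument; [lH1] to [lH3] allocate it; [lSub0] to [lClr] substitute, with [lCmpE]
    to [lCp2] treating a variable; [lA1] to [lA5] follow an address; [lFin] and [lFin1] read the
    verdict. *)
Inductive lab := lLd0 | lLd1 | lLd2 | lMain | lVal | lValRet | lR
  | lH1 | lH2 | lH3 | lSub0 | lSub | lAdr | lCmpE | lCmpD | lCmpEnd | lMisE | lMisY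
  | lHit | lCp1 | lCp2 | lSubLam | lSubEnd | lClr | lA1 | lA2 | lA3 | lA4 | lA5
  | lFin | lFin1.

Definition nat_of_lab l :=
  match l with
  | lLd0 => 0 | lLd1 => 1 | lLd2 => 2 | lMain => 3 | lVal => 4 | lValRet => 5 | lR => 6
  | lH1 => 7 | lH2 => 8 | lH3 => 9 | lSub0 => 10 | lSub => 11 | lAdr => 12 | lCmpE => 13
  | lCmpD => 14 | lCmpEnd => 15 | lMisE => 16 | lMisY => 17 | lHit => 18 | lCp1 => 19
  | lCp2 => 20 | lSubLam => 21 | lSubEnd => 22 | lClr => 23 | lA1 => 24 | lA2 => 25
  | lA3 => 26 | lA4 => 27 | lA5 => 28 | lFin => 29 | lFin1 => 30
  end.
Definition lab_of_nat n :=
  match n with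
  | 0 => lLd0 | 1 => lLd1 | 2 => lLd2 | 3 => lMain | 4 => lVal | 5 => lValRet | 6 => lR
  | 7 => lH1 | 8 => lH2 | 9 => lH3 | 10 => lSub0 | 11 => lSub | 12 => lAdr | 13 => lCmpE
  | 14 => lCmpD | 15 => lCmpEnd | 16 => lMisE | 17 => lMisY | 18 => lHit | 19 => lCp1
  | 20 => lCp2 | 21 => lSubLam | 22 => lSubEnd | 23 => lClr | 24 => lA1 | 25 => lA2
  | 26 => lA3 | 27 => lA4 | 28 => lA5 | 29 => lFin | _ => lFin1
  end.
Lemma lab_ordK :
  cancel (fun t => inord (nat_of_lab t) : 'I_31) (fun i => lab_of_nat i).
Proof. by case; rewrite /= inordK. Qed.
HB.instance Definition _ := Finite.copy lab (can_type lab_ordK).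

Record stacks (A : Type) := Stk {
  sI : seq A; sT : seq A; sV : seq A; sX : seq A; sY : seq A;
  sD : seq A; sE : seq A; sH : seq A; sG : seq A; sK : seq A }.

Definition get A (s : stacks A) (i : idx) : seq A :=
  match i with
  | iI => sI s | iT => sT s | iV => sV s | iX => sX s | iY => sY s
  | iD => sD s | iE => sE s | iH => sH s | iG => sG s | iK => sK s
  end.

Definition set A (s : stacks A) (i : idx) (v : seq A) : stacks A :=
  let: Stk cI cT cV cX cY cD cE cH cG cK := s in
  match i with
  | iI => Stk v cT cV cX cY cD cE cH cG cK
  | iT => Stk cI v cV cX cY cD cE cH cG cK
  | iV => Stk cI cT v cX cY cD cE cH cG cK
  | iX => Stk cI cT cV v cY cD cE cH cG cK
  | iY => Stk cI cT cV cX v cD cE cH cG cK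
  | iD => Stk cI cT cV cX cY v cE cH cG cK
  | iE => Stk cI cT cV cX cY cD v cH cG cK
  | iH => Stk cI cT cV cX cY cD cE v cG cK
  | iG => Stk cI cT cV cX cY cD cE cH v cK
  | iK => Stk cI cT cV cX cY cD cE cH cG v
  end.

Lemma get_set A (s : stacks A) i v j :
  get (set s i v) j = if j == i then v else get s j.
Proof.
have -> : (j == i) = (nat_of_idx j == nat_of_idx i).
  apply/eqP/eqP => [-> //|e]; apply: (can_inj idx_ordK) => /=; congr inord; exact: e.
by case: s => *; case: i; case: j.
Qed.

Definition tot A (s : stacks A) : nat :=
  size (sI s) + size (sT s) + size (sV s) + size (sX s) + size (sY s) +
  size (sD s) + size (sE s) + size (sH s) + size (sG s) + size (sK s).

Definition pushes A (w : seq (idx * A)) (s : stacks A) : stacks A :=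
  foldl (fun s p => set s p.1 (p.2 :: get s p.1)) s w.

(* An instruction pops one stack and, according to the popped symbol ([None]
   on an empty stack), pushes finitely many symbols and jumps or halts. *)
Definition program (A : Type) := lab -> idx * (option A -> seq (idx * A) * (lab + bool)).

Section Run.
Variables (A : Type) (P : program A).

Definition sconfig := ((lab + bool) * stacks A)%type.

Definition sstep (c : sconfig) : sconfig :=
  match c with
  | (inl l, s) =>
    let: (i, f) := P l in
    let: (w, l') := f (ohead (get s i)) in
    (l', pushes w (set s i (behead (get s i))))
  | (inr b, s) => c
  end.

Inductive reach (M : nat) : nat -> sconfig -> sconfig -> Prop :=
| reach_refl c k : tot c.2 <= M -> reach M k c c
| reach_step l s c k :
    tot s <= M -> reach M k (sstep (inl l, s)) c -> reach M k.+1 (inl l, s) c.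

Lemma reach_le M k c c' M' k' :
  reach M k c c' -> k <= k' -> M <= M' -> reach M' k' c c'.
Proof.
move=> H; elim: H k' => {k c c'} [c k Hc|l s c k Hc _ IH] k' Hk HM.
  by apply: reach_refl; lia.
by case: k' Hk => // k' Hk; apply: reach_step; [lia|apply: IH].
Qed.

Lemma reach_trans M k1 k2 c1 c2 c3 :
  reach M k1 c1 c2 -> reach M k2 c2 c3 -> reach M (k1 + k2) c1 c3.
Proof.
elim=> {k1 c1 c2} [c k Hc|l s c k Hc _ IH] H.
  by apply: (reach_le H); lia.
by rewrite addSn; apply: reach_step => //; apply: IH.
Qed.

Lemma reach_iter M k c c' : reach M k c c' ->
  exists m, [/\ m <= k, iter m sstep c = c',
    (forall j, j <= m -> tot (iter j sstep c).2 <= M) &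
    (forall j, j < m -> exists l, (iter j sstep c).1 = inl l)].
Proof.
elim=> {k c c'} [c k Hc|l s c k Hc _ [m [Hm H1 H2 H3]]].
  by exists 0; split=> // -[].
exists m.+1; split=> //.
- by rewrite iterSr.
- by case=> [|j] Hj //; rewrite iterSr; apply: H2.
- by case=> [|j] Hj; [exists l|rewrite iterSr; apply: H3].
Qed.

End Run.

(** * The evaluator as a stack program *)

Section Evaluator.
Variable Sig : finType.

Definition asym := (Sig + ctok)%type.
Implicit Types (w : seq asym).

Local Notation Lam := (inr tLam : asym).
Local Notation Ret := (inr tRet : asym).
Local Notation App := (inr tApp : asym).
Local Notation Var := (inr tVar : asym).
Local Notation Adr := (inr tAdr : asym).
Local Notation Tick := (inr tTick : asym).
Local Notation Sep := (inr tSep : asym).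

Definition ticks n : seq asym := nseq n Tick.

(** In postfix order an application is met after both operands have been evaluated, and [Ret] makes
    the end of an abstraction recognisable by counting nested binders. *)
Fixpoint code (t : hterm) : seq asym :=
  match t with
  | hvar n => Var :: ticks n
  | hadr a => Adr :: ticks a
  | happ s t => code s ++ code t ++ [:: App]
  | hlam s => Lam :: code s ++ [:: Ret]
  end.

Fixpoint emb (t : term) : hterm :=
  match t with
  | var n => hvar n
  | app s t => happ (emb s) (emb t)
  | lam s => hlam (emb s)
  end.

Definition dead : seq (idx * asym) * (lab + bool) := ([::], inr false).

Section Program.
(* [heap] selects the mode: without it a beta step copies the argument, with
   it the argument is stored on the heap and its address is substituted.  The
   initial task is the term [app (app (app sf <input>) a1) a2].

   Stacks: [iT] holds the tasks, codes in postfix order; [iV] the values, each a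
   reversed code above a [Sep]; [iX] the code to be substituted; [iD] the binder
   depth in unary; [iE] and [iY] the variable index being compared with it, and
   temporaries; [iH] the heap, newest entry on top, [iG] the part of it that is
   moved aside during a lookup, and [iK] the number of entries in unary. *)
Variables (heap : bool) (sf a1 a2 : term).

Definition pushT w : seq (idx * asym) := [seq (iT, t) | t <- rev w].

(** The code of an encoded string is nested: all letter prefixes, the empty string, then equally
    many suffixes. Tasks are pushed from the last token on, so one pass over the input writes the
    suffixes and a second pass, over the reversed letters, writes the prefixes. *)
Definition str_prefix (a : Sig) : seq asym :=
  [:: Lam; Lam; Var] ++ code (emb (enc_sym a)) ++ [:: App].
Definition str_suffix : seq asym := [:: App; Ret; Ret].
Definition str_nil : seq asym := [:: Lam; Lam; Var; Tick; Ret; Ret].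
Definition task_tail : seq asym :=
  App :: code (emb a1) ++ App :: code (emb a2) ++ [:: App].

(** Values are stored reversed, so [lSub] reads a function body from its last token. The ticks of an
    index arrive before the token that tells a variable from an address, and pushing the result onto
    [iT] restores the forward order. *)
Definition prog : program asym := fun l =>
  match l with
  | lLd0 => (iT, fun _ => (pushT task_tail, inl lLd1))
  | lLd1 => (iI, fun o => match o with
      | Some a => ((iX, a) :: pushT str_suffix, inl lLd1)
      | None => (pushT str_nil, inl lLd2) end)
  | lLd2 => (iX, fun o => match o with
      | Some (inl a) => (pushT (str_prefix a), inl lLd2)
      | Some _ => dead
      | None => (pushT (code (emb sf)), inl lMain) end)
  | lMain => (iT, fun o => match o with
      | None => ([::], inl lFin)
      | Some (inr tLam) => ([:: (iV, Sep); (iV, Lam)], inl lVal)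
      | Some (inr tApp) => ([::], inl lR)
      | Some (inr tAdr) => ([:: (iV, Sep)], inl lA1)
      | Some _ => dead end)
  | lVal => (iT, fun o => match o with
      | Some (inr tLam) => ([:: (iV, Lam); (iD, Tick)], inl lVal)
      | Some (inr tRet) => ([:: (iV, Ret)], inl lValRet)
      | Some a => ([:: (iV, a)], inl lVal)
      | None => dead end)
  | lValRet => (iD, fun o => if o is Some _ then ([::], inl lVal) else ([::], inl lMain))
  | lR => (iV, fun o => match o with
      | Some (inr tSep) => ([::], inl (if heap then lH1 else lSub0))
      | Some a => ([:: (iX, a)], inl lR)
      | None => dead end)
  | lH1 => (iX, fun o => match o with
      | Some a => ([:: (iH, a)], inl lH1)
      | None => ([:: (iH, Sep)], inl lH2) end)
  | lH2 => (iK, fun o => match o with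
      | Some _ => ([:: (iE, Tick); (iX, Tick)], inl lH2)
      | None => ([:: (iX, Adr); (iK, Tick)], inl lH3) end)
  | lH3 => (iE, fun o => match o with
      | Some _ => ([:: (iK, Tick)], inl lH3)
      | None => ([::], inl lSub0) end)
  | lSub0 => (iV, fun _ => ([::], inl lSub))
  | lSub => (iV, fun o => match o with
      | Some (inr tTick) => ([:: (iE, Tick)], inl lSub)
      | Some (inr tVar) => ([::], inl lCmpE)
      | Some (inr tAdr) => ([::], inl lAdr)
      | Some (inr tRet) => ([:: (iT, Ret); (iD, Tick)], inl lSub)
      | Some (inr tLam) => ([::], inl lSubLam)
      | Some (inr tApp) => ([:: (iT, App)], inl lSub)
      | _ => dead end)
  | lAdr => (iE, fun o => match o with
      | Some _ => ([:: (iT, Tick)], inl lAdr)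
      | None => ([:: (iT, Adr)], inl lSub) end)
  | lCmpE => (iE, fun o => if o is Some _ then ([::], inl lCmpD) else ([::], inl lCmpEnd))
  | lCmpD => (iD, fun o => match o with
      | Some _ => ([:: (iY, Tick)], inl lCmpE)
      | None => ([:: (iT, Tick)], inl lMisE) end)
  | lCmpEnd => (iD, fun o => match o with
      | Some _ => ([:: (iD, Tick)], inl lMisY)
      | None => ([::], inl lHit) end)
  | lMisE => (iE, fun o => match o with
      | Some _ => ([:: (iT, Tick)], inl lMisE)
      | None => ([::], inl lMisY) end)
  | lMisY => (iY, fun o => match o with
      | Some _ => ([:: (iT, Tick); (iD, Tick)], inl lMisY)
      | None => ([:: (iT, Var)], inl lSub) end)
  | lHit => (iY, fun o => match o with
      | Some _ => ([:: (iD, Tick)], inl lHit)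
      | None => ([::], inl lCp1) end)
  | lCp1 => (iX, fun o => match o with
      | Some a => ([:: (iY, a)], inl lCp1)
      | None => ([::], inl lCp2) end)
  | lCp2 => (iY, fun o => match o with
      | Some a => ([:: (iX, a); (iT, a)], inl lCp2)
      | None => ([::], inl lSub) end)
  | lSubLam => (iD, fun o => match o with
      | Some _ => ([:: (iT, Lam)], inl lSub)
      | None => ([::], inl lSubEnd) end)
  | lSubEnd => (iV, fun _ => ([::], inl lClr))
  | lClr => (iX, fun o => if o is Some _ then ([::], inl lClr) else ([::], inl lMain))
  | lA1 => (iH, fun o => match o with
      | Some a => ([:: (iG, a)], inl lA1)
      | None => ([::], inl lA2) end)
  | lA2 => (iT, fun o => match o with
      | Some (inr tTick) => ([::], inl lA3)
      | Some a => ([:: (iT, a)], inl lA4)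
      | None => ([::], inl lA4) end)
  | lA3 => (iG, fun o => match o with
      | Some (inr tSep) => ([:: (iH, Sep)], inl lA2)
      | Some a => ([:: (iH, a)], inl lA3)
      | None => dead end)
  | lA4 => (iG, fun o => match o with
      | Some (inr tSep) => ([:: (iH, Sep)], inl lA5)
      | Some a => ([:: (iH, a); (iV, a)], inl lA4)
      | None => dead end)
  | lA5 => (iG, fun o => match o with
      | Some a => ([:: (iH, a)], inl lA5)
      | None => ([::], inl lMain) end)
  | lFin => (iV, fun _ => ([::], inl lFin1))
  | lFin1 => (iV, fun o => ([::], inr (o == Some Var)))
  end.

End Program.
End Evaluator.

(** * Correctness and cost of the subroutines of the evaluator *)

Section EvaluatorSteps.
Variable Sig : finType.
Local Notation asym := (asym Sig).
Local Notation Lam := (inr tLam : asym).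
Local Notation Ret := (inr tRet : asym).
Local Notation App := (inr tApp : asym).
Local Notation Var := (inr tVar : asym).
Local Notation Adr := (inr tAdr : asym).
Local Notation Tick := (inr tTick : asym).
Local Notation Sep := (inr tSep : asym).
Local Notation ticks := (ticks Sig).
Local Notation code := (code Sig).

Variables (heap : bool) (sf a1 a2 : term).
Local Notation prog := (prog Sig heap sf a1 a2).
Local Notation reach := (reach prog).

Implicit Types (cI cT cV cX cY cD cE cH cG cK w : seq asym).

Lemma ticksSr n w : ticks n.+1 ++ w = ticks n ++ Tick :: w.
Proof. by elim: n => //= n ->. Qed.

Lemma rev_ticks n : rev (ticks n) = ticks n.
Proof. by elim: n => //= n IH; rewrite rev_cons IH -cats1 -ticksSr cats0. Qed.

Lemma ticks_add m n : ticks (m + n) = ticks m ++ ticks n.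
Proof. exact: nseqD. Qed.

Lemma size_ticks n : size (ticks n) = n. Proof. exact: size_nseq. Qed.

Ltac tots :=
  repeat match goal with H : is_true (_ <= _) |- _ => revert H end;
  rewrite /tot /= ?size_cat ?size_rev ?size_ticks /=; lia.
Ltac step := apply: reach_step; [tots|rewrite /sstep /=].
Ltac fin := apply: reach_refl; tots.

Lemma reach_val_ticks M n cI cT cV cX cY cD cE cH cG cK :
  tot (Stk cI (ticks n ++ cT) cV cX cY cD cE cH cG cK) <= M ->
  reach M n (inl lVal, Stk cI (ticks n ++ cT) cV cX cY cD cE cH cG cK)
            (inl lVal, Stk cI cT (ticks n ++ cV) cX cY cD cE cH cG cK).
Proof.
elim: n cV => [|n IH] cV HM; first by apply: reach_refl.
step; rewrite -/(ticks n) -[Tick :: ticks n ++ cV]/(ticks n.+1 ++ cV) ticksSr.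
by apply: IH; tots.
Qed.

Lemma reach_val M q d cI cT cV cX cY cE cH cG cK :
  tot (Stk cI (code q ++ cT) cV cX cY (ticks d) cE cH cG cK) + size (code q) <= M ->
  reach M (2 * size (code q))
    (inl lVal, Stk cI (code q ++ cT) cV cX cY (ticks d) cE cH cG cK)
    (inl lVal, Stk cI cT (rev (code q) ++ cV) cX cY (ticks d) cE cH cG cK).
Proof.
elim: q d cT cV => [n|a|s IHs t IHt|s IHs] d cT cV.
- move=> HM; apply: (@reach_le _ _ M n.+1); [|by rewrite /= size_ticks; lia|by []].
  apply: reach_step; first by tots.
  rewrite /sstep /= rev_cons rev_ticks cat_rcons.
  by apply: reach_val_ticks; tots.
- move=> HM; apply: (@reach_le _ _ M a.+1); [|by rewrite /= size_ticks; lia|by []].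
  apply: reach_step; first by tots.
  rewrite /sstep /= rev_cons rev_ticks cat_rcons.
  by apply: reach_val_ticks; tots.
- rewrite /= !rev_cat -!catA /= !size_cat /= => HM.
  apply: (@reach_le _ _ M (2 * size (code s) + (2 * size (code t) + 1)));
    [|by lia|by []].
  apply: reach_trans; first by apply: IHs; tots.
  apply: reach_trans; first by apply: IHt; tots.
  by apply: reach_step; [tots|rewrite /sstep /=; apply: reach_refl; tots].
- rewrite /= !rev_cons !rev_cat /= -!catA /= !size_cat /= => HM.
  apply: (@reach_le _ _ M ((2 * size (code s) + 2).+1)); [|by lia|by []].
  apply: reach_step; first by tots.
  rewrite /sstep /= -/(ticks d.+1).
  apply: reach_trans.
    by apply: (IHs d.+1); tots.
  apply: reach_step; first by tots.
  rewrite /sstep /=; apply: reach_step; first by tots.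
  rewrite /sstep /= cat_rcons; apply: reach_refl; tots.
Qed.


Definition nosep w := all (fun a : asym => if a is inr tSep then false else true) w.

Lemma code_nosep q : nosep (code q).
Proof.
rewrite /nosep; elim: q => [n|a|s IHs t IHt|s IHs] /=; rewrite ?all_cat ?IHs ?IHt //.
- by rewrite all_nseq orbT.
- by rewrite all_nseq orbT.
Qed.

Lemma nosep_rev w : nosep (rev w) = nosep w.
Proof. exact: all_rev. Qed.

Lemma reach_R M w cI cT cV cX cY cD cE cH cG cK : nosep w ->
  tot (Stk cI cT (w ++ Sep :: cV) cX cY cD cE cH cG cK) <= M ->
  reach M (size w).+1
    (inl lR, Stk cI cT (w ++ Sep :: cV) cX cY cD cE cH cG cK)
    (inl (if heap then lH1 else lSub0),
     Stk cI cT cV (rev w ++ cX) cY cD cE cH cG cK).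
Proof.
elim: w cX => [|a w IH] cX; first by move=> _ HM; step; fin.
move=> /= /andP[Ha Hw] HM; step.
rewrite rev_cons cat_rcons; case: a Ha HM => [a|[]] //= _ HM; apply: IH => //; tots.
Qed.

Lemma reach_H1 M w cI cT cV cY cD cE cH cG cK :
  tot (Stk cI cT cV w cY cD cE cH cG cK) < M ->
  reach M (size w).+1
    (inl lH1, Stk cI cT cV w cY cD cE cH cG cK)
    (inl lH2, Stk cI cT cV [::] cY cD cE (Sep :: rev w ++ cH) cG cK).
Proof.
elim: w cH => [|a w IH] cH HM; first by step; fin.
by step; rewrite rev_cons cat_rcons; apply: IH; tots.
Qed.

Lemma reach_H2 M k cI cT cV cX cY cD cE cH cG :
  tot (Stk cI cT cV cX cY cD cE cH cG (ticks k)) + k + 2 <= M ->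
  reach M k.+1
    (inl lH2, Stk cI cT cV cX cY cD cE cH cG (ticks k))
    (inl lH3, Stk cI cT cV (Adr :: ticks k ++ cX) cY cD (ticks k ++ cE) cH cG [:: Tick]).
Proof.
elim: k cX cE => [|k IH] cX cE HM; first by step; fin.
step; rewrite -/(ticks k).
by rewrite -[Tick :: (ticks k ++ cX)]/(ticks k.+1 ++ cX) -[Tick :: (ticks k ++ cE)]/(ticks k.+1 ++ cE) !ticksSr; apply: IH; tots.
Qed.

Lemma reach_H3 M k cI cT cV cX cY cD cH cG cK :
  tot (Stk cI cT cV cX cY cD (ticks k) cH cG cK) <= M ->
  reach M k.+1
    (inl lH3, Stk cI cT cV cX cY cD (ticks k) cH cG cK)
    (inl lSub0, Stk cI cT cV cX cY cD [::] cH cG (ticks k ++ cK)).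
Proof.
elim: k cK => [|k IH] cK HM; first by step; fin.
by step; rewrite -/(ticks k) -[Tick :: (ticks k ++ cK)]/(ticks k.+1 ++ cK) ticksSr; apply: IH; tots.
Qed.

Lemma reach_sub_ticks M n cI cT cV cX cY cD cE cH cG cK :
  tot (Stk cI cT (ticks n ++ cV) cX cY cD cE cH cG cK) <= M ->
  reach M n
    (inl lSub, Stk cI cT (ticks n ++ cV) cX cY cD cE cH cG cK)
    (inl lSub, Stk cI cT cV cX cY cD (ticks n ++ cE) cH cG cK).
Proof.
elim: n cE => [|n IH] cE HM; first by fin.
by step; rewrite -/(ticks n) -[Tick :: (ticks n ++ cE)]/(ticks n.+1 ++ cE) ticksSr; apply: IH; tots.
Qed.

Lemma reach_adr M n cI cT cV cX cY cD cH cG cK :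
  tot (Stk cI cT cV cX cY cD (ticks n) cH cG cK) < M ->
  reach M n.+1
    (inl lAdr, Stk cI cT cV cX cY cD (ticks n) cH cG cK)
    (inl lSub, Stk cI (Adr :: ticks n ++ cT) cV cX cY cD [::] cH cG cK).
Proof.
elim: n cT => [|n IH] cT HM; first by step; fin.
by step; rewrite -/(ticks n) -[Tick :: (ticks n ++ cT)]/(ticks n.+1 ++ cT) ticksSr; apply: IH; tots.
Qed.

Lemma reach_misY M n cI cT cV cX cD cE cH cG cK :
  tot (Stk cI cT cV cX (ticks n) cD cE cH cG cK) + n < M ->
  reach M n.+1
    (inl lMisY, Stk cI cT cV cX (ticks n) cD cE cH cG cK)
    (inl lSub, Stk cI (Var :: ticks n ++ cT) cV cX [::] (ticks n ++ cD) cE cH cG cK).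
Proof.
elim: n cT cD => [|n IH] cT cD HM; first by step; fin.
step; rewrite -/(ticks n) -[Tick :: (ticks n ++ cT)]/(ticks n.+1 ++ cT).
by rewrite -[Tick :: (ticks n ++ cD)]/(ticks n.+1 ++ cD) !ticksSr; apply: IH; tots.
Qed.

Lemma reach_misE M n cI cT cV cX cY cD cH cG cK :
  tot (Stk cI cT cV cX cY cD (ticks n) cH cG cK) <= M ->
  reach M n.+1
    (inl lMisE, Stk cI cT cV cX cY cD (ticks n) cH cG cK)
    (inl lMisY, Stk cI (ticks n ++ cT) cV cX cY cD [::] cH cG cK).
Proof.
elim: n cT => [|n IH] cT HM; first by step; fin.
by step; rewrite -/(ticks n) -[Tick :: (ticks n ++ cT)]/(ticks n.+1 ++ cT) ticksSr; apply: IH; tots.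
Qed.

Lemma reach_hit M n cI cT cV cX cD cE cH cG cK :
  tot (Stk cI cT cV cX (ticks n) cD cE cH cG cK) <= M ->
  reach M n.+1
    (inl lHit, Stk cI cT cV cX (ticks n) cD cE cH cG cK)
    (inl lCp1, Stk cI cT cV cX [::] (ticks n ++ cD) cE cH cG cK).
Proof.
elim: n cD => [|n IH] cD HM; first by step; fin.
by step; rewrite -/(ticks n) -[Tick :: (ticks n ++ cD)]/(ticks n.+1 ++ cD) ticksSr; apply: IH; tots.
Qed.

Lemma reach_cp1 M w cI cT cV cY cD cE cH cG cK :
  tot (Stk cI cT cV w cY cD cE cH cG cK) <= M ->
  reach M (size w).+1
    (inl lCp1, Stk cI cT cV w cY cD cE cH cG cK)
    (inl lCp2, Stk cI cT cV [::] (rev w ++ cY) cD cE cH cG cK).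
Proof.
elim: w cY => [|a w IH] cY HM; first by step; fin.
by step; rewrite rev_cons cat_rcons; apply: IH; tots.
Qed.

Lemma reach_cp2 M w cI cT cV cX cD cE cH cG cK :
  tot (Stk cI cT cV cX w cD cE cH cG cK) + size w <= M ->
  reach M (size w).+1
    (inl lCp2, Stk cI cT cV cX w cD cE cH cG cK)
    (inl lSub, Stk cI (rev w ++ cT) cV (rev w ++ cX) [::] cD cE cH cG cK).
Proof.
elim: w cT cX => [|a w IH] cT cX HM; first by step; fin.
by step; rewrite rev_cons !cat_rcons; apply: IH; tots.
Qed.

Lemma reach_clr M w cI cT cV cY cD cE cH cG cK :
  tot (Stk cI cT cV w cY cD cE cH cG cK) <= M ->
  reach M (size w).+1
    (inl lClr, Stk cI cT cV w cY cD cE cH cG cK)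
    (inl lMain, Stk cI cT cV [::] cY cD cE cH cG cK).
Proof.
elim: w => [|a w IH] HM; first by step; fin.
by step; apply: IH; tots.
Qed.

Lemma reach_A1 M w cI cT cV cX cY cD cE cG cK :
  tot (Stk cI cT cV cX cY cD cE w cG cK) <= M ->
  reach M (size w).+1
    (inl lA1, Stk cI cT cV cX cY cD cE w cG cK)
    (inl lA2, Stk cI cT cV cX cY cD cE [::] (rev w ++ cG) cK).
Proof.
elim: w cG => [|a w IH] cG HM; first by step; fin.
by step; rewrite rev_cons cat_rcons; apply: IH; tots.
Qed.

Lemma reach_A5 M w cI cT cV cX cY cD cE cH cK :
  tot (Stk cI cT cV cX cY cD cE cH w cK) <= M ->
  reach M (size w).+1
    (inl lA5, Stk cI cT cV cX cY cD cE cH w cK)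
    (inl lMain, Stk cI cT cV cX cY cD cE (rev w ++ cH) [::] cK).
Proof.
elim: w cH => [|a w IH] cH HM; first by step; fin.
by step; rewrite rev_cons cat_rcons; apply: IH; tots.
Qed.

Lemma reach_A3 M w cI cT cV cX cY cD cE cH cG cK : nosep w ->
  tot (Stk cI cT cV cX cY cD cE cH (w ++ Sep :: cG) cK) <= M ->
  reach M (size w).+1
    (inl lA3, Stk cI cT cV cX cY cD cE cH (w ++ Sep :: cG) cK)
    (inl lA2, Stk cI cT cV cX cY cD cE (Sep :: rev w ++ cH) cG cK).
Proof.
elim: w cH => [|a w IH] cH; first by move=> _ HM; step; fin.
move=> /= /andP[Ha Hw] HM; step.
rewrite rev_cons cat_rcons; case: a Ha HM => [a|[]] //= _ HM; apply: IH => //; tots.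
Qed.

Lemma reach_A4 M w cI cT cV cX cY cD cE cH cG cK : nosep w ->
  tot (Stk cI cT cV cX cY cD cE cH (w ++ Sep :: cG) cK) + size w <= M ->
  reach M (size w).+1
    (inl lA4, Stk cI cT cV cX cY cD cE cH (w ++ Sep :: cG) cK)
    (inl lA5, Stk cI cT (rev w ++ cV) cX cY cD cE (Sep :: rev w ++ cH) cG cK).
Proof.
elim: w cH cV => [|a w IH] cH cV; first by move=> _ HM; step; fin.
move=> /= /andP[Ha Hw] HM; step.
rewrite rev_cons !cat_rcons; case: a Ha HM => [a|[]] //= _ HM; apply: IH => //; tots.
Qed.


(** Index and binder depth are decremented together, and the common part is saved on [iY]. What
    remains decides: nothing on either side is a hit, a remaining depth means a bound variable, a
    remaining index a larger variable; the last two are copied unchanged, as [hsubst] does not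
    renumber. *)
Lemma reach_cmp M p y n d cI cT cV cX cH cG cK :
  tot (Stk cI cT cV cX (ticks y) (ticks (p + d)) (ticks (p + n)) cH cG cK) <= M ->
  reach M (2 * p)
    (inl lCmpE, Stk cI cT cV cX (ticks y) (ticks (p + d)) (ticks (p + n)) cH cG cK)
    (inl lCmpE, Stk cI cT cV cX (ticks (p + y)) (ticks d) (ticks n) cH cG cK).
Proof.
elim: p y => [|p IH] y HM; first by fin.
move: HM; rewrite mulnS !addSn => HM; step; step.
rewrite -/(ticks y.+1) -/(ticks (p + y)).
rewrite -[Tick :: ticks (p + y)]/(ticks (p + y).+1) -addnS; rewrite add0n; apply: (IH y.+1); tots.
Qed.

Lemma reach_eq M w n cI cT cV cH cG cK :
  tot (Stk cI cT cV w [::] (ticks n) (ticks n) cH cG cK) + size w <= M ->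
  reach M (3 * n + 2 * size w + 5)
    (inl lCmpE, Stk cI cT cV w [::] (ticks n) (ticks n) cH cG cK)
    (inl lSub, Stk cI (w ++ cT) cV w [::] (ticks n) [::] cH cG cK).
Proof.
move=> HM.
apply: (@reach_le _ _ M (2 * n + (n.+1 + ((size w).+1 + (size w).+1)).+2));
  [|by lia|by []].
have := @reach_cmp M n 0 0 0 cI cT cV w cH cG cK; rewrite !addn0 => Hc.
apply: reach_trans; first by apply: Hc; tots.
step; step; apply: reach_trans; first by apply: reach_hit; tots.
apply: reach_trans; first by apply: reach_cp1; tots.
have := @reach_cp2 M (rev w) cI cT cV [::] (ticks n) [::] cH cG cK.
by rewrite size_rev revK !cats0; apply; tots.
Qed.

Lemma reach_lt M n d cI cT cV cX cH cG cK :
  tot (Stk cI cT cV cX [::] (ticks (n + d.+1)) (ticks n) cH cG cK) + n < M ->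
  reach M (3 * n + 3)
    (inl lCmpE, Stk cI cT cV cX [::] (ticks (n + d.+1)) (ticks n) cH cG cK)
    (inl lSub, Stk cI (Var :: ticks n ++ cT) cV cX [::] (ticks (n + d.+1)) [::] cH cG cK).
Proof.
move=> HM; apply: (@reach_le _ _ M (2 * n + (n.+1).+2)); [|by lia|by []].
have := @reach_cmp M n 0 0 d.+1 cI cT cV cX cH cG cK; rewrite !addn0 => Hc.
apply: reach_trans; first by apply: Hc; tots.
step; step; rewrite -/(ticks d.+1).
have -> : ticks (n + d.+1) = ticks n ++ ticks d.+1 by rewrite ticks_add.
by apply: reach_misY; tots.
Qed.

Lemma reach_gt M n d cI cT cV cX cH cG cK :
  tot (Stk cI cT cV cX [::] (ticks d) (ticks (d + n.+1)) cH cG cK) + d < M ->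
  reach M (3 * d + n + 5)
    (inl lCmpE, Stk cI cT cV cX [::] (ticks d) (ticks (d + n.+1)) cH cG cK)
    (inl lSub, Stk cI (Var :: ticks (d + n.+1) ++ cT) cV cX [::] (ticks d) [::] cH cG cK).
Proof.
move=> HM; apply: (@reach_le _ _ M (2 * d + (n.+1 + d.+1).+2)); [|by lia|by []].
have := @reach_cmp M d 0 n.+1 0 cI cT cV cX cH cG cK; rewrite !addn0 => Hc.
apply: reach_trans; first by apply: Hc; tots.
step; step; rewrite -/(ticks n).
apply: reach_trans; first by apply: reach_misE; tots.
have -> : ticks (d + n.+1) ++ cT = ticks d ++ ticks n ++ Tick :: cT.
  by rewrite ticks_add -catA ticksSr.
have := @reach_misY M d cI (ticks n ++ Tick :: cT) cV cX [::] [::] cH cG cK.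
by rewrite cats0; apply; tots.
Qed.

(** A hit passes over [u] twice, once to reverse it onto [iY] and once to copy it while restoring
    [iX]; this gives the [2] in the factor. All other work is a bounded number of moves per
    token. *)
Lemma reach_sub M q u d cI cT cV cH cG cK :
  tot (Stk cI cT (rev (code q) ++ cV) (code u) [::] (ticks d) [::] cH cG cK)
    + size (code (hsubst q d u)) + 2 * size (code q) <= M ->
  reach M (size (code q) * (2 * size (code u) + 10))
    (inl lSub, Stk cI cT (rev (code q) ++ cV) (code u) [::] (ticks d) [::] cH cG cK)
    (inl lSub, Stk cI (code (hsubst q d u) ++ cT) cV (code u) [::] (ticks d) [::] cH cG cK).
Proof.
set c := 2 * size (code u) + 10.
elim: q d cT cV => [n|a|s IHs t IHt|s IHs] d cT cV HM.
- apply: (@reach_le _ _ M (n + (3 * n + 2 * size (code u) + 5).+1)); [|by rewrite /= size_ticks mulSn /c; nia|by []].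
  rewrite /= rev_cons rev_ticks cat_rcons; apply: reach_trans.
    by move: HM; rewrite /= rev_cons rev_ticks cat_rcons => HM; apply: reach_sub_ticks; tots.
  rewrite cats0; move: HM; rewrite /= rev_cons rev_ticks cat_rcons; case: (ltngtP n d) => [lt|gt|<-] HM.
  + have -> : d = n + (d - n.+1).+1 by lia.
    apply: reach_step; first by tots.
    rewrite /sstep /=; apply: (@reach_le _ _ M (3 * n + 3)); [|by lia|by []].
    by apply: reach_lt; tots.
  + have E : n = d + (n - d.+1).+1 by lia.
    apply: reach_step; first by tots.
    rewrite /sstep /= {}E in HM *; set m := n - _ in HM *.
    apply: (@reach_le _ _ M (3 * d + m + 5)); [|by lia|by []].
    by apply: reach_gt; tots.
  + apply: reach_step; first by tots.
    by rewrite /sstep /=; apply: reach_eq; tots.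
- apply: (@reach_le _ _ M (a + (a.+1).+1)); [|by rewrite /= size_ticks mulSn /c; nia|by []].
  move: HM; rewrite /= rev_cons rev_ticks cat_rcons => HM; apply: reach_trans.
    by apply: reach_sub_ticks; tots.
  rewrite cats0; apply: reach_step; first by tots.
  by rewrite /sstep /=; apply: reach_adr; tots.
- move: HM; rewrite /= !rev_cat !size_cat -!catA /= => HM.
  (* Read backwards, the code presents the right operand first. *)
  apply: (@reach_le _ _ M (size (code t) * c + size (code s) * c).+1); [|by rewrite /c; nia|by []].
  apply: reach_step; first by tots.
  rewrite /sstep /=; apply: reach_trans.
    by apply: IHt; tots.
  by apply: IHs; tots.
- move: HM; rewrite /= !rev_cons !rev_cat /= !size_cat -!catA /= cat_rcons => HM.
  apply: (@reach_le _ _ M (size (code s) * c + 2).+1); [|by rewrite /c; nia|by []].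
  apply: reach_step; first by tots.
  rewrite /sstep /= -/(ticks d.+1); apply: reach_trans.
    by apply: (IHs d.+1); tots.
  by step; step; fin.
Qed.

End EvaluatorSteps.

(* Tasks ([None] is a pending application), values (bodies of abstractions),
   and the heap (bodies of abstractions, oldest first). *)
Definition astate := (seq (option hterm) * seq hterm * seq hterm)%type.

(** Abstractions stay whole, since reduction is weak and never enters them. *)
Fixpoint flat (t : hterm) : seq (option hterm) :=
  match t with
  | happ s t => flat s ++ flat t ++ [:: None]
  | _ => [:: Some t]
  end.

Definition anext (heap : bool) (st : astate) : astate :=
  let: (T, V, H) := st in
  match T, V with
  | Some (hlam q) :: T', _ => (T', q :: V, H)
  | Some (hadr a) :: T', _ => (T', nth (hvar 0) H a :: V, H)
  | None :: T', r :: q :: V' =>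
    if heap then (flat (hsubst q 0 (hadr (size H))) ++ T', V', rcons H r)
    else (flat (hsubst q 0 (hlam r)) ++ T', V', H)
  | _, _ => st
  end.

(** [anext] is total: it leaves a stuck state unchanged and reads a default at a dangling address.
    Those are the states excluded here, since the stack program has no counterpart for them. *)
Definition ready (st : astate) : bool :=
  let: (T, V, H) := st in
  match T with
  | Some (hlam _) :: _ => true
  | Some (hadr a) :: _ => a < size H
  | None :: _ => 1 < size V
  | _ => false
  end.

(** * Abstract states as stack contents *)

Section Representation.
Variable Sig : finType.
Local Notation asym := (asym Sig).
Local Notation Lam := (inr tLam : asym).
Local Notation Ret := (inr tRet : asym).
Local Notation App := (inr tApp : asym).
Local Notation Var := (inr tVar : asym).
Local Notation Adr := (inr tAdr : asym).
Local Notation Tick := (inr tTick : asym).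
Local Notation Sep := (inr tSep : asym).
Local Notation ticks := (ticks Sig).
Local Notation code := (code Sig).

Definition codeO (o : option hterm) : seq asym := if o is Some t then code t else [:: App].
Definition codeT T := flatten [seq codeO o | o <- T].
Definition codeV V := flatten [seq rcons (rev (code (hlam q))) Sep | q <- V].
Definition entries H := flatten [seq rcons (code (hlam h)) Sep | h <- H].

Definition rep (st : astate) : stacks asym :=
  let: (T, V, H) := st in
  Stk [::] (codeT T) (codeV V) [::] [::] [::] [::] (rev (entries H)) [::] (ticks (size H)).

Lemma codeT_cat T1 T2 : codeT (T1 ++ T2) = codeT T1 ++ codeT T2.
Proof. by rewrite /codeT map_cat flatten_cat. Qed.

Lemma codeT_flat t : codeT (flat t) = code t.
Proof.
elim: t => [n|a|s IHs t IHt|s IHs] /=; rewrite ?codeT_cat ?IHs ?IHt //;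
  by rewrite /codeT /= cats0.
Qed.

(** An address on [iT] is delimited only by the end of its ticks, so whatever follows it must not
    start with a tick. *)
Lemma code_head t : exists x w, code t = x :: w /\ (if x is inr tTick then false else true).
Proof.
elim: t => [n|a|s [x [w [E Hx]]] t _|s IHs].
- by exists Var, (ticks n).
- by exists Adr, (ticks a).
- by exists x, (w ++ code t ++ [:: App]); rewrite /= E.
- by exists Lam, (code s ++ [:: Ret]).
Qed.

Lemma codeT_head T : codeT T = [::] \/
  exists x w, codeT T = x :: w /\ (if x is inr tTick then false else true).
Proof.
case: T => [|[t|] T]; [by left| |by right; exists App, (codeT T)].
have [x [w [E Hx]]] := code_head t; right; exists x, (w ++ codeT T).
by rewrite /codeT /= E.
Qed.

Variables (heap : bool) (sf a1 a2 : term).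
Local Notation prog := (prog Sig heap sf a1 a2).
Local Notation reach := (reach prog).

Implicit Types (cI cT cV cX cY cD cE cH cG cK w : seq asym).

Ltac tots :=
  repeat match goal with H : is_true (_ <= _) |- _ => revert H end;
  rewrite /tot /= ?(size_cat, size_rev, size_rcons, size_ticks) /=; lia.

Lemma reach_lam M q T V H :
  2 * tot (rep (Some (hlam q) :: T, V, H)) + 5 <= M ->
  reach M (2 * size (code q) + 3)
    (inl lMain, rep (Some (hlam q) :: T, V, H)) (inl lMain, rep (T, q :: V, H)).
Proof.
rewrite /rep /codeT /= -/(codeT T) => HM; rewrite -catA /=.
apply: (@reach_le _ _ M (2 * size (code q) + 2).+1); [|by lia|by []].
apply: reach_step; first by tots.
rewrite /sstep /=; apply: reach_trans.
  by apply: (@reach_val _ _ _ _ _ _ _ 0); tots.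
apply: reach_step; first by tots.
rewrite /sstep /=; apply: reach_step; first by tots.
rewrite /sstep /=; set c := Stk _ _ _ _ _ _ _ _ _ _; set c' := Stk _ _ _ _ _ _ _ _ _ _.
have -> : c' = c by rewrite /c /c' /codeV /= rev_cons rev_cat -!cats1 -!catA.
by apply: reach_refl; rewrite /c; tots.
Qed.

Lemma entriesE H a : a < size H ->
  entries (drop a H) = rcons (code (hlam (nth (hvar 0) H a))) Sep ++ entries (drop a.+1 H).
Proof. by move=> lt; rewrite (drop_nth (hvar 0) lt). Qed.

Lemma entries1 h : entries [:: h] = rcons (code (hlam h)) Sep.
Proof. exact: cats0. Qed.

Lemma entries_cat H1 H2 : entries (H1 ++ H2) = entries H1 ++ entries H2.
Proof. by rewrite /entries map_cat flatten_cat. Qed.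

Lemma size_entries H : size H <= size (entries H).
Proof.
elim: H => // h H IH; rewrite -cat1s entries_cat entries1 size_cat [in X in _ <= X]size_cat size_rcons.
by move: IH => /=; lia.
Qed.

(** Addresses count from the oldest entry, which lies at the bottom of [iH]. Once the whole heap has
    been moved to [iG] the oldest entry is on top, and each tick of the address moves one entry
    back. *)
Lemma reach_skip M a i H cI cT cV cX cY cD cE cK : a + i <= size H ->
  tot (Stk cI (ticks a ++ cT) cV cX cY cD cE (rev (entries (take i H))) (entries (drop i H)) cK) <= M ->
  reach M (2 * a + size (entries (drop i H)))
    (inl lA2, Stk cI (ticks a ++ cT) cV cX cY cD cE
                  (rev (entries (take i H))) (entries (drop i H)) cK)
    (inl lA2, Stk cI cT cV cX cY cD cE
                  (rev (entries (take (a + i) H))) (entries (drop (a + i) H)) cK).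
Proof.
elim: a i => [|a IH] i Hi HM; first by apply: reach_refl; exact: HM.
have lt : i < size H by lia.
have E := entriesE lt; set w := code (hlam (nth _ _ _)) in E.
have E' : rev (entries (take i.+1 H)) = Sep :: rev w ++ rev (entries (take i H)).
  by rewrite (take_nth (hvar 0) lt) -cats1 entries_cat rev_cat entries1 rev_rcons.
have nw : nosep w by exact: code_nosep.
clearbody w.
apply: (@reach_le _ _ M ((size w).+1 + (2 * a + size (entries (drop i.+1 H)))).+1).
- apply: reach_step; first exact: HM.
  rewrite /sstep /= -/(ticks a); move: HM; rewrite E => HM; rewrite cat_rcons.
  apply: reach_trans.
    by apply: reach_A3; [exact: nw|tots].
  by rewrite -E' addSnnS; apply: IH; [lia|rewrite E'; tots].
- by rewrite E size_cat size_rcons; lia.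
- by [].
Qed.

Lemma reach_adr_step M a T V H : a < size H ->
  let st := (Some (hadr a) :: T, V, H) in
  tot (rep st) + tot (rep (anext heap st)) + 5 <= M ->
  reach M (4 * tot (rep st) + 10)
    (inl lMain, rep st) (inl lMain, rep (anext heap st)).
Proof.
move=> lt st; set h := nth (hvar 0) H a.
pose e := entries H; pose E0 := entries (drop a.+1 H); pose w := code (hlam h).
have He : e = entries (take a H) ++ rcons w Sep ++ E0.
  by rewrite -(entriesE lt) -entries_cat cat_take_drop.
have nw : nosep w by exact: code_nosep.
have -> : rep (anext heap st) = Stk [::] (codeT T) (rev w ++ Sep :: codeV V)
            [::] [::] [::] [::] (rev e) [::] (ticks (size H)).
  by rewrite /rep /st [anext _ _]/= -/h /codeV [flatten (map _ (_ :: _))]/= cat_rcons.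
have -> : rep st = Stk [::] (Adr :: ticks a ++ codeT T) (codeV V)
            [::] [::] [::] [::] (rev e) [::] (ticks (size H)) by [].
have Ed := entriesE lt; rewrite -/h -/w -/E0 in Ed => HM.
clearbody w h E0; clear st.
have He2 : entries (take 0 H) = [::] by rewrite take0.
have He3 : entries (drop 0 H) = e by rewrite drop0.
clearbody e.
apply: (@reach_le _ _ M ((size (rev e)).+1 + (2 * a + size e + ((size w).+1 + (size E0).+1).+1)).+1).
- apply: reach_step; first by tots.
  rewrite /sstep /=; apply: reach_trans.
    by apply: reach_A1; tots.
  rewrite revK cats0.
  have := @reach_skip M a 0 H [::] (codeT T) (Sep :: codeV V) [::] [::] [::] [::] (ticks (size H)).
  rewrite addn0 He2 He3 => Hs; apply: reach_trans.
    by apply: Hs; [lia|tots].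
  have HA4 : reach M ((size w).+1 + (size E0).+1)
    (inl lA4, Stk [::] (codeT T) (Sep :: codeV V) [::] [::] [::] [::]
                  (rev (entries (take a H))) (entries (drop a H)) (ticks (size H)))
    (inl lMain, Stk [::] (codeT T) (rev w ++ Sep :: codeV V)
            [::] [::] [::] [::] (rev e) [::] (ticks (size H))).
    rewrite Ed cat_rcons; apply: reach_trans.
      apply: reach_A4; first exact: nw.
      by move: HM; rewrite He; tots.
    have -> : rev e = rev E0 ++ (Sep :: rev w ++ rev (entries (take a H))).
      by rewrite He !rev_cat rev_rcons -catA.
    by apply: reach_A5; move: HM; rewrite He; tots.
  (* [lA2] notices the end of the address only by popping the next task token, if there is one, and
     then puts it back. *)
  case: (codeT_head T) HM HA4 {Hs} => [->|[x [v [-> Hx]]]] HM HA4.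
    apply: reach_step; last by rewrite /sstep /=; apply: HA4.
    by move: HM; rewrite He Ed; tots.
  apply: reach_step; first by move: HM; rewrite He Ed; tots.
  by rewrite /sstep; case: x Hx HM HA4 => [x|[]] // _ HM HA4; apply: HA4.
- have : a <= size e by apply: leq_trans (ltnW lt) _; rewrite -He3 drop0 size_entries.
  by move: HM; rewrite He; tots.
- by [].
Qed.

Lemma reach_sub0 M q u cI cT cV cH cG cK :
  tot (Stk cI cT (rcons (rev (code (hlam q))) Sep ++ cV) (code u) [::] [::] [::] cH cG cK)
    + size (code (hsubst q 0 u)) + 2 * size (code q) <= M ->
  reach M (size (code q) * (2 * size (code u) + 10) + size (code u) + 5)
    (inl lSub0, Stk cI cT (rcons (rev (code (hlam q))) Sep ++ cV) (code u)
                    [::] [::] [::] cH cG cK)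
    (inl lMain, Stk cI (code (hsubst q 0 u) ++ cT) cV [::] [::] [::] [::] cH cG cK).
Proof.
have -> : rcons (rev (code (hlam q))) Sep ++ cV = Ret :: rev (code q) ++ Lam :: Sep :: cV.
  by rewrite /= rev_cons rev_cat !cat_rcons /= .
move=> HM.
apply: (@reach_le _ _ M (size (code q) * (2 * size (code u) + 10) + (size (code u)).+1.+3).+1);
  [|by lia|by []].
apply: reach_step; first by tots.
rewrite /sstep /=; apply: reach_trans.
  by apply: (@reach_sub _ _ _ _ _ _ _ _ 0); tots.
apply: reach_step; first by tots.
rewrite /sstep /=; apply: reach_step; first by tots.
rewrite /sstep /=; apply: reach_step; first by tots.
by rewrite /sstep /=; apply: reach_clr; tots.
Qed.

Lemma reach_app_step M r q T V H :
  let st := (None :: T, r :: q :: V, H) in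
  3 * tot (rep st) + tot (rep (anext heap st)) + 5 <= M ->
  reach M (20 * (tot (rep st)).+1 * (tot (rep st)).+1)
    (inl lMain, rep st) (inl lMain, rep (anext heap st)).
Proof.
move=> st; set R := rcons (rev (code (hlam r))) Sep.
pose Q := rcons (rev (code (hlam q))) Sep.
have -> : rep st = Stk [::] (App :: codeT T) (R ++ Q ++ codeV V)
   [::] [::] [::] [::] (rev (entries H)) [::] (ticks (size H)) by [].
have sR : size R = size (code r) + 3.
  by rewrite size_rcons size_rev /= size_cat /=; lia.
have sQ : size Q = size (code q) + 3.
  by rewrite size_rcons size_rev /= size_cat /=; lia.
have sr : size (code (hlam r)) = size (code r) + 2 by rewrite /= size_cat /=; lia.
set Z := tot _; have HZ : Z = 1 + size (codeT T) + size R + size Q + size (codeV V) +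
    size (entries H) + size H by rewrite /Z; tots.
move=> HM.
pose W := code (hlam r).
have Rdef : R ++ Q ++ codeV V = rev W ++ Sep :: Q ++ codeV V.
  by rewrite cat_rcons.
have nR : nosep (rev W) by rewrite nosep_rev; apply: code_nosep.
have sW : size W = size (code r) + 2 by exact: sr.
have HQ : Q = rcons (rev (code (hlam q))) Sep by [].
have [Eh|Eh] : heap = true \/ heap = false by case: heap; [left|right].
- have El : (if heap then lH1 else lSub0) = lH1 by rewrite Eh.
  pose u := hadr (size H).
  have E : rep (anext heap st) = Stk [::] (code (hsubst q 0 u) ++ codeT T) (codeV V)
    [::] [::] [::] [::] (Sep :: rev W ++ rev (entries H)) [::] (ticks (size H).+1).
    rewrite /rep /anext /st Eh codeT_cat codeT_flat -cats1 entries_cat entries1.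
    by rewrite rev_cat rev_rcons size_cat addn1.
  have su : size (code u) = (size H).+1 by rewrite /= size_ticks.
  rewrite E in HM *; clearbody W R Z Q; clear st E.
  apply: (@reach_le _ _ M ((size (rev W)).+1 + ((size W).+1 + ((size H).+1 + ((size H).+1 +
    (size (code q) * (2 * size (code u) + 10) + size (code u) + 5))))).+1).
  + apply: reach_step; first by tots.
    set c' := (X in reach _ _ _ X); rewrite /sstep /= Rdef.
    apply: reach_trans; first by apply: reach_R; [exact: nR|rewrite -Rdef; tots].
    rewrite El revK cats0; apply: reach_trans.
      by apply: reach_H1; tots.
    have -> : ticks (size H) = ticks (size H) ++ [::] by rewrite cats0.
    apply: reach_trans.
      by rewrite cats0; apply: reach_H2; tots.
    rewrite !cats0; apply: reach_trans.
      by apply: reach_H3; tots.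
    have -> : ticks (size H) ++ [:: Tick] = ticks (size H).+1 by rewrite -addn1 ticks_add.
    by rewrite /c' HQ; apply: (@reach_sub0 _ q (hadr (size H))); rewrite -HQ -/u; tots.
  + rewrite size_rev su sW; nia.
  + by [].
- have El : (if heap then lH1 else lSub0) = lSub0 by rewrite Eh.
  have E : rep (anext heap st) = Stk [::] (code (hsubst q 0 (hlam r)) ++ codeT T) (codeV V)
    [::] [::] [::] [::] (rev (entries H)) [::] (ticks (size H)).
    by rewrite /rep /anext /st Eh codeT_cat codeT_flat.
  rewrite E in HM *; clearbody R Z Q; clear st E.
  apply: (@reach_le _ _ M ((size (rev W)).+1 +
    (size (code q) * (2 * size W + 10) + size W + 5)).+1).
  + apply: reach_step; first by tots.
    set c' := (X in reach _ _ _ X); rewrite /sstep /= Rdef.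
    apply: reach_trans; first by apply: reach_R; [exact: nR|rewrite -Rdef; tots].
    rewrite El revK cats0.
    by rewrite /c' HQ; apply: (@reach_sub0 _ q (hlam r)); rewrite -HQ; tots.
  + rewrite size_rev sW; nia.
  + by [].
Qed.

(** The time refers to the state before the step alone: substitution costs a product of two code
    lengths found there. A run confined to few cells thus has cheap steps, even if the next result
    would not fit. *)
Lemma reach_anext M st : ready st ->
  3 * tot (rep st) + tot (rep (anext heap st)) + 5 <= M ->
  reach M (20 * (tot (rep st)).+1 * (tot (rep st)).+1)
    (inl lMain, rep st) (inl lMain, rep (anext heap st)).
Proof.
case: st => [[[|[[n|a|s t|q]|] T] V] H] //.
- move=> lt HM; apply: (reach_le (reach_adr_step (M := M) (V := V) (T := T) lt _)) => //.
    by move: HM; move: (tot _) (tot _) => *; lia.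
  by set Z := tot _; nia.
- move=> _ HM; set st := (_, _, _).
  have HZ : size (code q) <= tot (rep st).
    by rewrite /rep /st /codeT /= ; tots.
  apply: (reach_le (reach_lam (M := M) (V := V) (q := q) (T := T) (H := H) _)) => //.
    by move: HM; rewrite -/st; move: (tot _) (tot _) => *; lia.
  by move: HZ; move: (tot _) (size _) => *; nia.
- case: V => [|r [|q V]] // _ HM.
  exact: reach_app_step.
Qed.

Definition verdict (q : hterm) : bool := if q is hvar 0 then true else false.

Lemma reach_verdict M q H : tot (rep ([::], [:: q], H)) <= M ->
  exists s, reach M 3 (inl lMain, rep ([::], [:: q], H)) (inr (verdict q), s) /\
  tot s <= tot (rep ([::], [:: q], H)).
Proof.
move=> HM; pose w := rev (code q) ++ [:: Lam; Sep].
have E : codeV [:: q] = Ret :: w.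
  by rewrite /codeV /= cats0 rev_cons rev_cat /= -cats1 -cats1 /w -catA.
exists (Stk [::] [::] (behead w) [::] [::] [::] [::] (rev (entries H)) [::] (ticks (size H))).
split; last by rewrite /rep E; case: (w) => [|x v]; tots.
rewrite /rep E in HM *.
apply: reach_step; first by [].
rewrite /sstep /=; apply: reach_step; first by [].
rewrite /sstep /=; apply: reach_step; first by tots.
rewrite /sstep /=.
have -> : (ohead w == Some Var) = verdict q.
  rewrite /w; case: q {E HM w} => [[|n]|a|s t|s] /=.
  - by rewrite /rev /= eqxx.
  - by rewrite -[_ :: _ :: _]/(Var :: ticks n.+1) rev_cons rev_ticks; apply/eqP.
  - by rewrite rev_cons rev_ticks; case: a => [|a]; apply/eqP.
  - by rewrite !rev_cat /=; apply/eqP.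
  - by rewrite rev_cons rev_cat /=; apply/eqP.
apply: reach_refl; move: HM; rewrite -/w; case: (w) => [|x v]; tots.
Qed.

Lemma pushesT w cI cT cV cX cY cD cE cH cG cK :
  pushes (pushT w) (Stk cI cT cV cX cY cD cE cH cG cK) =
  Stk cI (w ++ cT) cV cX cY cD cE cH cG cK.
Proof.
elim: w => //= a w IH; rewrite /pushT rev_cons map_rcons /pushes foldl_rcons.
by rewrite -/(pushT w) -/(pushes _ _) IH.
Qed.

Fixpoint suffixes n : seq asym := if n is n'.+1 then str_suffix Sig ++ suffixes n' else [::].

Lemma size_suffixes n : size (suffixes n) = 3 * n.
Proof. by elim: n => //= n ->; lia. Qed.

Lemma suffixesSr n w : suffixes n.+1 ++ w = suffixes n ++ str_suffix Sig ++ w.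
Proof. by elim: n => //= n IH; rewrite IH. Qed.

Lemma code_enc_cons a (x : seq Sig) :
  code (emb (enc_str (a :: x))) = str_prefix a ++ code (emb (enc_str x)) ++ str_suffix Sig.
Proof. by rewrite /= -!catA. Qed.

Local Notation load_state cI cT cX :=
  (Stk cI cT [::] cX [::] [::] [::] [::] [::] [::]).

Lemma sstep_prefix a w cX :
  sstep prog (inl lLd2, load_state [::] w (inl a :: cX)) =
  (inl lLd2, load_state [::] (str_prefix a ++ w) cX).
Proof. by rewrite -pushesT. Qed.

Lemma sstep_head w :
  sstep prog (inl lLd2, load_state [::] w [::]) =
  (inl lMain, load_state [::] (code (emb sf) ++ w) [::]).
Proof. by rewrite -pushesT. Qed.

Lemma sstep_nil w cX :
  sstep prog (inl lLd1, load_state [::] w cX) =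
  (inl lLd2, load_state [::] (str_nil Sig ++ w) cX).
Proof. by rewrite -pushesT. Qed.

Lemma sstep_suffix a cI w cX :
  sstep prog (inl lLd1, load_state (a :: cI) w cX) =
  (inl lLd1, load_state cI (str_suffix Sig ++ w) (a :: cX)).
Proof. by rewrite -pushesT. Qed.

Lemma sstep_tail cI :
  sstep prog (inl lLd0, load_state cI [::] [::]) =
  (inl lLd1, load_state cI (task_tail Sig a1 a2) [::]).
Proof. by rewrite -[task_tail _ _ _]cats0 -pushesT. Qed.

Lemma reach_load1 M (x y : seq Sig) w :
  size w + 3 * size x + size x + size y + 6 <= M ->
  reach M (size x).+1
    (inl lLd1, load_state [seq inl a | a <- x] w [seq inl a | a <- y])
    (inl lLd2, load_state [::] (str_nil Sig ++ suffixes (size x) ++ w)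
       [seq inl a | a <- catrev x y]).
Proof.
elim: x y w => [|a x IH] y w HM.
  apply: reach_step; first by rewrite /tot /= size_map; lia.
  rewrite sstep_nil.
  by apply: reach_refl; rewrite /tot /= size_map; move: HM; rewrite /=; lia.
apply: reach_step; first by move: HM; rewrite /tot /= !size_map; lia.
rewrite [map _ _]/= sstep_suffix -[inl a :: _]/[seq inl b | b <- a :: y].
rewrite [size (a :: x)]/= suffixesSr; apply: IH.
by rewrite size_cat; move: HM => /=; lia.
Qed.

Lemma code_enc_size (x : seq Sig) : 6 + 3 * size x <= size (code (emb (enc_str x))).
Proof.
elim: x => // a x IH; rewrite code_enc_cons !size_cat /=; move: IH; lia.
Qed.

(** Pays for the suffixes that are already on the task stack while the letters of [y] still wait for
    their prefixes. *)
Lemma size_catrev_code (y z : seq Sig) :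
  size (code (emb (enc_str z))) + 3 * size y <= size (code (emb (enc_str (catrev y z)))).
Proof.
elim: y z => [|a y IH] z; first by rewrite muln0 addn0.
apply: leq_trans (IH (a :: z)); rewrite code_enc_cons !size_cat.
by rewrite [size (a :: y)]/= [size (str_suffix _)]/=; lia.
Qed.

Lemma reach_load2 M (y z : seq Sig) w :
  size (code (emb sf)) + size (code (emb (enc_str (catrev y z)))) + size w + size y <= M ->
  reach M (size y).+1
    (inl lLd2, load_state [::] (code (emb (enc_str z)) ++ suffixes (size y) ++ w)
       [seq inl a | a <- y])
    (inl lMain, load_state [::] (code (emb sf) ++ code (emb (enc_str (catrev y z))) ++ w) [::]).
Proof.
elim: y z => [|a y IH] z HM.
  apply: reach_step; first by rewrite /tot /= !size_cat; move: HM => /=; lia.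
  rewrite sstep_head.
  by apply: reach_refl; rewrite /tot /= !size_cat; move: HM; rewrite /=; lia.
have Hz : size (code (emb (enc_str z))) + 3 * (size y).+1 <=
   size (code (emb (enc_str (catrev (a :: y) z)))).
  exact: (size_catrev_code (a :: y) z).
apply: (reach_step (k := (size y).+1)).
  rewrite /tot /= !size_cat size_map /= size_cat size_suffixes; move: HM Hz => /=.
  by lia.
rewrite [map _ _]/= sstep_prefix [size (a :: y)]/=
  -[suffixes (size y).+1]/(str_suffix Sig ++ suffixes (size y)) -catA.
have -> : str_prefix a ++ code (emb (enc_str z)) ++ str_suffix Sig ++ suffixes (size y) ++ w
  = code (emb (enc_str (a :: z))) ++ suffixes (size y) ++ w.
  by rewrite code_enc_cons -!catA.
by apply: IH; apply: leq_trans HM; rewrite leq_add2l; exact: leqnSn.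
Qed.

Definition init_state (x : seq Sig) : astate :=
  (flat (emb (app (app (app sf (enc_str x)) a1) a2)), [::], [::]).

Definition init_stacks (x : seq Sig) : stacks asym :=
  Stk [seq inl a | a <- x] [::] [::] [::] [::] [::] [::] [::] [::] [::].

Lemma rep_init x : rep (init_state x) =
  load_state [::] (code (emb sf) ++ code (emb (enc_str x)) ++ task_tail Sig a1 a2) [::].
Proof.
rewrite /rep /init_state codeT_flat; congr (Stk _ _ _ _ _ _ _ _ _ _).
by rewrite /= -!catA.
Qed.

Lemma reach_load M x :
  2 * tot (rep (init_state x)) + 10 <= M ->
  reach M (2 * size x + 3) (inl lLd0, init_stacks x) (inl lMain, rep (init_state x)).
Proof.
rewrite rep_init => HM; have Hx := code_enc_size x.
have Hc : size (code (emb (enc_str x))) + size (task_tail Sig a1 a2) +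
   size (code (emb sf)) <= tot (load_state [::]
   (code (emb sf) ++ code (emb (enc_str x)) ++ task_tail Sig a1 a2) [::]).
  by rewrite /tot [sT _]/= !size_cat; lia.
set Z := tot _ in HM Hc.
have Sr : size (catrev x [::]) = size x by rewrite catrevE cats0 size_rev.
apply: (@reach_le _ _ M ((size x).+1 + (size (catrev x [::])).+1).+1);
  [|by rewrite Sr; lia|by []].
apply: reach_step; first by rewrite /tot /= size_map; lia.
rewrite sstep_tail; apply: reach_trans.
  by apply: (@reach_load1 _ _ [::]); rewrite [size [::]]/=; lia.
have E : x = catrev (catrev x [::]) [::] by rewrite !catrevE !cats0 revK.
have := @reach_load2 M (catrev x [::]) [::] (task_tail Sig a1 a2).
by rewrite -E Sr; apply; lia.
Qed.

End Representation.

(** * Correctness of the abstract machine *)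

Lemma step_lam s t : step (lam s) t -> False.
Proof. by move=> H; inversion H. Qed.

Lemma step_det s t t' : step s t -> step s t' -> t = t'.
Proof.
move=> H; elim: H t' => {s t} [s t|s s' t st IH|s t t1 st IH] t' H; inversion H; subst => //.
- by case: (step_lam H3).
- by case: (step_lam H3).
- by case: (step_lam st).
- by rewrite (IH _ H3).
- by case: (step_lam st).
- by case: (step_lam st).
- by case: (step_lam H3).
- by rewrite (IH _ H3).
Qed.

(* [U] lists the closed L-terms that the heap cells stand for. *)
Fixpoint unf (U : seq term) (t : hterm) : term :=
  match t with
  | hvar n => var n
  | hadr a => nth (lam (var 0)) U a
  | happ s t => app (unf U s) (unf U t)
  | hlam s => lam (unf U s)
  end.

Fixpoint hbound (k : nat) (t : hterm) : bool :=
  match t with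
  | hvar n => n < k
  | hadr _ => true
  | happ s t => hbound k s && hbound k t
  | hlam s => hbound k.+1 s
  end.

Fixpoint abound (n : nat) (t : hterm) : bool :=
  match t with
  | hvar _ => true
  | hadr a => a < n
  | happ s t => abound n s && abound n t
  | hlam s => abound n s
  end.

Lemma unf_emb U s : unf U (emb s) = s.
Proof. by elim: s => //= [s -> t ->|s ->]. Qed.

Lemma hbound_emb k s : hbound k (emb s) = bound k s.
Proof. by elim: s k => [n|s IHs t IHt|s IHs] k //=; rewrite ?IHs ?IHt. Qed.

Lemma abound_emb n s : abound n (emb s).
Proof. by elim: s => //= s -> t ->. Qed.

Lemma abound_le m n t : m <= n -> abound m t -> abound n t.
Proof.
move=> le; elim: t => [k|a|s IHs t IHt|s IHs] //=; first by lia.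
by case/andP=> /IHs-> /IHt->.
Qed.

Lemma hbound_le m n t : m <= n -> hbound m t -> hbound n t.
Proof.
elim: t m n => [k|a|s IHs t IHt|s IHs] m n le //=; first by lia.
  by case/andP=> /(IHs _ _ le)-> /(IHt _ _ le)->.
by apply: IHs.
Qed.

(** The default in [unf] was chosen to be a value, so that every address, even a dangling one,
    unfolds to a closed abstraction. *)
Lemma value_nth U a : all value U -> value (nth (lam (var 0)) U a).
Proof.
move=> vU; case: (ltnP a (size U)) => [lt|ge]; last by rewrite nth_default.
by move/(all_nthP (lam (var 0))): vU; apply.
Qed.

Lemma unf_hsubst U s k u : all value U ->
  unf U (hsubst s k u) = subst (unf U s) k (unf U u).
Proof.
move=> vU; elim: s k => [n|a|s IHs t IHt|s IHs] k /=.
- by case: eqP.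
- by rewrite closed_subst //; apply: val_closed; apply: value_nth.
- by rewrite IHs IHt.
- by rewrite IHs.
Qed.

Lemma unf_rcons U v t : abound (size U) t -> unf (rcons U v) t = unf U t.
Proof.
elim: t => [n|a|s IHs t IHt|s IHs] //=; first by move=> lt; rewrite nth_rcons lt.
  by case/andP=> /IHs-> /IHt->.
by move/IHs->.
Qed.

Lemma bound_unf U k t : all value U -> hbound k t -> bound k (unf U t).
Proof.
move=> vU; elim: t k => [n|a|s IHs t IHt|s IHs] k //=.
- by move=> _; apply: closed_bound; apply: val_closed; apply: value_nth.
- by case/andP=> /IHs-> /IHt->.
- by apply: IHs.
Qed.

Lemma hbound_hsubst k s u : hbound 0 u -> hbound k.+1 s -> hbound k (hsubst s k u).
Proof.
move=> cu; elim: s k => [n|a|s IHs t IHt|s IHs] k //=.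
- by case: eqP => [_ _|ne lt]; [apply: hbound_le cu|rewrite /=; lia].
- by case/andP=> /IHs-> /IHt->.
- by apply: IHs.
Qed.

Lemma abound_hsubst n k s u : abound n u -> abound n s -> abound n (hsubst s k u).
Proof.
move=> bu; elim: s k => [m|a|s IHs t IHt|s IHs] k //=.
- by case: eqP.
- by case/andP=> /IHs-> /IHt->.
- by apply: IHs.
Qed.

(* The L-term denoted by tasks and values, read in reverse Polish notation. *)
Fixpoint dec (T : seq (option term)) (W : seq term) : option (seq term) :=
  match T with
  | [::] => Some W
  | Some t :: T' => dec T' (t :: W)
  | None :: T' => if W is t :: s :: W' then dec T' (app s t :: W') else None
  end.

Lemma dec_flat U t T W :
  dec ([seq omap (unf U) o | o <- flat t] ++ T) W = dec T (unf U t :: W).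
Proof.
elim: t T W => //= s IHs t IHt T W.
by rewrite !map_cat -!catA IHs IHt.
Qed.

(** Since [V] consists of abstractions, the pending applications put [s] only where reduction is
    allowed: as the argument of an abstraction from [V], or as the function applied to another
    term. *)
Lemma dec_step T W s s' V t : step s s' -> all value V ->
  dec T (W ++ s :: V) = Some [:: t] ->
  exists2 t', step t t' & dec T (W ++ s' :: V) = Some [:: t'].
Proof.
elim: T W s s' V t => [|[u|] T IH] W s s' V t st vV /=.
- case: W => [|w W] /=; last by case=> _; case: W.
  by case=> E E2; subst; exists s'.
- by apply: (IH (u :: W)).
case: W => [|w [|w' W]] /=.
- case: V vV => // v V /= /andP[/andP[lv _] vV] H.
  by apply: (IH [::] _ _ _ _ _ vV H); case: v lv {H} => // v _; apply: stepAppR.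
- by move=> H; apply: (IH [::] _ _ _ _ _ vV H); apply: stepAppL.
- by apply: (IH (app w' w :: W)).
Qed.

(** A pending application counts one, just as an [app] node does, so decoding neither creates nor
    loses size. This is the source of the linear space bound in copying mode. *)
Lemma dec_size T W X : dec T W = Some X ->
  sumn [seq tsize t | t <- X] =
  sumn [seq tsize t | t <- W] + sumn [seq if o is Some t then tsize t else 1 | o <- T].
Proof.
elim: T W => [|[u|] T IH] W /=.
- by case=> E; subst; rewrite addn0.
- by move/IH=> -> /=; lia.
- by case: W => [|t [|s W]] // /IH -> /=; lia.
Qed.

Definition good n k t := hbound k t && abound n t.

Definition simple t := if t is happ _ _ then false else true.

Definition good_task n (o : option hterm) :=
  if o is Some t then simple t && good n 0 t else true.

(** Heap cells may contain addresses, and [inv_heap] only asks that [U] solve the resulting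
    unfolding equation; this avoids a recursion along addresses. *)
Record inv (t : term) (st : astate) (U : seq term) : Prop := Inv {
  inv_size : size U = size st.2;
  inv_val : all value U;
  inv_heap : U = [seq lam (unf U h) | h <- st.2];
  inv_T : all (good_task (size st.2)) st.1.1;
  inv_V : all (good (size st.2) 1) st.1.2;
  inv_H : all (good (size st.2) 1) st.2;
  inv_dec : dec [seq omap (unf U) o | o <- st.1.1] [seq lam (unf U q) | q <- st.1.2]
            = Some [:: t] }.

Lemma flat_good n t : good n 0 t -> all (good_task n) (flat t).
Proof.
elim: t => [m|a|s IHs t IHt|s IHs] H /=; rewrite ?andbT //.
by case/andP: H => /= /andP[hs ht] /andP[gs gt]; rewrite !all_cat IHs ?IHt // /good ?hs ?ht.
Qed.

Lemma inv_init s : closed s -> inv s (flat (emb s), [::], [::]) [::].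
Proof.
move=> cs; split=> //=.
  by apply: flat_good; rewrite /good hbound_emb abound_emb andbT.
by have := dec_flat [::] (emb s) [::] [::]; rewrite cats0 unf_emb.
Qed.

Lemma inv_push heap t o T V H U : inv t (Some o :: T, V, H) U ->
  [/\ ready (Some o :: T, V, H), inv t (anext heap (Some o :: T, V, H)) U &
      exists q, anext heap (Some o :: T, V, H) = (T, q :: V, H)].
Proof.
case=> /= sU vU hU /andP[/andP[so /andP[ho ao]] gT] gV gH dU.
case: o so ho ao dU => //= [a|q] _ ho ao dU.
- split=> //; last by exists (nth (hvar 0) H a).
  split=> //=; first by rewrite gV andbT (all_nthP _ gH).
  rewrite -dU; congr (dec _ (_ :: _)).
  by rewrite [in RHS]hU (nth_map (hvar 0)).
- split=> //; last by exists q.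
  by split=> //=; rewrite gV /good ho ao.
Qed.

Lemma all_value_V n U V : all value U -> all (good n 1) V ->
  all value [seq lam (unf U q) | q <- V].
Proof.
move=> vU; rewrite all_map; elim: V => //= q V IH /andP[/andP[hq _] /IH->].
by rewrite andbT /value /closed /=; apply: bound_unf.
Qed.

(** The two topmost values form a redex, and [dec_step] carries its contraction over to the denoted
    term. In heap mode [U] is extended by the unfolded argument; everything older contains only
    older addresses and keeps its meaning by [unf_rcons]. *)
Lemma inv_beta heap t T V H U : inv t (None :: T, V, H) U ->
  ready (None :: T, V, H) /\ exists t' U' r q V' T', [/\ V = r :: q :: V', step t t',
    inv t' (anext heap (None :: T, V, H)) U' &
    anext heap (None :: T, V, H) = (T', V', if heap then rcons H r else H)].
Proof.
case=> /= sU vU hU gT gV gH.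
case: V gV => [|r [|q V]] //= /andP[/andP[hr ar] /andP[/andP[hq aq] gV]] dU; split=> //.
set R := lam (unf U r) in dU; pose s' := subst (unf U q) 0 R.
have st : step (app (lam (unf U q)) R) s' by apply: stepBeta.
have vV := all_value_V vU gV.
have [t' st' dU'] := dec_step (W := [::]) st vV dU; exists t'.
have vR : value R by rewrite /value /closed /= bound_unf.
case: heap.
- exists (rcons U R), r, q, V, (flat (hsubst q 0 (hadr (size H))) ++ T); split=> //.
  have au W : all (good (size H) 1) W ->
      [seq lam (unf (rcons U R) h) | h <- W] = [seq lam (unf U h) | h <- W].
    elim: W => //= h W IH /andP[/andP[_ ah] /IH ->].
    by rewrite unf_rcons // sU.
  have gmon k W : all (good (size H) k) W -> all (good (size (rcons H r)) k) W.
    apply: sub_all => h /andP[hh ah]; rewrite /good hh /=; apply: abound_le ah.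
    by rewrite size_rcons.
  split=> /=.
  + by rewrite !size_rcons sU.
  + by rewrite all_rcons vR vU.
  + by rewrite map_rcons au // -hU unf_rcons // sU.
  + rewrite all_cat flat_good /=.
      apply: sub_all gT => -[h|] //= /andP[-> /andP[hh ah]]; rewrite /good hh /=.
      by apply: abound_le ah; rewrite size_rcons.
    rewrite /good hbound_hsubst //= abound_hsubst //= ?size_rcons //.
    by apply: abound_le aq.
  + exact: gmon.
  + by rewrite all_rcons gmon // andbT /good hr /=; apply: abound_le ar; rewrite size_rcons.
  + rewrite map_cat dec_flat au // -dU' unf_hsubst ?all_rcons ?vR //=.
    rewrite unf_rcons ?sU // nth_rcons sU ltnn eqxx.
    congr (dec _ _); elim: T gT {dU dU'} => //= o T IH /andP[go /IH ->].
    case: o go => //= h /andP[_ /andP[_ ah]]; by rewrite unf_rcons ?sU.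
- exists U, r, q, V, (flat (hsubst q 0 (hlam r)) ++ T); split=> //; split=> //=.
  + by rewrite all_cat flat_good //= /good hbound_hsubst //= abound_hsubst.
  + by rewrite map_cat dec_flat unf_hsubst.
Qed.

(** Moving a task to the values does not change the denoted term, so these steps take place between
    two reduction steps of L. *)
Lemma push_phase heap t T V H U : inv t (T, V, H) U ->
  exists m, let st := iter m (anext heap) (T, V, H) in
  [/\ inv t st U, size st.1.2 = size V + m,
      (if st.1.1 is Some _ :: _ then false else true),
      (forall j, j < m -> ready (iter j (anext heap) (T, V, H))) &
      (forall j, j <= m -> inv t (iter j (anext heap) (T, V, H)) U)].
Proof.
elim: T V => [|[o|] T IH] V I.
- by exists 0; split=> //= [|[]] //; rewrite addn0.
- have [rd I' [q E]] := inv_push heap I; rewrite E in I'.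
  have [m] := IH _ I'; rewrite -E => -[I1 S1 C1 R1 J1].
  exists m.+1; rewrite /= -iterS iterSr; split=> //.
  + by rewrite S1 /=; lia.
  + by case=> [|j] Hj //; rewrite iterSr; apply: R1.
  + by case=> [|j] Hj //; rewrite iterSr; apply: J1.
- by exists 0; split=> //= [|[]] //; rewrite addn0.
Qed.

(** Potential argument: a push adds one value, a beta step removes two, and a single value is left
    at the end. From an empty value stack, at most [k] beta steps thus come with at most [1 + 2 * k]
    pushes. *)
Lemma run_inv heap t v k sp : red t (lam v) k sp -> forall st U, inv t st U ->
  exists n q H U', [/\ n + size st.1.2 <= 1 + 3 * k,
    iter n (anext heap) st = ([::], [:: q], H), unf U' q = v, all value U' &
    (forall j, j < n -> ready (iter j (anext heap) st)) /\
    (forall j, j <= n -> exists t' U', inv t' (iter j (anext heap) st) U' /\ tsize t' <= sp)].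
Proof.
move E: (lam v) => w rw; elim: rw E => {t w k sp} [s k sp Hs|s s' w k sp Hs st _ IH] E [[T V] H] U I.
- have [m] := push_phase heap I; set st := iter _ _ _ => -[I1 S1 C1 R1 J1].
  case Est: st I1 S1 C1 => [[[|[o|] T'] V'] H'] I1 S1 C1 //.
    have := inv_dec I1 => /= -[]; case: V' Est I1 S1 {C1} => [|q [|q' V']] //= Est I1 S1 [E2].
    exists m, q, H', U; split=> //.
    + by rewrite addnC -S1.
    + by move: E2; rewrite -E => -[].
    + by case: I1.
    + by split=> // j /J1 Hj; exists s, U.
  have [_ [t' [U' [r [q [V2 [T2 [_ st' _ _]]]]]]]] := inv_beta heap I1.
  by rewrite -E in st'; case: (step_lam st').
- have [m] := push_phase heap I; set st' := iter _ _ _ => -[I1 S1 C1 R1 J1].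
  case Est: st' I1 S1 C1 => [[[|[o|] T'] V'] H'] I1 S1 C1 //.
    have := inv_dec I1 => /= -[]; case: V' Est I1 S1 {C1} => [|q [|q' V']] //= Est I1 S1 [E2].
    by rewrite -E2 in st; case: (step_lam st).
  have [rd [t' [U' [r [q [V2 [T2 [EV stt I2 E3]]]]]]]] := inv_beta heap I1.
  (* Determinism identifies the redex contracted by the machine with the next step of the given
     reduction. *)
  rewrite (step_det stt st) in I2.
  have [n [q' [H2 [U2 [Hn F1 F2 vU2 [F3 F4]]]]]] := IH E _ _ I2.
  have it j : iter (j + m.+1) (anext heap) (T, V, H) =
              iter j (anext heap) (anext heap (None :: T', V', H')).
    by rewrite iterD iterS -/st' Est.
  exists (n + m.+1), q', H2, U2; split=> //.
  + by move: Hn S1; rewrite E3 EV /=; lia.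
  + by rewrite it.
  + split=> j Hj.
      case: (ltngtP j m) => [lt|gt|->]; [exact: R1| |by rewrite -/st' Est].
      by rewrite -(subnK gt) it; apply: F3; lia.
    case: (leqP j m) => [le|gt]; first by exists s, U; split=> //; apply: J1.
    by rewrite -(subnK gt) it; apply: F4; lia.
Qed.

(** * Sizes of states in copying mode and in heap mode *)

Section Sizes.
Variable Sig : finType.
Local Notation code := (code Sig).

Lemma code_size U t : abound 0 t -> size (code t) <= 2 * tsize (unf U t).
Proof.
elim: t => [n|a|s IHs t IHt|s IHs] //=.
- by rewrite size_ticks; lia.
- by case/andP=> /IHs ? /IHt ?; rewrite !size_cat /=; lia.
- by move/IHs; rewrite size_cat /=; lia.
Qed.

Lemma tot_rep T V H : tot (rep Sig (T, V, H)) =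
  size (codeT Sig T) + size (codeV Sig V) + size (entries Sig H) + size H.
Proof. by rewrite /rep /tot /= size_rev size_ticks; lia. Qed.

(** With an empty heap no address occurs, and code is at most twice the size of its term. A stored
    abstraction has the three extra tokens [Lam], [Ret] and [Sep] against one [lam] node, which
    raises the factor to 3. *)
Lemma tot_rep_subst t T V U : inv t (T, V, [::]) U ->
  tot (rep Sig (T, V, [::])) <= 3 * tsize t.
Proof.
case=> /= _ _ _ gT gV _ /dec_size /=; rewrite addn0 => ->; rewrite tot_rep /= !addn0.
rewrite addnC mulnDr; apply: leq_add.
- elim: V gV => //= q V IH /andP[/andP[_ aq] /IH {}IH].
  rewrite /codeV /= -/(codeV Sig V) size_cat size_rcons size_rev /= size_cat /=.
  by have := code_size U aq; move: IH; rewrite /codeV; lia.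
- elim: T gT => //= o T IH /andP[go /IH {}IH].
  rewrite /codeT /= -/(codeT Sig T) size_cat; move: IH; rewrite -/(codeT Sig T).
  case: o go => [h /andP[_ /andP[_ ah]]|_] /=; last by lia.
  by have := code_size U ah; have := tsize_gt0 (unf U h); lia.
Qed.

Lemma iter_nil n st : st.2 = [::] -> (iter n (anext false) st).2 = [::].
Proof.
elim: n => //= n IH /IH; case: (iter _ _ _) => [[T V] H] /= ->.
by case: T => [|[[m|a|s t|s]|] T] //=; case: V => [|r [|q V]].
Qed.

(* Addresses count as single symbols, so that substituting one never increases
   the size. *)
Fixpoint csize (t : hterm) : nat :=
  match t with
  | hvar n => n.+1
  | hadr _ => 1
  | happ s t => csize s + csize t + 1
  | hlam s => csize s + 2
  end.

Lemma csize_code t n : abound n t -> size (code t) <= csize t * n.+1.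
Proof.
elim: t => [m|a|s IHs t IHt|s IHs] //=.
- by rewrite size_ticks; nia.
- by rewrite size_ticks; lia.
- by case/andP=> /IHs ? /IHt ?; rewrite !size_cat /=; nia.
- by move/IHs; rewrite size_cat /=; nia.
Qed.

Lemma csize_hsubst s k a : csize (hsubst s k (hadr a)) <= csize s.
Proof.
elim: s k => [n|b|s IHs t IHt|s IHs] k //=.
- by case: eqP.
- by have := IHs k; have := IHt k; lia.
- by have := IHs k.+1; lia.
Qed.

Definition small N (st : astate) : bool :=
  [&& all (fun o => if o is Some t then csize t <= N else true) st.1.1,
      all (fun q => csize q <= N) st.1.2 & all (fun q => csize q <= N) st.2].

Lemma flat_small N t : csize t <= N ->
  all (fun o => if o is Some t then csize t <= N else true) (flat t).
Proof.
by elim: t => [n|a|s IHs t IHt|s IHs] H /=; rewrite ?andbT ?all_cat ?IHs ?IHt //;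
  move: H => /=; lia.
Qed.

Lemma size_flat t : size (flat t) <= csize t.
Proof. by elim: t => [n|a|s IHs t IHt|s IHs] //=; rewrite ?size_cat /=; lia. Qed.

(** [N] is meant as the size of the initial term and [j] as the number of steps made: a step adds at
    most [N] tasks, one value and one cell, and substituting an address enlarges no piece. *)
Definition heap_inv N j (st : astate) : Prop :=
  [/\ small N st, size st.1.1 <= N * j.+1, size st.1.2 <= j & size st.2 <= j].

Lemma heap_inv_next N j st : ready st -> heap_inv N j st -> heap_inv N j.+1 (anext true st).
Proof.
case: st => [[T V] H] /= rd [/and3P[/= sT sV sH] nT nV nH].
case: T rd sT nT => [|[[n|a|s t|q]|] T] //= rd sT nT.
- split=> /=; [|by nia|by lia|by lia].
  case/andP: sT => _ sT; apply/and3P; split=> //=.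
  by apply/andP; split=> //; apply: (all_nthP _ sH).
- case/andP: sT => cq sT; split=> /=; [|by nia|by lia|by lia].
  apply/and3P; split=> //=; apply/andP; split=> //; exact: leq_trans (leq_addr _ _) cq.
- case: V rd sV nV => [|r [|q V]] //= _ /and3P[cr cq sV] nV.
  set u := hadr (size H); have hu : csize (hsubst q 0 u) <= N.
    by apply: leq_trans (csize_hsubst _ _ _) cq.
  split=> /=; [| |by lia|by rewrite size_rcons; lia].
    by apply/and3P; split=> //=; rewrite ?all_cat ?flat_small ?all_rcons ?cr.
  by rewrite size_cat; have := size_flat (hsubst q 0 u); nia.
Qed.

Lemma heap_inv_iter N n st : heap_inv N 0 st ->
  (forall j, j < n -> ready (iter j (anext true) st)) ->
  forall j, j <= n -> heap_inv N j (iter j (anext true) st).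
Proof.
move=> H0 R; elim=> [|j IH] Hj //=.
by apply: heap_inv_next; [apply: R|apply: IH; lia].
Qed.

(** Rounded up from at most [N * j.+1 + j + j] pieces, each with code of length at most
    [(N + 3) * j.+1] because addresses stay below [j], together with the entry counter. *)
Definition heap_bound N j := (2 * N + 4) * (N + 4) * j.+1 * j.+1.

Lemma heap_arith N j :
  (N * j.+1 + j + j) * ((N + 3) * j.+1) + j <= (2 * N + 4) * (N + 4) * j.+1 * j.+1.
Proof.
have H1 : N * j.+1 + j + j <= (N + 2) * j.+1 by rewrite mulnDl; lia.
apply: (@leq_trans ((N + 2) * j.+1 * ((N + 3) * j.+1) + j.+1 * j.+1)).
  by apply: leq_add; [rewrite leq_mul2r H1 orbT|nia].
rewrite (_ : (N + 2) * j.+1 * ((N + 3) * j.+1) = (N + 2) * (N + 3) * j.+1 * j.+1); last first.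
  by rewrite -!mulnA; congr (_ * _); rewrite mulnCA.
rewrite -[_ * _ * j.+1 * j.+1]mulnA -[_ * _ * j.+1 * j.+1]mulnA -{2}[j.+1 * j.+1]mul1n -mulnDl.
by rewrite leq_mul2r; apply/orP; right; nia.
Qed.

Lemma tot_rep_heap N j t st U : inv t st U -> heap_inv N j st ->
  tot (rep Sig st) <= heap_bound N j.
Proof.
case: st => [[T V] H] [/= _ _ _ gT gV gH _] [/and3P[/= sT sV sH] nT nV nH].
rewrite tot_rep.
have L (W : seq hterm) (f : hterm -> nat) : all (good (size H) 1) W ->
    all (fun q => csize q <= N) W -> (forall h, f h = size (code h) + 3) ->
    sumn [seq f h | h <- W] <= size W * ((N + 3) * j.+1).
  move=> + + Ef; elim: W => //= h W IH /andP[/andP[_ ah] gW] /andP[ch cW].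
  have := IH gW cW; rewrite Ef; have := csize_code ah.
  have : csize h * (size H).+1 <= N * j.+1 by apply: leq_mul.
  by rewrite mulSn mulnDl; lia.
have LV : size (codeV Sig V) <= size V * ((N + 3) * j.+1).
  rewrite /codeV size_flatten /shape -map_comp; apply: L => // h /=.
  by rewrite size_rcons size_rev /= size_cat /=; lia.
have LH : size (entries Sig H) <= size H * ((N + 3) * j.+1).
  rewrite /entries size_flatten /shape -map_comp; apply: L => // h /=.
  by rewrite size_rcons size_cat /=; lia.
have LT : size (codeT Sig T) <= size T * ((N + 3) * j.+1).
  rewrite /codeT size_flatten /shape -map_comp.
  elim: T gT sT {nT} => //= o T IH /andP[go gT] /andP[co sT].
  have := IH gT sT; rewrite mulSn; suff : size (codeO Sig o) <= (N + 3) * j.+1 by lia.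
  case: o go co => [h /andP[_ /andP[_ ah]] ch|_ _] /=; last by nia.
  apply: leq_trans (csize_code ah) _; apply: leq_mul; lia.
set P := (N + 3) * j.+1 in LV LH LT.
apply: (@leq_trans ((size T + size V + size H) * P + size H)).
  by rewrite !mulnDl leq_add2r !leq_add.
apply: (@leq_trans ((N * j.+1 + j + j) * P + j)).
  by apply: leq_add => //; apply: leq_mul => //; rewrite !leq_add.
rewrite /heap_bound /P; apply: heap_arith.
Qed.

End Sizes.

(** * Stack programs on a single-tape Turing machine *)

(* Cell [j] of the tape holds the [j]-th symbol from the top of every stack,
   together with the [j]-th input symbol.  Hence a push or a pop shifts one track
   by one cell in a sweep over the tape, which is delimited by blanks.  A push
   that runs off the right end restarts the computation: first in the other mode
   on the same number of cells, then in the first mode with one cell more. *)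

Inductive phase := pConv | pExt | pRew | pRun | pPush | pBack | pPopR | pPopL.

Definition nat_of_phase p :=
  match p with pConv => 0 | pExt => 1 | pRew => 2 | pRun => 3 | pPush => 4 | pBack => 5
  | pPopR => 6 | pPopL => 7 end.
Definition phase_of_nat n :=
  match n with 0 => pConv | 1 => pExt | 2 => pRew | 3 => pRun | 4 => pPush | 5 => pBack
  | 6 => pPopR | _ => pPopL end.
Lemma phase_ordK :
  cancel (fun t => inord (nat_of_phase t) : 'I_8) (fun i => phase_of_nat i).
Proof. by case; rewrite /= inordK. Qed.
HB.instance Definition _ := Finite.copy phase (can_type phase_ordK).

Section Machine.
Variable Sig : finType.
Local Notation A := (asym Sig).
Variable P : bool -> program A.
Variable start : lab.

(** The pushes still to be done by an instruction are kept in the finite control, so their number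
    needs a uniform bound. *)
Definition width : nat := \max_(b : bool) \max_(l : lab) \max_(o : option A) size ((P b l).2 o).1.

Lemma size_width b l o : size ((P b l).2 o).1 <= width.
Proof.
apply: leq_trans (leq_bigmax b); apply: leq_trans (leq_bigmax l).
exact: (leq_bigmax (F := fun o => size ((P b l).2 o).1) o).
Qed.

Definition track := (option Sig * {ffun idx -> option A})%type.

Definition mstate : finType :=
  (phase * bool * (lab + bool) * width.-bseq (idx * A) * idx * option A)%type.

Definition mk p b l w i c : mstate :=
  (p, b, l, insub_bseq width w, i, c).

Local Notation mcell := (option (Sig + track)).

Definition setv (v : {ffun idx -> option A}) i c : {ffun idx -> option A} :=
  [ffun j => if j == i then c else v j].
Definition blankv : {ffun idx -> option A} := [ffun=> None].
(** The input component of a cell is never overwritten once set, so each restart can refill [iI]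
    from it. *)
Definition resetv (a : option Sig) : {ffun idx -> option A} :=
  [ffun j => if j is iI then omap inl a else None].

Definition mhalt (q : mstate) : option bool :=
  let: (p, b, l, w, i, c) := q in
  match p, l, (w : seq _) with pRun, inr o, [::] => Some o | _, _, _ => None end.

(** A push carries the displaced symbol to the right; meeting the blank with a symbol in hand is the
    overflow. A pop first runs to the right end and then shifts leftwards, so that the symbol in
    hand at the left blank is the one popped. *)
Definition mdelta (q : mstate) (h : mcell) : mstate * mcell * move :=
  let: (p, b, l, w, i, c) := q in
  match p, h with
  | pConv, Some (inl a) => (q, Some (inr (Some a, blankv)), Rmove)
  | pConv, None =>
    (mk pExt false (inl start) [::] iI None, Some (inr (None, blankv)), Rmove)
  | pExt, _ => (mk pRew b (inl start) [::] iI None, h, Lmove)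
  | pRew, Some (inr (a, _)) => (q, Some (inr (a, resetv a)), Lmove)
  | pRew, None => (mk pRun b (inl start) [::] iI None, None, Rmove)
  | pRun, _ =>
    match (w : seq _), l with
    | (j, a) :: w', _ => (mk pPush b l w' j (Some a), h, Nmove)
    | [::], inl l' => (mk pPopR b l [::] (P b l').1 None, h, Nmove)
    | [::], inr _ => (q, h, Nmove)
    end
  | pPush, Some (inr (a, v)) =>
    ((pPush, b, l, w, i, v i), Some (inr (a, setv v i c)), Rmove)
  | pPush, None =>
    if c is None then ((pBack, b, l, w, iI, None), None, Lmove)
    else if b then (mk pExt false (inl start) [::] iI None, Some (inr (None, blankv)), Rmove)
    else (mk pRew true (inl start) [::] iI None, None, Lmove)
  | pBack, Some _ => (q, h, Lmove)
  | pBack, None => ((pRun, b, l, w, iI, None), None, Rmove)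
  | pPopR, Some _ => (q, h, Rmove)
  | pPopR, None => ((pPopL, b, l, w, i, None), None, Lmove)
  | pPopL, Some (inr (a, v)) =>
    ((pPopL, b, l, w, i, v i), Some (inr (a, setv v i c)), Lmove)
  | pPopL, None =>
    if l is inl l' then
      let: (w', l'') := (P b l').2 c in (mk pRun b l'' w' iI None, None, Rmove)
    else (q, None, Nmove)
  | _, _ => (q, h, Nmove)
  end.

Definition machine : TM Sig :=
  {| tm_state := mstate; tm_work := track; tm_start := mk pConv false (inl start) [::] iI None;
     tm_halt := mhalt; tm_delta := mdelta |}.

Lemma bseq_mk (w : seq (idx * A)) : size w <= width -> insub_bseq width w = w :> seq _.
Proof. by move=> H; rewrite /insub_bseq insubdK. Qed.

Lemma mhalt_mk p b l w i c : (if p is pRun then false else true) -> mhalt (mk p b l w i c) = None.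
Proof. by case: p. Qed.

(* [conf q L R]: [L] is the tape left of the head, nearest first, and [R] the
   tape from the head on. *)
Definition conf (q : mstate) (L R : seq mcell) : config machine :=
  (q, L, head None R, behead R).
Definition lconf (q : mstate) (L R : seq mcell) : config machine :=
  conf q (behead L) (head None L :: R).

Lemma step_right q L h R q' w : mdelta q h = (q', w, Rmove) ->
  tm_step (conf q L (h :: R)) = conf q' (w :: L) R.
Proof. by move=> E; rewrite /tm_step /conf /= E; case: R {E} => [|r R]. Qed.

Lemma step_left q L h R q' w : mdelta q h = (q', w, Lmove) ->
  tm_step (conf q L (h :: R)) = lconf q' L (w :: R).
Proof. by move=> E; rewrite /tm_step /conf /= E; case: L {E}. Qed.

Lemma step_none q L h R q' w : mdelta q h = (q', w, Nmove) ->
  tm_step (conf q L (h :: R)) = conf q' L (w :: R).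
Proof. by move=> E; rewrite /tm_step /conf /= E. Qed.

Lemma conf_nil q L : conf q L [::] = conf q L [:: None].
Proof. by []. Qed.

Lemma size_conf q L R : cfg_size (conf q L R) <= size L + size R + 1.
Proof.
suff : size L + 1 + size (behead R) <= size L + size R + 1 by [].
by rewrite size_behead; lia.
Qed.

Lemma size_lconf q L R : cfg_size (lconf q L R) <= size L + size R + 2.
Proof.
suff : size (behead L) + 1 + size R <= size L + size R + 2 by [].
by rewrite size_behead; lia.
Qed.

Inductive treach (M : nat) : nat -> config machine -> config machine -> Prop :=
| treach_refl c k : cfg_size c <= M -> treach M k c c
| treach_step c c' k : cfg_size c <= M -> @tm_halt Sig machine (cfg_state c) = None ->
    treach M k (@tm_step Sig machine c) c' -> treach M k.+1 c c'.

Lemma treach_le M k c c' M' k' :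
  treach M k c c' -> k <= k' -> M <= M' -> treach M' k' c c'.
Proof.
move=> H; elim: H k' => {k c c'} [c k Hc|c c' k Hc hc _ IH] k' Hk HM.
  by apply: treach_refl; lia.
by case: k' Hk => // k' Hk; apply: treach_step; [lia|exact: hc|apply: IH].
Qed.

Lemma treach_trans M k1 k2 c1 c2 c3 :
  treach M k1 c1 c2 -> treach M k2 c2 c3 -> treach M (k1 + k2) c1 c3.
Proof.
elim=> {k1 c1 c2} [c k Hc|c c' k Hc hc _ IH] H.
  by apply: (treach_le H); lia.
by rewrite addSn; apply: treach_step => //; apply: IH.
Qed.

Lemma treach_iter M k c c' : treach M k c c' ->
  exists m, [/\ m <= k, iter m (@tm_step Sig machine) c = c',
    (forall j, j <= m -> cfg_size (iter j (@tm_step Sig machine) c) <= M) &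
    (forall j, j < m -> @tm_halt Sig machine (cfg_state (iter j (@tm_step Sig machine) c)) = None)].
Proof.
elim=> {k c c'} [c k Hc|c c' k Hc hc _ [m [Hm H1 H2 H3]]].
  by exists 0; split=> // -[].
exists m.+1; split=> //.
- by rewrite iterSr.
- by case=> [|j] Hj //; rewrite iterSr; apply: H2.
- by case=> [|j] Hj //; rewrite iterSr; apply: H3.
Qed.

Section Sweeps.
Variable x : seq Sig.

Definition rawcell (v : nat -> {ffun idx -> option A}) (j : nat) : mcell :=
  Some (inr (onth x j, v j)).
Definition rawcells v j n := [seq rawcell v i | i <- iota j n].
Definition content (s : stacks A) (j : nat) : {ffun idx -> option A} :=
  [ffun i => onth (get s i) j].
Definition cells s j n := rawcells (content s) j n.

Lemma size_rawcells v j n : size (rawcells v j n) = n.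
Proof. by rewrite size_map size_iota. Qed.

Lemma rawcellsS v j n : rawcells v j n.+1 = rawcell v j :: rawcells v j.+1 n.
Proof. by []. Qed.

Lemma rev_rawcellsS v n : rev (rawcells v 0 n.+1) = rawcell v n :: rev (rawcells v 0 n).
Proof. by rewrite /rawcells -addn1 iotaD map_cat rev_cat. Qed.

Lemma content_set s i v j : content (set s i v) j = setv (content s j) i (onth v j).
Proof. by apply/ffunP=> k; rewrite !ffunE get_set; case: eqP => // ->. Qed.

(** The slack covers the delimiting blanks and the crude estimates [size_conf] and [size_lconf]. *)
Definition tape_room (s : nat) := s + 6.

Ltac tsize := rewrite /tape_room; 
  match goal with
  | |- context [cfg_size (lconf _ _ _)] => apply: leq_trans (size_lconf _ _ _) _
  | |- context [cfg_size (conf _ _ _)] => apply: leq_trans (size_conf _ _ _) _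
  end;
  rewrite /= ?(size_cat, size_rev, size_rawcells) /= ?(size_cat, size_rev, size_rawcells) /=; lia.

(** In front of cell [j] the symbol in hand is the [j]-th of the new stack; exchanging it with the
    cell leaves the next one in hand. *)
Lemma sweep_push b l w i a st L0 tl n j : size L0 <= 1 -> size tl <= 1 ->
  let st' := set st i (a :: get st i) in
  treach (tape_room (j + n)) n
    (conf (mk pPush b l w i (onth (a :: get st i) j)) (rev (cells st' 0 j) ++ L0)
          (cells st j n ++ tl))
    (conf (mk pPush b l w i (onth (a :: get st i) (j + n)))
          (rev (cells st' 0 (j + n)) ++ L0) tl).
Proof.
move=> sL sR st'; elim: n j => [|n IH] j.
  by rewrite addn0; apply: treach_refl; tsize.
apply: treach_step; [by tsize|exact: mhalt_mk|].
rewrite [cells _ _ _.+1]rawcellsS.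
have E : mdelta (mk pPush b l w i (onth (a :: get st i) j)) (rawcell (content st) j) =
  (mk pPush b l w i (onth (a :: get st i) j.+1), rawcell (content st') j, Rmove).
  by rewrite /mdelta /mk /= /rawcell /st' content_set ffunE.
rewrite (step_right _ _ E) addnS -addSn.
by have := IH j.+1; rewrite [rev (cells _ 0 j.+1)]rev_rawcellsS.
Qed.


Lemma lconf_cons q c L R : lconf q (c :: L) R = conf q L (c :: R).
Proof. by []. Qed.

Definition quiet (q : mstate) := if q.1.1.1.1.1 is pRun then false else true.

Lemma quiet_halt q : quiet q -> mhalt q = None.
Proof. by case: q => [[[[[[] b] l] w] i] c]. Qed.

(** Common to popping, returning and rewinding. The state may vary with the position because a pop
    carries a symbol along. *)
Lemma sweep_left (q : nat -> mstate) v v' L0 R n :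
  size L0 <= 1 -> (forall j, quiet (q j)) ->
  (forall j, j < n -> mdelta (q j.+1) (rawcell v j) = (q j, rawcell v' j, Lmove)) ->
  treach (tape_room (n + size R)) n
    (lconf (q n) (rev (rawcells v 0 n) ++ L0) R)
    (lconf (q 0) L0 (rawcells v' 0 n ++ R)).
Proof.
move=> sL qq; elim: n R => [|n IH] R Hq.
  by apply: treach_refl; tsize.
apply: treach_step; [by tsize|exact: (quiet_halt (qq n.+1))|].
rewrite rev_rawcellsS cat_cons lconf_cons (step_left _ _ (Hq n (ltnSn n))).
have -> : rawcells v' 0 n.+1 ++ R = rawcells v' 0 n ++ rawcell v' n :: R.
  by rewrite /rawcells -addn1 iotaD map_cat -catA.
by have := IH (rawcell v' n :: R); rewrite /= addnS -addSn; apply=> j Hj; apply: Hq; lia.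
Qed.

Lemma sweep_popR b l w i v L0 tl n j : size L0 <= 1 -> size tl <= 1 ->
  treach (tape_room (j + n)) n
    (conf (mk pPopR b l w i None) (rev (rawcells v 0 j) ++ L0) (rawcells v j n ++ tl))
    (conf (mk pPopR b l w i None) (rev (rawcells v 0 (j + n)) ++ L0) tl).
Proof.
move=> sL sR; elim: n j => [|n IH] j.
  by rewrite addn0; apply: treach_refl; tsize.
apply: treach_step; [by tsize|exact: mhalt_mk|].
rewrite [rawcells _ _ _.+1]rawcellsS cat_cons.
have E : mdelta (mk pPopR b l w i None) (rawcell v j) =
  (mk pPopR b l w i None, rawcell v j, Rmove) by [].
rewrite (step_right _ _ E) addnS -addSn.
by have := IH j.+1; rewrite [rev (rawcells _ 0 j.+1)]rev_rawcellsS.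
Qed.

Definition run_conf b l w st s (tl : seq mcell) :=
  conf (mk pRun b l w iI None) [:: None] (cells st 0 s ++ tl).

(** The right delimiter may be a cell not yet visited or an explicit blank; once the head stands
    there, the two give the same configuration. *)
Definition blank_end (tl : seq mcell) := tl = [::] \/ tl = [:: None].

Lemma conf_blank q L tl : blank_end tl -> conf q L tl = conf q L [:: None].
Proof. by case=> ->. Qed.

Lemma blank_size tl : blank_end tl -> size tl <= 1.
Proof. by case=> ->. Qed.

Lemma tm_pop b l st s tl : blank_end tl -> size (get st (P b l).1) <= s ->
  let: (i, f) := P b l in let: (w, l') := f (ohead (get st i)) in
  treach (tape_room s.+1) (2 * s + 3) (run_conf b (inl l) [::] st s tl)
     (run_conf b l' w (set st i (behead (get st i))) s [:: None]).
Proof.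
move=> bt; case EP: (P b l) => [i f] /= si; case Ef: (f _) => [w l'].
set st' := set _ _ _.
apply: (@treach_le (tape_room s.+1) (1 + (s + (1 + (s + 1)))) _ _ (tape_room s.+1)); [|lia|by []].
have E1 : mdelta (mk pRun b (inl l) [::] iI None) (head None (cells st 0 s ++ tl)) =
  (mk pPopR b (inl l) [::] i None, head None (cells st 0 s ++ tl), Nmove).
  by rewrite /mdelta /mk bseq_mk // EP.
have E2 : mdelta (mk pPopR b (inl l) [::] i None) None =
  ((pPopL, b, inl l, insub_bseq width [::], i, None), None, Lmove) by [].
pose q j : mstate := (pPopL, b, inl l, insub_bseq width [::], i, onth (get st i) j).
have qs : q s = (pPopL, b, inl l, insub_bseq width [::], i, None).
  by rewrite /q onth_default.
have Eb u j : onth u j.+1 = onth (behead u) j :> option A by case: u => //=; rewrite onth0n.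
have E3 : forall j, j < s -> mdelta (q j.+1) (rawcell (content st) j) =
   (q j, rawcell (content st') j, Lmove).
  by move=> j _; rewrite /q Eb /mdelta /rawcell /st' content_set ffunE.
have E4 : mdelta (q 0) None = (mk pRun b l' w iI None, None, Rmove).
  have -> : q 0 = (pPopL, b, inl l, insub_bseq width [::], i, ohead (get st i)).
    by rewrite /q; case: (get st i).
  by rewrite /mdelta EP /= Ef.
have Hr : run_conf b (inl l) [::] st s tl =
  conf (mk pRun b (inl l) [::] iI None) [:: None]
       (head None (cells st 0 s ++ tl) :: behead (cells st 0 s ++ tl)).
  by rewrite /run_conf; case: (_ ++ _).
have Hr2 : conf (mk pPopR b (inl l) [::] i None) [:: None]
       (head None (cells st 0 s ++ tl) :: behead (cells st 0 s ++ tl)) =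
  conf (mk pPopR b (inl l) [::] i None) [:: None] (cells st 0 s ++ tl).
  by case: (_ ++ _).
have tl1 := blank_size bt.
apply: treach_trans.
  apply: treach_step; last by rewrite Hr (step_none _ _ E1) Hr2; apply: treach_refl; tsize.
  - by rewrite /run_conf; tsize.
  - by [].
apply: treach_trans.
  apply: (treach_le (@sweep_popR b (inl l) [::] i (content st) [:: None] tl s 0 _ _)) => //.
rewrite add0n (conf_blank _ _ bt); apply: treach_trans.
  apply: treach_step; last by rewrite (step_left _ _ E2) -qs; apply: treach_refl; tsize.
  - by tsize.
  - by [].
apply: treach_trans.
  apply: (treach_le (@sweep_left q (content st) (content st') [:: None] [:: None] s _ _ E3)) => //.
  by rewrite /tape_room /=; lia.
apply: treach_step; first by tsize.
  by [].
by rewrite lconf_cons (step_right _ _ E4) /run_conf; apply: treach_refl; tsize.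
Qed.

Lemma tm_push b l i a w st s tl : blank_end tl -> size w < width ->
  let st' := set st i (a :: get st i) in
  treach (tape_room s.+1) (s + 2) (run_conf b l ((i, a) :: w) st s tl)
     (conf (mk pPush b l w i (onth (a :: get st i) s))
        (rev (cells st' 0 s) ++ [:: None]) [:: None]).
Proof.
move=> bt sw st'; have tl1 := blank_size bt.
have E1 : mdelta (mk pRun b l ((i, a) :: w) iI None) (head None (cells st 0 s ++ tl)) =
  (mk pPush b l w i (Some a), head None (cells st 0 s ++ tl), Nmove).
  by rewrite /mdelta /= bseq_mk.
apply: (@treach_le (tape_room s.+1) (1 + s) _ _ (tape_room s.+1)); [|lia|by []].
have Hr : run_conf b l ((i, a) :: w) st s tl =
  conf (mk pRun b l ((i, a) :: w) iI None) [:: None]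
       (head None (cells st 0 s ++ tl) :: behead (cells st 0 s ++ tl)).
  by rewrite /run_conf; case: (_ ++ _).
have Hr2 : conf (mk pPush b l w i (Some a)) [:: None]
       (head None (cells st 0 s ++ tl) :: behead (cells st 0 s ++ tl)) =
  conf (mk pPush b l w i (Some a)) [:: None] (cells st 0 s ++ tl).
  by case: (_ ++ _).
apply: treach_trans.
  apply: treach_step; last by rewrite Hr (step_none _ _ E1) Hr2; apply: treach_refl; tsize.
  - by rewrite /run_conf; tsize.
  - by rewrite /= bseq_mk //; case: (l).
rewrite -(conf_blank _ _ bt).
apply: (treach_le (@sweep_push b l w i a st [:: None] tl s 0 _ _)) => //.
Qed.

Lemma tm_push_ok b l i a w st s tl : blank_end tl -> size w < width ->
  size (get st i) < s ->
  treach (tape_room s.+1) (2 * s + 4) (run_conf b l ((i, a) :: w) st s tl)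
     (run_conf b l w (set st i (a :: get st i)) s [:: None]).
Proof.
move=> bt sw si; apply: (@treach_le (tape_room s.+1) (s + 2 + (1 + (s + 1))) _ _ (tape_room s.+1)); [|lia|by []].
apply: treach_trans; first exact: tm_push.
set st' := set _ _ _; rewrite onth_default //.
have E1 : mdelta (mk pPush b l w i None) None =
  ((pBack, b, l, insub_bseq width w, iI, None), None, Lmove) by [].
pose q : mstate := (pBack, b, l, insub_bseq width w, iI, None).
have E2 : forall j, j < s -> mdelta q (rawcell (content st') j) =
   (q, rawcell (content st') j, Lmove) by [].
have E3 : mdelta q None = (mk pRun b l w iI None, None, Rmove) by [].
apply: treach_trans.
  apply: treach_step; last by rewrite (step_left _ _ E1); apply: treach_refl; tsize.
  - by tsize.
  - by [].
apply: treach_trans.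
  apply: (treach_le (@sweep_left (fun=> q) (content st') (content st') [:: None] [:: None] s _ _ E2)) => //.
  by rewrite /tape_room /=; lia.
apply: treach_step; first by tsize.
  by [].
by rewrite lconf_cons (step_right _ _ E3) /run_conf; apply: treach_refl; tsize.
Qed.

Definition init0 : stacks A :=
  Stk [seq inl c | c <- x] [::] [::] [::] [::] [::] [::] [::] [::] [::].

Lemma content_init0 j : content init0 j = resetv (onth x j).
Proof. by apply/ffunP=> i; rewrite !ffunE; case: i; rewrite /= ?onth0n ?onth_map. Qed.

(** [L0] is empty after the conversion of the input, which has not yet visited the left blank, and
    [[:: None]] at every later restart. *)
Lemma tm_rewind b v s L0 : size L0 <= 1 -> head None L0 = None -> behead L0 = [::] ->
  treach (tape_room s.+1) (s + 1)
    (lconf (mk pRew b (inl start) [::] iI None) (rev (rawcells v 0 s) ++ L0) [:: None])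
    (run_conf b (inl start) [::] init0 s [:: None]).
Proof.
move=> sL hL bL; pose q := mk pRew b (inl start) [::] iI None.
have E1 : forall j, j < s -> mdelta q (rawcell v j) = (q, rawcell (content init0) j, Lmove).
  by move=> j _; rewrite /rawcell content_init0.
apply: treach_trans.
  apply: (treach_le (@sweep_left (fun=> q) v (content init0) L0 [:: None] s _ _ E1)) => //.
  by rewrite /tape_room /=; lia.
have E2 : mdelta q None = (mk pRun b (inl start) [::] iI None, None, Rmove) by [].
apply: treach_step; first by tsize.
  by [].
rewrite /lconf hL bL (step_right _ _ E2) /run_conf; apply: treach_refl; tsize.
Qed.

Definition restart (b : bool) (s : nat) : config machine :=
  run_conf b (inl start) [::] init0 s [:: None].

Lemma tm_extend v s L0 L : size L0 <= 1 -> head None L0 = None -> behead L0 = [::] ->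
  size x <= s -> L = (Some (inr (None, blankv)) : mcell) :: rev (rawcells v 0 s) ++ L0 ->
  treach (tape_room s.+2) (s + 3) (conf (mk pExt false (inl start) [::] iI None) L [::])
    (restart false s.+1).
Proof.
move=> sL hL bL sx ->; pose q := mk pExt false (inl start) [::] iI None.
apply: (@treach_le (tape_room s.+2) (1 + (s.+1 + 1)) _ _ (tape_room s.+2)); [|lia|by []].
apply: treach_trans.
  have E : mdelta q None = (mk pRew false (inl start) [::] iI None, None, Lmove) by [].
  apply: treach_step; last by rewrite conf_nil (step_left _ _ E); apply: treach_refl; tsize.
  - by tsize.
  - by [].
pose v' j := if j < s then v j else blankv.
have Ev : rev (rawcells v' 0 s.+1) =
          (Some (inr (None, blankv)) : mcell) :: rev (rawcells v 0 s).
  rewrite rev_rawcellsS /rawcell /v' ltnn onth_default //; congr (_ :: rev _).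
  by apply/eq_in_map => j; rewrite mem_iota /rawcell => /andP[_ ->].
by have := @tm_rewind false v' s.+1 L0 sL hL bL; rewrite Ev.
Qed.

Definition next_mode b s := if b then restart false s.+1 else restart true s.

Lemma tm_push_overflow b l i a w st s tl : blank_end tl -> size w < width ->
  size x <= s -> s <= size (get st i) ->
  treach (tape_room s.+2) (2 * s + 6) (run_conf b l ((i, a) :: w) st s tl) (next_mode b s).
Proof.
move=> bt sw sx si; apply: (@treach_le (tape_room s.+2) (s + 2 + (1 + (s + 3))) _ _ (tape_room s.+2)); [|lia|by []].
apply: treach_trans; first by apply: (treach_le (@tm_push b l i a w st s tl bt sw)); rewrite /tape_room; lia.
set st' := set _ _ _; case Eo: (onth _ s) => [c|]; last first.
  by move: (onthTE (a :: get st i) s); rewrite Eo /= ltnS si.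
rewrite /next_mode; case: b.
  have E : mdelta (mk pPush true l w i (Some c)) None =
    (mk pExt false (inl start) [::] iI None, Some (inr (None, blankv)), Rmove) by [].
  apply: treach_step; [by tsize|by []|rewrite (step_right _ _ E)].
  exact: (@tm_extend (content st') s [:: None]).
have E : mdelta (mk pPush false l w i (Some c)) None =
  (mk pRew true (inl start) [::] iI None, None, Lmove) by [].
apply: treach_step; [by tsize|by []|rewrite (step_left _ _ E)].
by apply: (treach_le (tm_rewind _ _ _ _ _ _)) => //; rewrite /tape_room; lia.
Qed.

End Sweeps.
End Machine.

(** * Attempts on a growing tape *)

Section Simulation.
Variable Sig : finType.
Local Notation A := (asym Sig).
Variable P : bool -> program A.
Variable start : lab.
Variable x : seq Sig.

Local Notation treach := (@treach Sig P start).
Local Notation run_conf := (@run_conf Sig P start x).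
Local Notation restart := (restart P start x).
Local Notation next_mode := (next_mode P start x).
Local Notation width := (width P).
Local Notation blanks := [:: None].

Definition fits (s : nat) (st : stacks A) : bool := [forall i, size (get st i) <= s].

Definition step_cost (s : nat) := width.+1 * (2 * s + 6).

Let bl : @blank_end Sig blanks. Proof. by right. Qed.

Lemma size_pushes (w : seq (idx * A)) st i : size (get st i) <= size (get (pushes w st) i).
Proof.
elim: w st => //= -[j a] w IH st; apply: leq_trans (IH _); rewrite get_set /=.
by case: eqP => // ->.
Qed.

(** Pushes never shrink a stack, so an overflow in the middle of the list already shows that the
    final stacks do not fit. Overflow can thus be stated in terms of whole instructions. *)
Lemma tm_pushes b l w st s : size w <= width -> size x <= s -> fits s st ->
  (fits s (pushes w st) /\
   treach (tape_room s.+2) (size w * (2 * s + 6)) (run_conf b l w st s blanks)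
          (run_conf b l [::] (pushes w st) s blanks)) \/
  (~~ fits s (pushes w st) /\
   treach (tape_room s.+2) (size w * (2 * s + 6)) (run_conf b l w st s blanks) (next_mode b s)).
Proof.
elim: w st => [|[i a] w IH] st sw sx hs.
  by left; split=> //; apply: treach_refl; apply: leq_trans (size_conf _ _ _ _) _;
     rewrite size_cat size_rawcells /tape_room /=; lia.
case: (ltnP (size (get st i)) s) => [lt|ge].
  have hs' : fits s (set st i (a :: get st i)).
    apply/forallP=> j; rewrite get_set; case: eqP => // _.
    by move/forallP: hs; apply.
  have H1 : treach (tape_room s.+2) (2 * s + 6) (run_conf b l ((i, a) :: w) st s blanks)
     (run_conf b l w (set st i (a :: get st i)) s blanks).
    by apply: (treach_le (tm_push_ok start x b l a bl sw lt)); rewrite /tape_room; lia.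
  case: (IH _ (ltnW sw) sx hs') => -[h1 h2]; [left|right]; split=> //;
    by rewrite mulSn; apply: treach_trans H1 h2.
right; split.
  apply/negP=> /forallP /(_ i); have := size_pushes w (set st i (a :: get st i)) i.
  by rewrite get_set eqxx /=; lia.
apply: (treach_le (tm_push_overflow start b l a bl sw sx ge)) => //.
by rewrite [size _]/= mulSn leq_addr.
Qed.

Lemma tm_sstep b l st s : size x <= s -> fits s st ->
  let c := sstep (P b) (inl l, st) in
  (fits s c.2 /\
   treach (tape_room s.+2) (step_cost s) (run_conf b (inl l) [::] st s blanks)
          (run_conf b c.1 [::] c.2 s blanks)) \/
  (~~ fits s c.2 /\
   treach (tape_room s.+2) (step_cost s) (run_conf b (inl l) [::] st s blanks) (next_mode b s)).
Proof.
move=> sx hs; rewrite /sstep.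
have := @tm_pop _ P start x b l st s _ bl.
have := size_width P b l; case EP: (P b l) => [i f] sw.
have {}sw := sw (ohead (get st i)); move: sw.
rewrite [(_, _).2]/=; case: (f _) => [w l'] /= sw Hp.
have hi : size (get st i) <= s by move/forallP: hs; apply.
have {}Hp := Hp hi.
have hs' : fits s (set st i (behead (get st i))).
  apply/forallP=> j; rewrite get_set; case: eqP => [_|_]; last by move/forallP: hs; apply.
  by rewrite size_behead; lia.
have sc : 2 * s + 3 + size w * (2 * s + 6) <= step_cost s.
  by rewrite /step_cost mulSn; have := leq_mul sw (leqnn (2 * s + 6)); lia.
have {}Hp := treach_le Hp (leqnn _) (_ : tape_room s.+1 <= tape_room s.+2).
by case: (tm_pushes b l' sw sx hs') => -[h1 h2]; [left|right]; split=> //;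
  apply: (treach_le (treach_trans (Hp _) h2)).
Qed.

Definition trace b j := iter j (sstep (P b)) (inl start, init0 x).

Lemma fits_init s : size x <= s -> fits s (init0 x).
Proof. by move=> sx; apply/forallP; case=> //=; rewrite size_map. Qed.

Lemma tm_trace b s n : size x <= s ->
  (forall j, j < n -> exists l, (trace b j).1 = inl l) ->
  ((forall j, j <= n -> fits s (trace b j).2) /\
   treach (tape_room s.+2) (n * step_cost s) (restart b s)
          (run_conf b (trace b n).1 [::] (trace b n).2 s blanks)) \/
  (exists m, [/\ m < n, forall j, j <= m -> fits s (trace b j).2, ~~ fits s (trace b m.+1).2 &
   treach (tape_room s.+2) (m.+1 * step_cost s) (restart b s) (next_mode b s)]).
Proof.
move=> sx; elim: n => [|n IH] Hl.
  left; split; first by case=> // _; apply: fits_init.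
  apply: treach_refl; apply: leq_trans (size_conf _ _ _ _) _.
  by rewrite size_cat size_rawcells /tape_room /=; lia.
case: IH => [j Hj|[hs Hr]|[m [lt h1 h2 h3]]]; first by apply: Hl; lia.
  have [l El] := Hl n (ltnSn n).
  have Et : trace b n = (inl l, (trace b n).2) by rewrite -El; case: (trace b n).
  have := tm_sstep b l sx (hs n (leqnn n)); rewrite -Et -/(trace b n.+1) El in Hr *.
  case=> -[h1 h2].
    left; split.
      by move=> j; rewrite leq_eqVlt ltnS => /orP[/eqP->|/hs].
    by rewrite mulSn addnC; apply: treach_trans Hr h2.
  right; exists n; split=> //.
  by rewrite mulSn addnC; apply: treach_trans Hr h2.
by right; exists m; split=> //; lia.
Qed.

Variables (o : bool) (N : bool -> nat) (tau : nat -> nat).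
Hypothesis halts : forall b, (trace b (N b)).1 = inr o.
Hypothesis runs : forall b j, j < N b -> exists l, (trace b j).1 = inl l.
(* A prefix of the run that fits on [s] cells is short, even if the whole run
   does not fit and is long. *)
Hypothesis fast : forall b s m, m <= N b -> (forall j, j < m -> fits s (trace b j).2) -> m <= tau s.
Hypothesis tau_mono : forall s s', s <= s' -> tau s <= tau s'.

Definition halted (c : config (machine P start)) :=
  @tm_halt Sig (machine P start) (cfg_state c) = Some o.

Lemma tm_try b s : size x <= s ->
  (exists2 c, halted c & treach (tape_room s.+2) (tau s * step_cost s) (restart b s) c) \/
  ((exists2 j, j <= N b & ~~ fits s (trace b j).2) /\
   treach (tape_room s.+2) (tau s * step_cost s) (restart b s) (next_mode b s)).
Proof.
move=> sx; case: (tm_trace sx (@runs b)) => [[hs Hr]|[m [lt h1 h2 h3]]].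
  left; eexists; last first.
    apply: (treach_le Hr) => //; rewrite leq_mul2r; apply/orP; right.
    by apply: fast => // j /ltnW; apply: hs.
  rewrite /halted halts /=; by rewrite bseq_mk.
right; split; first by exists m.+1.
apply: (treach_le h3) => //; rewrite leq_mul2r; apply/orP; right.
by apply: (@fast b).
Qed.

(** Induction on the number [d] of extensions left: with [s1] cells mode [b0] cannot overflow any
    more. Each tape size costs at most two attempts, all charged at the price of the largest
    size. *)
Lemma tm_total b0 s1 : (forall j, j <= N b0 -> fits s1 (trace b0 j).2) ->
  forall d s, size x <= s -> s1 <= s + d ->
  exists2 c, halted c &
    treach (tape_room (s + d).+2) (d.+1 * (2 * (tau (s + d) * step_cost (s + d)))) (restart false s) c.
Proof.
move=> H1; have mono s s' : s <= s' -> tau s * step_cost s <= tau s' * step_cost s'.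
  move=> le; apply: leq_mul; first exact: tau_mono.
  by rewrite leq_mul2l; apply/orP; right; lia.
have fm s s' st : s <= s' -> fits s st -> fits s' st.
  by move=> le /forallP H; apply/forallP=> i; apply: leq_trans (H i) le.
elim=> [|d IH] s sx le.
- rewrite addn0 in le *.
  have ok : ~ exists2 j, j <= N b0 & ~~ fits s (trace b0 j).2.
    by case=> j /H1 /(fm _ _ _ le) ->.
  case: (tm_try false sx) => [[c hc Hc]|[nf Hr]].
    by exists c => //; apply: (treach_le Hc) => //; lia.
  case: (tm_try true sx) => [[c hc Hc]|[nt _]].
    by exists c => //; apply: (treach_le (treach_trans Hr Hc)) => //; lia.
  by exfalso; apply: ok; case: (b0).
- have le' : s1 <= s.+1 + d by rewrite addSnnS.
  have [c hc Hc] := IH s.+1 (leqW sx) le'.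
  rewrite addSnnS in Hc; set C := tau (s + d.+1) * _ in Hc *.
  have HC : tau s * step_cost s <= C by apply: mono; lia.
  have HM : tape_room s.+2 <= tape_room (s + d.+1).+2 by rewrite /tape_room; lia.
  case: (tm_try false sx) => [[c1 hc1 Hc1]|[nf Hr]].
    by exists c1 => //; apply: (treach_le Hc1) => //; nia.
  case: (tm_try true sx) => [[c1 hc1 Hc1]|[nt Hr2]].
    by exists c1 => //; apply: (treach_le (treach_trans Hr Hc1)) => //; nia.
  exists c => //.
  have H2 := treach_le (treach_trans Hr Hr2) (leqnn _) HM.
  by apply: (treach_le (treach_trans H2 Hc)) => //; nia.
Qed.

(** The first blank after the input is turned into an empty cell, so even the empty input starts
    with one cell. *)
Lemma tm_conv : treach (tape_room (size x).+2) (2 * size x + 5)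
  (init_config (machine P start) x) (restart false (size x).+1).
Proof.
pose q := mk P pConv false (inl start) [::] iI None.
have -> : init_config (machine P start) x = conf start q [::] [seq Some (inl c) | c <- x].
  by case: (x).
pose v (j : nat) : {ffun idx -> option A} := blankv Sig.
have sw n : n <= size x -> treach (tape_room (size x).+2) n
    (conf start q [::] [seq Some (inl c) | c <- x])
    (conf start q (rev (rawcells x v 0 n)) [seq Some (inl c) | c <- drop n x]).
  have sz k : k <= size x -> cfg_size (conf start q (rev (rawcells x v 0 k))
    [seq Some (inl c) | c <- drop k x]) <= tape_room (size x).+2.
    move=> Hk; apply: leq_trans (size_conf _ _ _ _) _.
    by rewrite size_rev size_rawcells size_map size_drop /tape_room; lia.
  elim: n => [|n IH] Hn; first by rewrite drop0; apply: treach_refl; have := sz 0 isT; rewrite drop0.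
  apply: (@treach_le _ _ _ (tape_room (size x).+2) (n + 1)); [|by rewrite addn1|by []].
  apply: treach_trans; first by apply: IH; lia.
  apply: treach_step; [by apply: sz; lia|by []|].
  case Ex: {1}x Hn => [|c0 x'] // Hn; rewrite -Ex in Hn.
  rewrite (drop_nth c0 Hn) map_cons.
  have E : mdelta start q (Some (inl (nth c0 x n))) =
    (q, Some (inr (Some (nth c0 x n), blankv Sig)), Rmove) by [].
  rewrite (step_right _ _ E) rev_rawcellsS /rawcell.
  have -> : onth x n = Some (nth c0 x n).
    by rewrite onthE (nth_map c0).
  apply: treach_refl; have := sz n.+1 Hn; rewrite rev_rawcellsS /rawcell.
  by rewrite onthE (nth_map c0).
apply: (@treach_le _ _ _ (tape_room (size x).+2) (size x + (1 + (size x + 3)))); [|lia|by []].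
apply: treach_trans; first by apply: sw; exact: leqnn.
rewrite drop_size conf_nil.
have E : mdelta start q None = (mk P pExt false (inl start) [::] iI None,
   Some (inr (None, blankv Sig)), Rmove) by [].
apply: treach_step; [|by []|rewrite (step_right _ _ E)].
  by apply: leq_trans (size_conf _ _ _ _) _; rewrite size_rev size_rawcells /tape_room /=; lia.
by apply: (@tm_extend _ P start x v (size x) [::]) => //; rewrite cats0.
Qed.

End Simulation.

(** * Reading off the answer *)

Section Observation.
Variables (Sig : finType) (tsym : Sig).

(* Applying the computed string to [obs_true] and [obs_fun] exposes its letter as
   the shape of a value that contains no address even in heap mode. *)
Definition obs_true := lam (var 0).
Definition obs_branch (a : Sig) : term := if a == tsym then obs_true else lam obs_true.
Definition obs_fun := lams 2 (apps (var 1) (branches obs_branch)).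

Lemma val_obs_branch a : value (obs_branch a).
Proof. by rewrite /obs_branch; case: eqP. Qed.

Lemma val_obs_fun : value obs_fun.
Proof.
by rewrite /value /= /closed /= -/(apps _ _) bound_apps bound_branches //; apply: val_obs_branch.
Qed.

Definition obs_cost : nat :=
  let D := tsize obs_fun + #|Sig|.*2 + 20 in D.+4 * (20 * D).+1 + #|Sig|.

Lemma red_obs (c : Sig) :
  red (apps (enc_str [:: c]) [:: obs_true; obs_fun]) (obs_branch c) obs_cost obs_cost.
Proof.
have vf := val_obs_fun; have vb := val_obs_branch.
have ec := closed_enc_sym c; have sc := tsize_enc_sym c.
rewrite /obs_cost; set D := _ + _ + 20; set B := D.+4 * _ + _.
have HD : 20 * D + 40 <= B by rewrite /B; move: (#|Sig|) => z; nia.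
have sf : tsize obs_fun <= D by rewrite /D; lia.
have sS : #|Sig|.*2 + 20 <= D by rewrite /D; lia.
have sb : sizes (branches obs_branch) <= D.
  by apply: leq_trans sf; rewrite /obs_fun tsize_lams tsize_apps; lia.
apply: (@red_le _ _ (2 + (2 + #|Sig|)) B) => //; last by rewrite /B; lia.
apply: (@red_trans _ (apps obs_fun [:: enc_sym c; snil])).
  apply: (@red_case_cons (enc_sym c) snil) => //.
  by rewrite !sizes_cons (_ : sizes [::] = 0) // (_ : tsize snil = 4) // (_ : tsize obs_true = 2) //; lia.
apply: (@red_trans _ (apps (enc_sym c) (branches obs_branch))).
  have := @red_betas D (20 * D) (apps (var 1) (branches obs_branch)) [:: enc_sym c; snil] [::] B.
  have -> : substs (apps (var 1) (branches obs_branch)) [:: enc_sym c; snil] =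
     apps (enc_sym c) (branches obs_branch).
    by rewrite /= !subst_apps !(closed_branches vb) /= (closed_subst _ _ ec).
  apply=> //.
  - by move: sf; rewrite /obs_fun tsize_lams; lia.
  - by rewrite /= val_enc_sym.
  - by rewrite /= !sizes_cons (_ : sizes [::] = 0) // (_ : tsize snil = 4) //; lia.
  - by rewrite /B; lia.
by apply: red_enc_sym => //; lia.
Qed.

Variables (fsym : Sig) (Htf : tsym != fsym) (sf : term).

Definition observed (x : seq Sig) := app (app (app sf (enc_str x)) obs_true) obs_fun.

Lemma red_observed x b k sp :
  red (app sf (enc_str x)) (enc_str [:: if b then tsym else fsym]) k sp ->
  red (observed x) (lam (if b then var 0 else obs_true)) (k + obs_cost)
      (sp + obs_cost + tsize obs_fun + 10).
Proof.
move=> H; have -> : lam (if b then var 0 else obs_true) = obs_branch (if b then tsym else fsym).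
  by rewrite /obs_branch; case: b {H}; rewrite ?eqxx // eq_sym (negPf Htf).
apply: red_trans.
  by apply: (red_le (red_appL obs_fun (red_appL obs_true H))) => //; rewrite (_ : tsize obs_true = 2) //; lia.
by apply: (red_le (red_obs _)) => //; lia.
Qed.

End Observation.

(** * Running the evaluator *)

Section Trace.
Variables (Sig : finType) (sf a1 a2 : term) (x : seq Sig).
Local Notation P := (fun b => prog Sig b sf a1 a2).
Local Notation trace := (trace P lLd0 x).
Local Notation init := (init_state sf a1 a2 x).
Local Notation stage b i := (iter i (anext b) init).

Lemma fits_tot s (st : stacks (asym Sig)) : tot st <= s -> fits s st.
Proof.
move=> H; apply/forallP=> i; apply: leq_trans H.
by case: st => *; case: i; rewrite /tot /=; lia.
Qed.

Lemma tot_fits s (st : stacks (asym Sig)) : fits s st -> tot st <= 10 * s.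
Proof.
move=> /forallP H; move: (H iI) (H iT) (H iV) (H iX) (H iY) (H iD) (H iE) (H iH) (H iG) (H iK).
by case: st {H} => cI cT cV cX cY cD cE cH cG cK; rewrite /tot /=; lia.
Qed.

(** Ten stacks confined to [s] cells hold at most [10 * s] symbols; the rest is the quadratic cost
    from [reach_anext]. *)
Definition round_cost s := 20 * (10 * s).+1 * (10 * s).+1.

(** For the last clause: a prefix that goes beyond a stage passes through its representation, which
    therefore fits on [s] cells, so the next round costs at most [round_cost s]. Only this local
    argument is available when the full run needs more room. *)
Lemma trace_stage b Z i :
  (forall j, j < i -> ready (stage b j)) ->
  (forall j, j <= i -> tot (rep Sig (stage b j)) <= Z) ->
  exists m, [/\ trace b m = (inl lMain, rep Sig (stage b i)),
    (forall j, j < m -> exists l, (trace b j).1 = inl l),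
    (forall j, j <= m -> tot (trace b j).2 <= 4 * Z + 10) &
    (forall s k, k <= m -> (forall j, j < k -> fits s (trace b j).2) ->
       k <= 2 * size x + 3 + i * round_cost s)].
Proof.
elim: i => [|i IH] Hr Ht.
  have HZ := Ht 0 isT.
  have Hl : 2 * tot (rep Sig init) + 10 <= 4 * Z + 10 by move: HZ => /=; lia.
  have /reach_iter[m [h1 h2 h3 h4]] := reach_load b Hl.
  exists m; split; [exact: h2|exact: h4|exact: h3|].
  by move=> s k Hk _; lia.
have [m [h1 h2 h3 h4]] := IH (fun j Hj => Hr j (ltnW Hj)) (fun j Hj => Ht j (leqW Hj)).
have Z1 := Ht i (leqnSn i); have Z2 := Ht i.+1 (leqnn _).
have Hn : 3 * tot (rep Sig (stage b i)) + tot (rep Sig (anext b (stage b i))) + 5 <= 4 * Z + 10.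
  by move: Z2; rewrite iterS; lia.
have /reach_iter[d [g1 g2 g3 g4]] := reach_anext sf a1 a2 (Hr i (ltnSn i)) Hn.
have tr j : trace b (j + m) = iter j (sstep (prog Sig b sf a1 a2)) (inl lMain, rep Sig (stage b i)).
  by rewrite /trace iterD -/(trace b m) h1.
exists (d + m); split.
- by rewrite tr g2.
- move=> j Hj; case: (ltnP j m) => [/h2 //|le]; rewrite -(subnK le) tr; apply: g4; lia.
- move=> j Hj; case: (leqP j m) => [/h3 //|/ltnW le]; rewrite -(subnK le) tr; apply: g3; lia.
- move=> s k Hk Hf; rewrite mulSn; case: (leqP k m) => [le|gt].
    by have := h4 s k le Hf; lia.
  have := h4 s m (leqnn m) (fun j Hj => Hf j (ltn_trans Hj gt)).
  have := tot_fits (Hf m gt); rewrite h1 /= => T10.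
  have : d <= round_cost s.
    apply: leq_trans g1 _; rewrite /round_cost -!mulnA leq_mul2l /=.
    by apply: leq_mul; rewrite ltnS.
  by lia.
Qed.

Lemma trace_halts b Z n q H :
  stage b n = ([::], [:: q], H) ->
  (forall j, j < n -> ready (stage b j)) ->
  (forall j, j <= n -> tot (rep Sig (stage b j)) <= Z) ->
  exists m, [/\ (trace b m).1 = inr (verdict q),
    (forall j, j < m -> exists l, (trace b j).1 = inl l),
    (forall j, j <= m -> fits (4 * Z + 10) (trace b j).2) &
    (forall s k, k <= m -> (forall j, j < k -> fits s (trace b j).2) ->
       k <= 2 * size x + 6 + n * round_cost s)].
Proof.
move=> En Hr Ht; have [m [h1 h2 h3 h4]] := trace_stage Hr Ht.
have Hv : tot (rep Sig ([::], [:: q], H)) <= 4 * Z + 10 by rewrite -En; have := Ht n (leqnn n); lia.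
have [s0 [/reach_iter[d [g1 g2 g3 g4]] _]] := reach_verdict b sf a1 a2 Hv.
have tr j : trace b (j + m) = iter j (sstep (prog Sig b sf a1 a2)) (inl lMain, rep Sig ([::], [:: q], H)).
  by rewrite /trace iterD -/(trace b m) h1 En.
exists (d + m); split.
- by rewrite tr g2.
- move=> j Hj; case: (ltnP j m) => [/h2 //|le]; rewrite -(subnK le) tr; apply: g4; lia.
- move=> j Hj; apply: fits_tot; case: (leqP j m) => [/h3 //|/ltnW le].
  by rewrite -(subnK le) tr; apply: g3; lia.
- move=> s k Hk Hf; case: (leqP k m) => [le|gt]; first by have := h4 s k le Hf; lia.
  by have := h4 s m (leqnn m) (fun j Hj => Hf j (ltn_trans Hj gt)); lia.
Qed.

End Trace.

(** An address cannot stand for [var 0], since heap cells denote abstractions; an unresolved body is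
    therefore correctly read as [false]. *)
Lemma verdict_unf U q b : all value U ->
  unf U q = (if b then var 0 else obs_true) -> verdict q = b.
Proof.
move=> vU; case: q => [[|n]|a|s t|s]; case: b => //= E.
by have := value_nth a vU; rewrite E.
Qed.

Section LtoTM.
Variables (Sig : finType) (tsym fsym : Sig) (Htf : tsym != fsym) (sf : term).
Variables (f : seq Sig -> bool) (T S : nat -> nat).
Hypothesis csf : closed sf.
Hypothesis sf_computes : forall x, red (app sf (enc_str x))
  (enc_str [:: if f x then tsym else fsym]) (T (size x)) (S (size x)).

Let a1 := obs_true.
Let a2 := obs_fun tsym.
Let P b := prog Sig b sf a1 a2.

Definition obs_time := obs_cost tsym.
Definition obs_space := obs_cost tsym + tsize a2 + 10.
(** [csize] is at most twice [tsize], and an encoded letter contributes at most [#|Sig|.*2 + 5] to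
    the size of the input. *)
Definition code_const := 2 * (tsize sf + tsize a2 + 10) + (#|Sig|.*2 + 5).*2.

Definition rounds n := 1 + 3 * (T n + obs_time).
Definition height_subst n := 4 * (3 * (S n + obs_space)) + 10.
Definition height_heap n := 4 * heap_bound (code_const * n.+1) (rounds n) + 10.
(** [T] and [S] are not assumed to be related, so neither estimate dominates the other: the space
    bound will use the first half of the minimum, the time bound the second. The summand [n.+1] is
    the size of the first attempt. *)
Definition height n := n.+1 + minn (height_subst n) (height_heap n).
Definition tau n s := 2 * n + 6 + rounds n * round_cost s.
Definition machine_time n :=
  2 * n + 5 + (height n).+1 * (2 * (tau n (height n) * step_cost P (height n))).
Definition machine_space n := tape_room (height n).+2.

Lemma csize_emb t : csize (emb t) <= 2 * tsize t.
Proof. by elim: t => //= [n|s IHs t IHt|s IHs]; lia. Qed.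

Lemma machine_halts x : exists2 c, halted (P := P) (start := lLd0) (f x) c &
  treach (tape_room (height (size x)).+2) (machine_time (size x))
    (init_config (machine P lLd0) x) c.
Proof.
set n := size x.
pose t0 := observed tsym sf x.
have ct0 : closed t0.
  rewrite /t0 /observed /closed /= -/(closed sf) csf -/(closed (enc_str x)) closed_enc_str.
  exact: val_closed (val_obs_fun tsym).
have r0 := red_observed Htf (sf_computes x); rewrite -/n in r0.
have sN : csize (emb t0) <= code_const * n.+1.
  apply: leq_trans (csize_emb _) _; rewrite /t0 /observed.
  have := tsize_enc_str x; rewrite -/n => He.
  have -> : tsize (app (app (app sf (enc_str x)) obs_true) (obs_fun tsym)) =
    tsize sf + tsize (enc_str x) + tsize a2 + 5.
    by rewrite /a2; move: (obs_fun tsym) (enc_str x) => u v /=; lia.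
  by rewrite /code_const; nia.
have main b Z :
  (forall j n', n' <= rounds n -> (forall i, i < n' -> ready (iter i (anext b) (init_state sf a1 a2 x))) ->
     j <= n' -> (exists t U, inv t (iter j (anext b) (init_state sf a1 a2 x)) U /\ tsize t <= S n + obs_space) ->
     tot (rep Sig (iter j (anext b) (init_state sf a1 a2 x))) <= Z) ->
  exists m, [/\ (trace P lLd0 x b m).1 = inr (f x),
    (forall j, j < m -> exists l, (trace P lLd0 x b j).1 = inl l),
    (forall j, j <= m -> fits (4 * Z + 10) (trace P lLd0 x b j).2) &
    (forall s k, k <= m -> (forall j, j < k -> fits s (trace P lLd0 x b j).2) ->
       k <= tau n s)].
  move=> HZ.
  have [n' [q [H [U [Hn Hst Hu vU [Hr Hi]]]]]] := run_inv b r0 (inv_init ct0).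
  have Hn' : n' <= rounds n by move: Hn; rewrite /rounds /obs_time /=; lia.
  have tb j : j <= n' -> tot (rep Sig (iter j (anext b) (init_state sf a1 a2 x))) <= Z.
    move=> Hj; apply: (HZ j n' Hn' Hr Hj); have [t [U' [h1 h2]]] := Hi j Hj.
    by exists t, U'; split=> //; move: h2; rewrite /obs_space /a2; lia.
  have [m [h1 h2 h3 h4]] := trace_halts Hst Hr tb.
  exists m; split=> //; first by rewrite h1 (verdict_unf vU Hu).
  move=> s k Hk Hf; apply: leq_trans (h4 s k Hk Hf) _.
  by rewrite /tau leq_add2l leq_mul2r Hn' orbT.
have bf : forall j n', n' <= rounds n ->
    (forall i, i < n' -> ready (iter i (anext false) (init_state sf a1 a2 x))) -> j <= n' ->
    (exists t U, inv t (iter j (anext false) (init_state sf a1 a2 x)) U /\ tsize t <= S n + obs_space) ->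
    tot (rep Sig (iter j (anext false) (init_state sf a1 a2 x))) <= 3 * (S n + obs_space).
  move=> j n' _ _ _ [t [U [It st]]]; move: It.
  have := @iter_nil j (init_state sf a1 a2 x) erefl.
  case: (iter _ _ _) => [[T' V] H] /= -> It.
  by apply: leq_trans (tot_rep_subst Sig It) _; rewrite leq_mul2l.
have bt : forall j n', n' <= rounds n ->
    (forall i, i < n' -> ready (iter i (anext true) (init_state sf a1 a2 x))) -> j <= n' ->
    (exists t U, inv t (iter j (anext true) (init_state sf a1 a2 x)) U /\ tsize t <= S n + obs_space) ->
    tot (rep Sig (iter j (anext true) (init_state sf a1 a2 x)))
      <= heap_bound (code_const * n.+1) (rounds n).
  move=> j n' Hn' Hr Hj [t [U [It _]]].
  have h0 : heap_inv (code_const * n.+1) 0 (init_state sf a1 a2 x).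
    split=> //; last by rewrite muln1; apply: leq_trans (size_flat _) sN.
    by apply/and3P; split=> //; exact: (flat_small sN).
  have Ij := heap_inv_iter h0 Hr Hj.
  apply: leq_trans (tot_rep_heap Sig It Ij) _; rewrite /heap_bound -!mulnA !leq_mul2l.
  by apply/orP; right; apply/orP; right; apply: leq_mul; lia.
have [mf [f1 f2 f3 f4]] := main false _ bf.
have [mt [t1 t2 t3 t4]] := main true _ bt.
pose N (b : bool) := if b then mt else mf.
have halts b : (trace P lLd0 x b (N b)).1 = inr (f x) by case: b.
have runs b j : j < N b -> exists l, (trace P lLd0 x b j).1 = inl l.
  by case: b; [apply: t2|apply: f2].
have fast b s m : m <= N b -> (forall j, j < m -> fits s (trace P lLd0 x b j).2) -> m <= tau n s.
  by case: b; [apply: t4|apply: f4].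
have mono s s' : s <= s' -> tau n s <= tau n s'.
  move=> le; rewrite /tau leq_add2l leq_mul2l; apply/orP; right.
  by rewrite /round_cost -!mulnA leq_mul2l; apply/orP; right; apply: leq_mul; lia.
(* The smaller of the two estimates names the mode that is sure to succeed. *)
have [b0 Hb0] : exists b0, forall j, j <= N b0 -> fits (height n) (trace P lLd0 x b0 j).2.
  have fm s s' st : s <= s' -> fits s st -> fits (Sig := Sig) s' st.
    by move=> le /forallP H; apply/forallP=> i; apply: leq_trans (H i) le.
  rewrite /height; case: leqP => _; [exists false|exists true] => j Hj.
    by apply: fm (f3 j Hj); rewrite leq_addl.
  by apply: fm (t3 j Hj); rewrite leq_addl.
have E : height n = n.+1 + (height n - n.+1) by rewrite /height; lia.
have [||c hc Hc] := tm_total halts runs fast mono Hb0 (d := height n - n.+1) (s := n.+1).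
- by [].
- by rewrite -E.
exists c => //; rewrite -E in Hc.
apply: (treach_le (treach_trans (treach_le (tm_conv P lLd0 x) (leqnn _) _) Hc)) => //.
- by rewrite /tape_room -/n /height; lia.
- by rewrite /machine_time leq_add2l leq_mul2r; apply/orP; right; rewrite ltnS leq_subr.
Qed.

Lemma machine_computes : TM_computes (machine P lLd0) f machine_time machine_space.
Proof.
move=> x; have [c hc /treach_iter[m [h1 h2 h3 h4]]] := machine_halts x.
by exists m; split=> //; rewrite h2.
Qed.

End LtoTM.

(** * Polynomial bounds *)

Section PolyBounds.
Variable y : nat -> nat.
Hypothesis y_gt0 : forall n, 0 < y n.

(** The bound holds for all [n] and [y] is positive, so exponents can be raised freely and closure
    under sums and products is immediate. Asymptotics enter only in [polyb_bigO]. *)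
Definition polyb (g : nat -> nat) : Prop := exists c e, forall n, g n <= c * y n ^ e.

Lemma polyb_le g h : (forall n, g n <= h n) -> polyb h -> polyb g.
Proof. by move=> le [c [e H]]; exists c, e => n; apply: leq_trans (H n). Qed.

Lemma polyb_const c : polyb (fun=> c).
Proof. by exists c, 0 => n; rewrite expn0 muln1. Qed.

Lemma polyb_base : polyb y.
Proof. by exists 1, 1 => n; rewrite expn1 mul1n. Qed.

Lemma polyb_add g h : polyb g -> polyb h -> polyb (fun n => g n + h n).
Proof.
move=> [c [e Hg]] [c' [e' Hh]]; exists (c + c'), (e + e') => n.
rewrite mulnDl expnD; apply: leq_add.
  by apply: leq_trans (Hg n) _; rewrite leq_mul2l leq_pmulr ?orbT // expn_gt0 y_gt0.
by apply: leq_trans (Hh n) _; rewrite leq_mul2l leq_pmull ?orbT // expn_gt0 y_gt0.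
Qed.

Lemma polyb_mul g h : polyb g -> polyb h -> polyb (fun n => g n * h n).
Proof.
move=> [c [e Hg]] [c' [e' Hh]]; exists (c * c'), (e + e') => n.
by rewrite expnD mulnACA; apply: leq_mul.
Qed.

Lemma polyb_succ g : polyb g -> polyb (fun n => (g n).+1).
Proof.
move=> H; apply: (polyb_le (h := fun n => g n + 1)) => [n|]; first by rewrite addn1.
by apply: polyb_add => //; apply: polyb_const.
Qed.

End PolyBounds.

Lemma peval_monomial e t : peval (rcons (nseq e 0) 1) t = t ^ e.
Proof.
rewrite /peval size_rcons size_nseq big_ord_recr /= big1 ?add0n => [|i _].
  by rewrite nth_rcons size_nseq ltnn eqxx mul1n.
by rewrite nth_rcons size_nseq ltn_ord nth_nseq ltn_ord mul0n.
Qed.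

(** From [n0.+1] on, [n] is positive and hence so is [T n]; therefore [T n + n.+1 <= (k + 2) * T n],
    and the factor is absorbed by the constant. *)
Lemma polyb_bigO T g : OmegaLin T -> polyb (fun n => T n + n.+1) g ->
  exists p, bigO g (fun n => peval p (T n)).
Proof.
move=> [k [n0 HT]] [c [e Hg]]; exists (rcons (nseq e 0) 1), (c * (k + 2) ^ e), n0.+1 => n Hn.
have HTn := HT n (ltnW Hn).
have T1 : 0 < T n by case: (T n) HTn => //; rewrite muln0; lia.
rewrite peval_monomial; apply: leq_trans (Hg n) _; rewrite -mulnA -expnMn leq_mul2l.
by apply/orP; right; case: e {Hg} => // e; rewrite leq_exp2r //; nia.
Qed.

Lemma linear_bigO S a b c : OmegaLin S -> bigO (fun n => a * n + b * S n + c) S.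
Proof.
move=> [k [n0 HS]]; exists (a * k + b + c), n0.+1 => n Hn.
have HSn := HS n (ltnW Hn).
have S1 : 0 < S n by case: (S n) HSn => //; rewrite muln0; lia.
rewrite !mulnDl -mulnA; apply: leq_add; last by rewrite leq_pmulr.
by apply: leq_add => //; rewrite leq_mul2l HSn orbT.
Qed.

Lemma bigO_le g h S : (forall n, g n <= h n) -> bigO h S -> bigO g S.
Proof. by move=> le [c [n0 H]]; exists c, n0 => n /H; apply: leq_trans. Qed.

Ltac polyb :=
  lazymatch goal with
  | |- polyb _ (fun _ => ?c) => exact: polyb_const
  | |- polyb ?y (fun n => @?g n + @?h n) => apply: (@polyb_add y _ g h); [assumption|polyb|polyb]
  | |- polyb ?y (fun n => @?g n * @?h n) => apply: (@polyb_mul y g h); polyb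
  | |- polyb ?y (fun n => (@?g n).+1) => apply: (@polyb_succ y _ g); [assumption|polyb]
  | |- _ => assumption
  end.

Lemma polyb_machine_time (Sig : finType) (tsym : Sig) sf T S :
  polyb (fun n => T n + n.+1) (machine_time tsym sf T S).
Proof.
set y := fun n => T n + n.+1.
have y0 n : 0 < y n by rewrite /y addnS.
have pT : polyb y T by apply: (polyb_le (h := y)) (polyb_base y) => n; exact: leq_addr.
have pn : polyb y id by apply: (polyb_le (h := y)) (polyb_base y) => n; rewrite /y; lia.
have pr : polyb y (rounds tsym T) by rewrite /rounds; polyb.
have ph : polyb y (height tsym sf T S).
  (* [S] may exceed every polynomial in [T], so the minimum is estimated by its heap half. *)
  apply: (polyb_le (h := fun n => n.+1 + height_heap tsym sf T n)).
    by move=> n; rewrite leq_add2l geq_minr.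
  by rewrite /height_heap /heap_bound; polyb.
by rewrite /machine_time /tau /step_cost /round_cost; polyb.
Qed.

Unset Implicit Arguments.

Theorem theorem2 (Sig : finType) (tsym fsym : Sig) (Htf : tsym != fsym)
    (f : seq Sig -> bool) (T S : nat -> nat)
    (HT : OmegaLin T) (HS : OmegaLin S) :
  (L_computable tsym fsym f T S ->
     exists (p : seq nat) (M : TM Sig) (T' S' : nat -> nat),
       [/\ TM_computes M f T' S',
           bigO T' (fun n => peval p (T n)) &
           bigO S' S])
  /\
  ((exists M : TM Sig, TM_computes M f T S) ->
     exists (p : seq nat) (T' S' : nat -> nat),
       [/\ L_computable tsym fsym f T' S',
           bigO T' (fun n => peval p (T n)) &
           bigO S' S]).
Proof.
split.
- case=> sf [csf Hsf].
  have Hr x := reduces_within_red (Hsf x).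
  have [p Hp] := polyb_bigO HT (polyb_machine_time tsym sf T S).
  exists p, (machine (fun b => prog Sig b sf obs_true (obs_fun tsym)) lLd0),
    (machine_time tsym sf T S), (machine_space tsym sf T S); split=> //.
    exact: (machine_computes Htf csf Hr).
  (* Here the copying half of the minimum is used; the slope [12 = 4 * 3] comes from
     [height_subst]. *)
  apply: bigO_le (linear_bigO 1 12 (12 * obs_space tsym + 20) HS) => n.
  rewrite /machine_space /tape_room /height /height_subst.
  by have := geq_minl (4 * (3 * (S n + obs_space tsym)) + 10) (height_heap tsym sf T n); lia.
- case=> M HM; have HL := L_computable_of_TM tsym fsym HM.
  set T' := (fun n => _) in HL; set S' := (fun n => _) in HL.
  have [|p Hp] := @polyb_bigO T T' HT.
    set y := fun n => T n + n.+1.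
    have y0 n : 0 < y n by rewrite /y addnS.
    have pT : polyb y T by apply: (polyb_le (h := y)) (polyb_base y) => n; exact: leq_addr.
    have pn : polyb y id by apply: (polyb_le (h := y)) (polyb_base y) => n; rewrite /y; lia.
    by rewrite /T' /sim_time; polyb.
  exists p, T', S'; split=> //.
  rewrite /S' /sim_space; set A := conv_const _ + _; set B := space_const _ _ _.
  (* The part [A * n.+2], caused by the translation of the input, is absorbed because [S] grows at
     least linearly. *)
  by apply: bigO_le (linear_bigO A B (2 * A + B) HS) => n; rewrite (mulnS A n.+1) (mulnS A n) (mulnS B); lia.
Qed.
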